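(* Let $\mathrm E_2$ be the group of orientation-preserving isometries of the Euclidean plane, with Lie algebra $\mathfrak e_2$, and let $V\subset T_{\mathbb C}\mathrm E_2$ be the left-invariant line bundle whose value at the identity $e\in\mathrm E_2$ is spanned by $$L=\begin{pmatrix}0&-i&1\\i&0&0\\0&0&0\end{pmatrix}\in(\mathfrak e_2)_{\mathbb C}.$$ Then: (a) Every left-invariant CR structure on $\mathrm E_2$ is CR equivalent to $V$ by $\mathrm{Aut}(\mathrm E_2)$. (b) $V$ is an aspherical left-invariant CR structure on $\mathrm E_2$. (c) $V$ is realized in $\mathrm P((\mathfrak e_2)_{\mathbb C})=\mathbb{CP}^2$ by the adjoint orbit of $[L]$. This is CR equivalent to the real hypersurface $[\mathrm{Re}(z_1)]^2+[\mathrm{Re}(z_2)]^2=1$ in $\mathbb C^2$.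
   Context: $\mathrm E_2=\mathrm{SO}_2\rtimes\mathbb R^2$ is identified with the group of real matrices $\begin{pmatrix}R&\mathbf w\\0&1\end{pmatrix}$, $R\in\mathrm{SO}_2$, $\mathbf w\in\mathbb R^2$; its Lie algebra $\mathfrak e_2$ consists of the real matrices $\begin{pmatrix}0&-c&a\\c&0&b\\0&0&0\end{pmatrix}$, and $(\mathfrak e_2)_{\mathbb C}=\mathfrak e_2\otimes\mathbb C$. $\mathrm{Aut}(\mathrm E_2)$ is the group of Lie group automorphisms. $\mathrm E_2$ acts on $\mathrm P((\mathfrak e_2)_{\mathbb C})$ by the projectivized adjoint action. All CR structures are on smooth 3-manifolds and are non-degenerate. A CR structure on a 3-manifold $M$ is a complex line subbundle $V\subset T_{\mathbb C}M:=TM\otimes\mathbb C$ such that $V\cap\overline V=\{0\}$ and the sections of $V\oplus\overline V$ bracket-generate $T_{\mathbb C}M$. A real hypersurface $M$ in a complex 2-manifold $N$ carries the induced structure $V=T_{\mathbb C}M\cap T^{(0,1)}N$. A CR equivalence is a diffeomorphism $f$ with $(\mathrm df)_{\mathbb C}V_1=V_2$. A CR structure is spherical if every point has a neighborhood CR equivalent to an open subset of the unit sphere $S^3\subset\mathbb C^2$; a left-invariant CR structure is aspherical if it is not spherical. A CR structure on a Lie group is left-invariant if all left translations are CR equivalences. ''Realized by'' a hypersurface means CR equivalent to it. *)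

(* Defs.v *)
From HB Require Import structures.
From mathcomp Require Import all_boot all_order all_algebra.
From mathcomp Require Import all_classical all_reals all_analysis.
From mathcomp Require Import complex.

Set Implicit Arguments.
Unset Strict Implicit.
Unset Printing Implicit Defensive.

Import Order.TTheory GRing.Theory Num.Theory.
Import numFieldNormedType.Exports.

Local Open Scope classical_set_scope.
Local Open Scope ring_scope.

Fixpoint Ck_on (R : realType) (V W : normedModType R) (k : nat)
    (U : set V) (f : V -> W) : Prop :=
  match k with
  | 0 => forall x, U x -> {for x, continuous f}
  | k'.+1 => (forall x, U x -> differentiable f x) /\
             (forall v, Ck_on k' U (fun x => 'D_v f x))
  end.

Definition smooth_on (R : realType) (V W : normedModType R)
    (U : set V) (f : V -> W) : Prop := forall k, Ck_on k U f.

(* A complex matrix is split as A + iB; the derivatives of the library are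
   R-linear, and are extended to complex directions and complex-valued
   functions through this splitting. *)
Definition remx (R : realType) m n (A : 'M[R[i]]_(m, n)) : 'M[R]_(m, n) :=
  map_mx (@complex.Re R) A.

Definition immx (R : realType) m n (A : 'M[R[i]]_(m, n)) : 'M[R]_(m, n) :=
  map_mx (@complex.Im R) A.

Definition cplxmx (R : realType) m n (A B : 'M[R]_(m, n)) : 'M[R[i]]_(m, n) :=
  \matrix_(i, j) (A i j +i* B i j)%C.

Definition tocmx (R : realType) m n (A : 'M[R]_(m, n)) : 'M[R[i]]_(m, n) :=
  map_mx (real_complex R) A.

Definition conjmx (R : realType) m n (A : 'M[R[i]]_(m, n)) : 'M[R[i]]_(m, n) :=
  map_mx conjc A.

Definition csmooth_on (R : realType) n (U : set 'rV[R]_n)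
    (X : 'rV[R]_n -> 'rV[R[i]]_n) : Prop :=
  smooth_on U (fun x => remx (X x)) /\ smooth_on U (fun x => immx (X x)).

(* The C-linear extension (dF_x)_C of the differential of F at x. *)
Definition cdiff (R : realType) n p q (F : 'rV[R]_n -> 'M[R]_(p, q))
    (x : 'rV[R]_n) (v : 'rV[R[i]]_n) : 'M[R[i]]_(p, q) :=
  cplxmx ('D_(remx v) F x) ('D_(immx v) F x).

Definition cfield_diff (R : realType) n (X : 'rV[R]_n -> 'rV[R[i]]_n)
    (x : 'rV[R]_n) (v : 'rV[R[i]]_n) : 'rV[R[i]]_n :=
  cdiff (fun y => remx (X y)) x v + 'i%C *: cdiff (fun y => immx (X y)) x v.

Definition lie_bracket (R : realType) n (X Y : 'rV[R]_n -> 'rV[R[i]]_n) :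
    'rV[R]_n -> 'rV[R[i]]_n :=
  fun x => cfield_diff Y x (X x) - cfield_diff X x (Y x).

Record param (R : realType) (T : Type) (n : nat) := Param {
  pdom : set 'rV[R]_n;
  pmap : 'rV[R]_n -> T }.

Record space (R : realType) (T : Type) (n : nat) := Space {
  pts : set T;
  atlas : set (param R T n) }.

(* F represents f near x: pmap d \o F = f \o pmap c. *)
Definition local_rep (R : realType) (T1 T2 : Type) n1 n2
    (c : param R T1 n1) (d : param R T2 n2) (f : T1 -> T2)
    (x : 'rV[R]_n1) (F : 'rV[R]_n1 -> 'rV[R]_n2) : Prop :=
  exists W : set 'rV[R]_n1,
    [/\ open W, W x, W `<=` pdom c, smooth_on W F &
        forall y, W y -> pdom d (F y) /\ pmap d (F y) = f (pmap c y)].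

Definition open_in (R : realType) (T : Type) n (M : space R T n)
    (O : set T) : Prop :=
  O `<=` pts M /\
  forall c, atlas M c -> open [set x | pdom c x /\ O (pmap c x)].

(* f is smooth on O; continuity is part of the existence of local_rep. *)
Definition smooth_map (R : realType) (T1 T2 : Type) n1 n2
    (M : space R T1 n1) (O : set T1) (N : space R T2 n2) (f : T1 -> T2) : Prop :=
  forall c x d y, atlas M c -> pdom c x -> O (pmap c x) ->
    atlas N d -> pdom d y -> pmap d y = f (pmap c x) ->
    exists F, local_rep c d f x F.

(* The compatibility of the parametrizations is the smoothness of the
   identity; a countable cover by parametrizations amounts to second
   countability. *)
Record smooth_manifold (R : realType) (T : Type) n (M : space R T n) : Prop := {
  mfd_cover : forall p, pts M p <->
    exists c x, [/\ atlas M c, pdom c x & pmap c x = p];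
  mfd_open : forall c, atlas M c -> open (pdom c);
  mfd_inj : forall c x y, atlas M c -> pdom c x -> pdom c y ->
    pmap c x = pmap c y -> x = y;
  mfd_compat : smooth_map M (pts M) M id;
  mfd_hausdorff : forall p q, pts M p -> pts M q -> p <> q ->
    exists O1 O2, [/\ open_in M O1, open_in M O2, O1 p, O2 q &
                      O1 `&` O2 = set0];
  mfd_countable : exists D : set (param R T n),
    [/\ D `<=` atlas M, countable D &
        forall p, pts M p -> exists c x, [/\ D c, pdom c x & pmap c x = p]] }.

Definition diffeo_on (R : realType) (T1 T2 : Type) n1 n2
    (M1 : space R T1 n1) (O1 : set T1) (M2 : space R T2 n2) (O2 : set T2)
    (f : T1 -> T2) : Prop :=
  exists g : T2 -> T1,
    [/\ forall p, O1 p -> O2 (f p) /\ g (f p) = p,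
        forall q, O2 q -> O1 (g q) /\ f (g q) = q,
        smooth_map M1 O1 M2 f & smooth_map M2 O2 M1 g].

(* Embedded submanifolds: a parametrization of S is smooth into the ambient
   manifold X, covers a relatively open part of S, and its inverse is locally
   the restriction to S of a smooth function on X (hence it is an immersion and
   a homeomorphism onto its image). All of them form the atlas of S. *)
Definition euclid (R : realType) n : space R 'rV[R]_n n :=
  Space setT [set Param setT id].

Definition sub_param (R : realType) (T : Type) N m (X : space R T N)
    (S : set T) (c : param R T m) : Prop :=
  [/\ open (pdom c),
      forall x, pdom c x -> S (pmap c x),
      smooth_map (euclid R m) (pdom c) X (pmap c) &
      forall x, pdom c x -> exists (O : set T) (r : T -> 'rV[R]_m),
        [/\ open_in X O, O (pmap c x), smooth_map X O (euclid R m) r,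
            forall p, S p -> O p -> exists2 y, pdom c y & pmap c y = p &
            forall y, pdom c y -> O (pmap c y) -> r (pmap c y) = y]].

Definition sub_space (R : realType) (T : Type) N m (X : space R T N)
    (S : set T) : space R T m := Space S (sub_param X S).

Definition submanifold (R : realType) (T : Type) N m (X : space R T N)
    (S : set T) : Prop :=
  S `<=` pts X /\
  forall p, S p -> exists (c : param R T m) x,
    [/\ sub_param X S c, pdom c x & pmap c x = p].

(* C^n is R^(n + n) through z = x + iy. *)
Definition cvec (R : realType) n (v : 'rV[R]_(n + n)) : 'rV[R[i]]_n :=
  cplxmx (lsubmx v) (rsubmx v).

Definition cJ (K : pzRingType) n (v : 'rV[K]_(n + n)) : 'rV[K]_(n + n) :=
  row_mx (- rsubmx v) (lsubmx v).

Definition T01 (R : realType) n : set 'rV[R[i]]_(n + n) :=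
  [set w | cJ w = - 'i%C *: w].

(* The last condition is the Cauchy-Riemann equation for the changes of
   coordinates. *)
Definition complex_manifold (R : realType) (T : Type) n
    (N : space R T (n + n)) : Prop :=
  smooth_manifold N /\
  forall c d x F v, atlas N c -> atlas N d -> local_rep c d id x F ->
    'D_(cJ v) F x = cJ ('D_v F x).

Definition cspace (R : realType) n : space R 'rV[R[i]]_n (n + n) :=
  Space setT [set Param setT (@cvec R n)].

(* A field V of subsets of the complexified tangent spaces: V c x is the
   fibre at pmap c x, read in C^3 through (d(pmap c)_x)_C. *)
Definition cr_field (R : realType) (T : Type) :=
  param R T 3 -> 'rV[R]_3 -> set 'rV[R[i]]_3.

Definition cline (K : pzRingType) m n (v : 'M[K]_(m, n)) : set 'M[K]_(m, n) :=
  [set a *: v | a in setT].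

Definition VVbar (R : realType) (V : set 'rV[R[i]]_3) : set 'rV[R[i]]_3 :=
  [set u + conjmx v | u in V & v in V].

Definition complex_line_bundle (R : realType) (T : Type) (M : space R T 3)
    (V : cr_field R T) : Prop :=
  (forall c d x F, atlas M c -> atlas M d -> local_rep c d id x F ->
     cdiff F x @` V c x = V d (F x)) /\
  (forall c x, atlas M c -> pdom c x ->
     exists (W : set 'rV[R]_3) (X : 'rV[R]_3 -> 'rV[R[i]]_3),
       [/\ open W, W x, W `<=` pdom c, csmooth_on W X &
           forall y, W y -> X y <> 0 /\ V c y = cline (X y)]).

Inductive iterated_bracket (R : realType) (T : Type) (V : cr_field R T)
    (c : param R T 3) (W : set 'rV[R]_3) : ('rV[R]_3 -> 'rV[R[i]]_3) -> Prop :=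
| ib_section X : csmooth_on W X -> (forall y, W y -> VVbar (V c y) (X y)) ->
    iterated_bracket V c W X
| ib_bracket X Y : iterated_bracket V c W X -> iterated_bracket V c W Y ->
    iterated_bracket V c W (lie_bracket X Y).

Definition bracket_generating (R : realType) (T : Type) (M : space R T 3)
    (V : cr_field R T) : Prop :=
  forall c x, atlas M c -> pdom c x ->
    exists W : set 'rV[R]_3,
      [/\ open W, W x, W `<=` pdom c &
          forall w : 'rV[R[i]]_3,
            exists k (a : 'I_k -> R[i]) (X : 'I_k -> 'rV[R]_3 -> 'rV[R[i]]_3),
              (forall j, iterated_bracket V c W (X j)) /\
              w = \sum_j a j *: X j x].

Record cr_structure (R : realType) (T : Type) (M : space R T 3)
    (V : cr_field R T) : Prop := {
  cr_manifold : smooth_manifold M;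
  cr_line : complex_line_bundle M V;
  cr_transverse : forall c x, atlas M c -> pdom c x ->
    V c x `&` [set conjmx v | v in V c x] = [set 0];
  cr_nondegenerate : bracket_generating M V }.

Definition cr_equiv_on (R : realType) (T1 T2 : Type)
    (M1 : space R T1 3) (V1 : cr_field R T1) (O1 : set T1)
    (M2 : space R T2 3) (V2 : cr_field R T2) (O2 : set T2)
    (f : T1 -> T2) : Prop :=
  diffeo_on M1 O1 M2 O2 f /\
  forall c d x F, atlas M1 c -> atlas M2 d -> O1 (pmap c x) ->
    local_rep c d f x F -> cdiff F x @` V1 c x = V2 d (F x).

Definition cr_equiv (R : realType) (T1 T2 : Type)
    (M1 : space R T1 3) (V1 : cr_field R T1)
    (M2 : space R T2 3) (V2 : cr_field R T2) (f : T1 -> T2) : Prop :=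
  cr_equiv_on M1 V1 (pts M1) M2 V2 (pts M2) f.

Definition real_hypersurface (R : realType) (T : Type)
    (N : space R T (2 + 2)) (S : set T) : Prop :=
  complex_manifold N /\ submanifold 3 N S.

(* The structure T_C S `&` T^{0,1} N induced on a real hypersurface S of N:
   F is the inclusion, read in the parametrizations c of S and d of N. *)
Definition induced_cr (R : realType) (T : Type) (N : space R T (2 + 2)) :
    cr_field R T :=
  fun c x => [set v | exists d F,
    [/\ atlas N d, local_rep c d id x F & T01 (cdiff F x v)]].

Definition sphere3 (R : realType) : set 'rV[R[i]]_2 :=
  [set z | \sum_j `|z 0 j| ^+ 2 = 1].

Definition spherical (R : realType) (T : Type) (M : space R T 3)
    (V : cr_field R T) : Prop :=
  forall p, pts M p ->
    exists (O : set T) (O' : set 'rV[R[i]]_2) (f : T -> 'rV[R[i]]_2),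
      [/\ open_in M O, O p,
          open_in (sub_space 3 (cspace R 2) (@sphere3 R)) O' &
          cr_equiv_on M V O
            (sub_space 3 (cspace R 2) (@sphere3 R))
            (@induced_cr R _ (cspace R 2)) O' f].

Definition SO2 (R : realType) : set 'M[R]_2 :=
  [set A | A *m A^T = 1%:M /\ \det A = 1].

Definition E2 (R : realType) : set 'M[R]_3 :=
  [set g | exists (A : 'M[R]_2) (w : 'cV[R]_2),
     SO2 A /\ g = block_mx A w (0 : 'rV[R]_2) (1%:M : 'M[R]_1)].

Definition mxspace3 (R : realType) : space R 'M[R]_3 (3 * 3) :=
  Space setT [set Param setT (@vec_mx R 3 3)].

Definition E2_space (R : realType) : space R 'M[R]_3 3 :=
  sub_space 3 (mxspace3 R) (@E2 R).

Definition left_invariant (R : realType) (V : cr_field R 'M[R]_3) : Prop :=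
  forall h, E2 h -> cr_equiv (E2_space R) V (E2_space R) V (fun g => h *m g).

Definition E2_aut (R : realType) (phi : 'M[R]_3 -> 'M[R]_3) : Prop :=
  diffeo_on (E2_space R) (@E2 R) (E2_space R) (@E2 R) phi /\
  forall g h, E2 g -> E2 h -> phi (g *m h) = phi g *m phi h.

Definition mx3_of_rows (K : pzRingType) (s : seq (seq K)) : 'M[K]_3 :=
  \matrix_(i, j) nth 0 (nth [::] s i) j.

Definition e2_mx (K : pzRingType) (a b c : K) : 'M[K]_3 :=
  mx3_of_rows [:: [:: 0; - c; a]; [:: c; 0; b]; [:: 0; 0; 0]].

(* e_2 for K = R, and its complexification for K = R[i]. *)
Definition e2_alg (K : pzRingType) : set 'M[K]_3 :=
  [set X | exists a b c, X = e2_mx a b c].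

(* The differential at the identity of the left translation by g is X |-> g X,
   tangent vectors to E_2 being viewed as matrices. *)
Definition left_line_field (R : realType) (X : 'M[R[i]]_3) :
    cr_field R 'M[R]_3 :=
  fun c x => [set v | cline (tocmx (pmap c x) *m X) (cdiff (pmap c) x v)].

Definition e2_L (R : realType) : 'M[R[i]]_3 :=
  mx3_of_rows [:: [:: 0; - 'i%C; 1]; [:: 'i%C; 0; 0]; [:: 0; 0; 0]].

Definition E2_V (R : realType) : cr_field R 'M[R]_3 :=
  left_line_field (@e2_L R).

(* Affine chart k: the homogeneous coordinate k is 1, the two others are
   given by z. *)
Definition homog (R : realType) (k : 'I_3) (z : 'rV[R[i]]_2) : 'rV[R[i]]_3 :=
  \row_j (if unlift k j is Some l then z 0 l else 1).

Definition e2_of_row (R : realType) (z : 'rV[R[i]]_3) : 'M[R[i]]_3 :=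
  e2_mx (z 0 0) (z 0 1) (z 0 2%:R).

Definition P_e2 (R : realType) : space R (set 'M[R[i]]_3) (2 + 2) :=
  Space [set P | exists X, [/\ e2_alg X, X <> 0 & P = cline X]]
        [set Param setT (fun v : 'rV[R]_(2 + 2) =>
               cline (e2_of_row (homog k (cvec v)))) | k in setT].

Definition Ad (R : realType) (g : 'M[R]_3) (X : 'M[R[i]]_3) : 'M[R[i]]_3 :=
  tocmx g *m X *m invmx (tocmx g).

Definition Ad_orbit (R : realType) (X : 'M[R[i]]_3) : set (set 'M[R[i]]_3) :=
  [set P | exists2 g, E2 g & P = Ad g @` cline X].

Definition tube (R : realType) : set 'rV[R[i]]_2 :=
  [set z | complex.Re (z 0 0) ^+ 2 + complex.Re (z 0 1) ^+ 2 = 1].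

(* Main.v *)
(* (a) Left invariance makes W the field of lines spanned by a left-invariant field
   X = (a, b, e) in (e_2)_C. Bracket generation forces e <> 0 and transversality
   forces X not to be proportional to its conjugate; conjugation by a similarity of
   the plane then carries X to a multiple of L.

   (b) With M = conj L and N = [L, M] one has [N, M] = L + M and [N, L] = - (L + M).
   A local CR equivalence with the sphere is a pair of functions f1, f2 killed by L
   with |f1|^2 + |f2|^2 = 1, and M f1, M f2 do not vanish together. These relations
   are contradictory in any commutative ring with such derivations where 9 <> 0;
   this is applied to the ring of smooth complex functions on a small open set.

   (c) g |-> (g_00 + i g_12, g_10 - i g_02) maps E_2 onto the tube and carries L to
   (0,1)-vectors; in the affine chart of the projective plane where the last
   coordinate is 1, the orbit of [L] is the image of the tube under z |-> - i z. *)

From HB Require Import structures.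
From mathcomp Require Import all_boot all_order all_algebra.
From mathcomp Require Import all_classical all_reals all_analysis.
From mathcomp Require Import complex.
From mathcomp Require Import ring.
Require Import Defs.

Set Implicit Arguments.
Unset Strict Implicit.
Unset Printing Implicit Defensive.

Import Order.TTheory GRing.Theory Num.Theory.
Import numFieldNormedType.Exports.

Local Open Scope classical_set_scope.
Local Open Scope ring_scope.

(** * Smooth maps *)

(** The atlas of a submanifold holds all its parametrizations, so statements about E_2 quantify over
    charts of unknown form. They are tamed by reading tangent vectors as matrices: at [g = pmap c x]
    the map [cdiff (pmap c) x] is injective, with image the products of [tocmx g] with elements of
    (e_2)_C. Identities between fields become identities between matrices, and brackets become
    commutators. Explicit charts serve to prove that the spaces are manifolds and to compute this
    image once. Asphericity needs one analytic fact, the symmetry of second derivatives: it makes a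
    bracket of fields act on functions as the commutator of the two derivations. The rest is
    algebra. The sphere enters only through the norm condition on f = (f1, f2) and L f = 0; these
    make M f a multiple mu of the unit vector (- conj f2, conj f1), and the bracket relations
    overdetermine mu. Working in a ring of functions, and not with values at a point, allows each
    identity to be differentiated again. In (c) the factor - i appears because [Ad g] keeps the
    rotation entry i of L, so making the last homogeneous coordinate 1 divides the two others by
    i. *)

Lemma differentiable_near_eq (R : realType) (V W : normedModType R)
    (f g : V -> W) (x : V) :
  (\near x, f x = g x) -> differentiable f x -> differentiable g x.
Proof.
move=> fg df.
have [dfc fE] := (diff_locallyP x f).1 df.
have gE : g \o shift x = cst (g x) + 'd f x +o_ 0 id.
  apply/eqaddoP => _/posnumP[e].
  have /eqaddoP/(_ e%:num (ltac:(by [])))/= := fE => fe.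
  have fg0 : \forall y \near (0 : V), f (y + x) = g (y + x).
    have := fg; rewrite (near_shift 0 x) => H; near=> y.
    have : (fun z => f z = g z) (y + x); last by [].
    near: y; move: H; apply: filter_app; near=> z.
    by rewrite /= subr0.
  near=> y.
  have fgy : f (y + x) = g (y + x) by near: y.
  have fey : `|(f \o shift x - (cst (f x) + 'd f x)) y| <= e%:num * `|y|.
    by near: y; exact: fe.
  by move: fey; rewrite !fctE /= fgy (nbhs_singleton fg).
have gd : 'd g x = 'd f x :> (V -> W) by exact: diff_unique.
by apply/diff_locallyP; rewrite gd.
Unshelve. all: by end_near. Qed.

Lemma near_open (T : topologicalType) (U : set T) (x : T) (P : T -> Prop) :
  open U -> U x -> (forall y, U y -> P y) -> \near x, P x.
Proof.
by move=> oU Ux UP; apply: filterS (open_nbhs_nbhs (conj oU Ux)).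
Qed.

Lemma Ck_onS (R : realType) (V W : normedModType R) k (U : set V) (f : V -> W) :
  Ck_on k.+1 U f -> Ck_on k U f.
Proof.
elim: k f => [|k IH] f [df Df]; first by move=> x Ux; exact/differentiable_continuous/df.
by split=> // v; apply/IH/Df.
Qed.

Lemma Ck_on_sub (R : realType) (V W : normedModType R) k (U U' : set V) (f : V -> W) :
  U' `<=` U -> Ck_on k U f -> Ck_on k U' f.
Proof.
move=> U'U; elim: k f => [|k IH] f /=; first by move=> fc x /U'U /fc.
by move=> [df Df]; split=> [x /U'U /df //|v]; apply/IH/Df.
Qed.

(** A derivative at a point depends only on the germ there, and on an open [U] equality on [U] is
    equality of germs. This is how a function is traded for a formula that is valid on [U] only. *)
Lemma Ck_on_ext (R : realType) (V W : normedModType R) k (U : set V) (f g : V -> W) :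
  open U -> (forall x, U x -> f x = g x) -> Ck_on k U f -> Ck_on k U g.
Proof.
move=> oU; elim: k f g => [|k IH] f g fg /=.
  move=> fc x Ux; rewrite /prop_for /continuous_at -(fg x Ux).
  apply: cvg_trans (fc x Ux); apply: near_eq_cvg.
  exact: (@near_open _ U).
move=> [df Df]; split=> [x Ux|v].
  exact: differentiable_near_eq (near_open oU Ux fg) (df x Ux).
apply: IH (Df v) => x Ux; apply: near_eq_derive.
exact: (@near_open _ U).
Qed.

Lemma smooth_on_sub (R : realType) (V W : normedModType R) (U U' : set V) (f : V -> W) :
  U' `<=` U -> smooth_on U f -> smooth_on U' f.
Proof. by move=> U'U fs k; apply: Ck_on_sub (fs k). Qed.

Lemma smooth_on_ext (R : realType) (V W : normedModType R) (U : set V) (f g : V -> W) :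
  open U -> (forall x, U x -> f x = g x) -> smooth_on U f -> smooth_on U g.
Proof. by move=> oU fg fs k; apply: Ck_on_ext (fs k). Qed.

Lemma smooth_on_differentiable (R : realType) (V W : normedModType R) (U : set V)
  (f : V -> W) x : smooth_on U f -> U x -> differentiable f x.
Proof. by move=> /(_ 1%N)[df _] /df. Qed.

Lemma smooth_on_derive (R : realType) (V W : normedModType R) (U : set V)
  (f : V -> W) v : smooth_on U f -> smooth_on U (fun x => 'D_v f x).
Proof. by move=> fs k; have [_] := fs k.+1; apply. Qed.

Lemma smooth_on_cst (R : realType) (V W : normedModType R) (U : set V) (a : W) :
  smooth_on U (fun _ : V => a).
Proof.
move=> k; elim: k a => [|k IH] a /=; first by move=> x _; exact: cvg_cst.
split=> [x _|v]; first exact: differentiable_cst.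
have -> : (fun x => 'D_v (fun _ : V => a) x) = cst 0.
  by apply/funext => x; exact: derive_cst.
exact: IH.
Qed.

Lemma derive_coord (R : realType) m n (i : 'I_m) (j : 'I_n) (v x : 'M[R]_(m, n)) :
  'D_v (fun y : 'M[R]_(m, n) => y i j : R) x = v i j.
Proof.
have := derive_mx (@derivable_id _ _ x v); rewrite derive_id => /matrixP/(_ i j).
by rewrite mxE.
Qed.

Lemma smooth_on_coord (R : realType) m n (U : set 'M[R]_(m, n)) (i : 'I_m) (j : 'I_n) :
  smooth_on U (fun y : 'M[R]_(m, n) => y i j : R).
Proof.
case=> [|k] /=; first by move=> x _; exact: coord_continuous.
split=> [x _|v]; first exact: differentiable_coord.
have -> : (fun x => 'D_v (fun y : 'M[R]_(m, n) => y i j : R) x) = fun=> v i j.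
  by apply/funext => x; exact: derive_coord.
exact: smooth_on_cst.
Qed.

Lemma deriveDf (R : realType) (V W : normedModType R) (f g : V -> W) x v :
  differentiable f x -> differentiable g x ->
  'D_v (fun y => f y + g y) x = 'D_v f x + 'D_v g x.
Proof. by move=> df dg; apply: (@deriveD _ _ _ f g); exact: diff_derivable. Qed.

Lemma Ck_onD (R : realType) (V W : normedModType R) k (U : set V) (f g : V -> W) :
  open U -> Ck_on k U f -> Ck_on k U g -> Ck_on k U (fun x => f x + g x).
Proof.
move=> oU; elim: k f g => [|k IH] f g /=.
  by move=> fc gc x Ux; apply: (@cvgD _ _ _ _ _ f g); [exact: fc|exact: gc].
move=> [df Df] [dg Dg]; split=> [x Ux|v].
  by apply: (@differentiableD _ _ _ f g); [exact: df|exact: dg].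
apply: (Ck_on_ext oU _ (IH _ _ (Df v) (Dg v))) => x Ux.
by rewrite deriveDf //; [exact: df|exact: dg].
Qed.

Lemma deriveMf (R : realType) (V : normedModType R) (f g : V -> R) x v :
  differentiable f x -> differentiable g x ->
  'D_v (fun y => f y * g y) x = f x * 'D_v g x + g x * 'D_v f x.
Proof. by move=> df dg; apply: (@deriveM _ _ f g); exact: diff_derivable. Qed.

(** The Leibniz rule multiplies a derivative, known to order [k], by an undifferentiated factor,
    known to order [k.+1]; [Ck_onS] lowers the latter so that the induction hypothesis covers both
    products. *)
Lemma Ck_onM (R : realType) (V : normedModType R) k (U : set V) (f g : V -> R) :
  open U -> Ck_on k U f -> Ck_on k U g -> Ck_on k U (fun x => f x * g x).
Proof.
move=> oU; elim: k f g => [|k IH] f g.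
  by move=> fc gc x Ux; apply: (@cvgM _ _ _ _ f g); [exact: fc|exact: gc].
move=> Cf Cg; have [df Df] := Cf; have [dg Dg] := Cg; split=> [x Ux|v].
  by apply: (@differentiableM _ _ f g); [exact: df|exact: dg].
have := Ck_onD oU (IH _ _ (Ck_onS Cf) (Dg v)) (IH _ _ (Ck_onS Cg) (Df v)).
apply: Ck_on_ext => // x Ux.
by rewrite deriveMf //; [exact: df|exact: dg].
Qed.

Lemma deriveVf (R : realType) (V : normedModType R) (f : V -> R) x v :
  f x != 0 -> differentiable f x ->
  'D_v (fun y => (f y)^-1) x = - ((f x)^-1 * (f x)^-1) * 'D_v f x.
Proof.
move=> f0 df; rewrite (@deriveV _ _ f) //; last exact: diff_derivable.
by rewrite /GRing.scale /= expr2 invfM.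
Qed.

Lemma Ck_onV (R : realType) (V : normedModType R) k (U : set V) (f : V -> R) :
  open U -> (forall x, U x -> f x != 0) ->
  Ck_on k U f -> Ck_on k U (fun x => (f x)^-1).
Proof.
move=> oU f0; elim: k => [|k IH].
  by move=> fc x Ux; apply: (@cvgV _ _ _ _ f); [exact: f0|exact: fc].
move=> Cf; have [df Df] := Cf; split=> [x Ux|v].
  by apply: (@differentiableV _ _ f); [exact: df|exact: f0].
have IV := IH (Ck_onS Cf).
have := Ck_onM oU (Ck_onM oU (smooth_on_cst U (-1 : R) k) (Ck_onM oU IV IV)) (Df v).
apply: Ck_on_ext => // x Ux.
by rewrite deriveVf ?mulN1r //; [exact: f0|exact: df].
Qed.

Lemma smooth_onD (R : realType) (V W : normedModType R) (U : set V) (f g : V -> W) :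
  open U -> smooth_on U f -> smooth_on U g -> smooth_on U (fun x => f x + g x).
Proof. by move=> oU fs gs k; apply: Ck_onD. Qed.

Lemma smooth_onM (R : realType) (V : normedModType R) (U : set V) (f g : V -> R) :
  open U -> smooth_on U f -> smooth_on U g -> smooth_on U (fun x => f x * g x).
Proof. by move=> oU fs gs k; apply: Ck_onM. Qed.

Lemma smooth_onV (R : realType) (V : normedModType R) (U : set V) (f : V -> R) :
  open U -> (forall x, U x -> f x != 0) ->
  smooth_on U f -> smooth_on U (fun x => (f x)^-1).
Proof. by move=> oU f0 fs k; apply: Ck_onV. Qed.

Lemma smooth_onN (R : realType) (V : normedModType R) (U : set V) (f : V -> R) :
  open U -> smooth_on U f -> smooth_on U (fun x => - f x).
Proof.
move=> oU fs; have := smooth_onM oU (smooth_on_cst U (-1 : R)) fs.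
by apply: smooth_on_ext => // x _; rewrite mulN1r.
Qed.

Lemma smooth_onB (R : realType) (V : normedModType R) (U : set V) (f g : V -> R) :
  open U -> smooth_on U f -> smooth_on U g -> smooth_on U (fun x => f x - g x).
Proof. by move=> oU fs gs; apply: smooth_onD => //; apply: smooth_onN. Qed.

Lemma Ck_on_sum (R : realType) (V W : normedModType R) k (U : set V) (I : Type)
    (s : seq I) (f : I -> V -> W) :
  open U -> (forall i, Ck_on k U (f i)) -> Ck_on k U (fun x => \sum_(i <- s) f i x).
Proof.
move=> oU fs; elim: s => [|i s IH].
  by apply: (Ck_on_ext oU _ (smooth_on_cst U 0 k)) => x _; rewrite big_nil.
by apply: (Ck_on_ext oU _ (Ck_onD oU (fs i) IH)) => x _; rewrite big_cons.
Qed.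

Lemma smooth_on_sum (R : realType) (V W : normedModType R) (U : set V) (I : Type)
    (s : seq I) (f : I -> V -> W) :
  open U -> (forall i, smooth_on U (f i)) -> smooth_on U (fun x => \sum_(i <- s) f i x).
Proof. by move=> oU fs k; apply: Ck_on_sum => // i; apply: fs. Qed.

Lemma differentiable_mx (R : realType) (V : normedModType R) m n
    (f : V -> 'M[R]_(m, n)) x :
  (forall i j, differentiable (fun y => f y i j : R) x) -> differentiable f x.
Proof.
move=> df.
have -> : f = \sum_(i < m) \sum_(j < n) (fun y => (f y i j : R) *: (delta_mx i j : 'M[R]_(m, n))).
  apply/funext => y; rewrite [LHS]matrix_sum_delta fct_sumE.
  by apply: eq_bigr => i _; rewrite fct_sumE.
apply: differentiable_sum => i; apply: differentiable_sum => j.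
exact: differentiableZl.
Qed.

Lemma differentiable_entry (R : realType) (V : normedModType R) m n
    (f : V -> 'M[R]_(m, n)) x i j :
  differentiable f x -> differentiable (fun y => f y i j : R) x.
Proof.
move=> df; apply: (@differentiable_comp _ _ _ _ f (fun A : 'M[R]_(m, n) => A i j : R)) => //.
exact: differentiable_coord.
Qed.

Lemma derive_entry (R : realType) (V : normedModType R) m n
    (f : V -> 'M[R]_(m, n)) x v i j :
  differentiable f x -> 'D_v (fun y => f y i j : R) x = ('D_v f x) i j.
Proof. by move=> df; rewrite derive_mx ?mxE //; exact: diff_derivable. Qed.

Lemma Ck_on_mx (R : realType) (V : normedModType R) m n k (U : set V)
    (f : V -> 'M[R]_(m, n)) : open U ->
  Ck_on k U f <-> forall i j, Ck_on k U (fun x => f x i j : R).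
Proof.
move=> oU; elim: k f => [|k IH] f; split.
- move=> fc i j x Ux.
  apply: (@continuous_comp _ _ _ f (fun A : 'M[R]_(m, n) => A i j : R)); first exact: fc.
  exact: coord_continuous.
- move=> fc x Ux; apply/cvgrPdist_le => e e0.
  near=> y.
  rewrite /Num.Def.normr/= mx_normrE (bigmax_le _ (ltW e0))//= => i _.
  rewrite !mxE/=; move: i; near: y; apply: filter_forall => /= i.
  by have /cvgrPdist_le := fc i.1 i.2 x Ux; apply.
- move=> [df Df] i j; split=> [x Ux|v]; first exact/differentiable_entry/df.
  apply: (Ck_on_ext oU _ ((IH _).1 (Df v) i j)) => x Ux.
  by rewrite derive_entry //; exact: df.
- move=> Cf; split=> [x Ux|v].
    by apply: differentiable_mx => i j; have [+ _] := Cf i j; apply.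
  apply/IH => i j; have [dij Dij] := Cf i j.
  apply: (Ck_on_ext oU _ (Dij v)) => x Ux; rewrite derive_entry //.
  by apply: differentiable_mx => i' j'; have [+ _] := Cf i' j'; apply.
Unshelve. all: by end_near. Qed.

Lemma smooth_on_mx (R : realType) (V : normedModType R) m n (U : set V)
    (f : V -> 'M[R]_(m, n)) : open U ->
  (forall i j, smooth_on U (fun x => f x i j : R)) -> smooth_on U f.
Proof. by move=> oU fs k; apply/(Ck_on_mx k _ oU) => i j; apply: fs. Qed.

Lemma smooth_on_entry (R : realType) (V : normedModType R) m n (U : set V)
    (f : V -> 'M[R]_(m, n)) i j : open U ->
  smooth_on U f -> smooth_on U (fun x => f x i j : R).
Proof. by move=> oU fs k; move: i j; apply/(Ck_on_mx k _ oU). Qed.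

Lemma derive_sum_coord (R : realType) (W : normedModType R) n (f : 'rV[R]_n -> W) x v :
  differentiable f x -> 'D_v f x = \sum_j v 0 j *: 'D_(delta_mx 0 j) f x.
Proof.
move=> df; rewrite deriveE // {1}(row_sum_delta v) linear_sum.
by apply: eq_bigr => j _; rewrite linearZ /= -deriveE.
Qed.

Lemma derive_comp (R : realType) (V : normedModType R) m (W : normedModType R)
    (f : V -> 'rV[R]_m) (g : 'rV[R]_m -> W) x v :
  differentiable f x -> differentiable g (f x) ->
  'D_v (fun y => g (f y)) x = 'D_('D_v f x) g (f x).
Proof.
move=> df dg; rewrite deriveE; last exact: differentiable_comp.
by rewrite (diff_comp df dg) /= -!deriveE.
Qed.

(** The chain rule, written in coordinates as the sum over j of (D_v f)_j times (d_j g) o f,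
    expresses a derivative of the composite by composites of lower order. The induction therefore
    varies [g] and keeps [f]. *)
Lemma Ck_on_comp (R : realType) (V : normedModType R) m k (U : set V)
    (U' : set 'rV[R]_m) (f : V -> 'rV[R]_m) (g : 'rV[R]_m -> R) :
  open U -> (forall x, U x -> U' (f x)) ->
  Ck_on k U f -> Ck_on k U' g -> Ck_on k U (fun x => g (f x)).
Proof.
move=> oU fU; elim: k g => [|k IH] g.
  move=> fc gc x Ux; apply: (@continuous_comp _ _ _ f g); first exact: fc.
  by apply: gc; exact: fU.
move=> Cf Cg; have [df Df] := Cf; have [dg Dg] := Cg; split=> [x Ux|v].
  by apply: (@differentiable_comp _ _ _ _ f g); [exact: df|exact/dg/fU].
have : Ck_on k U (fun x => \sum_j ('D_v f x) 0 j * 'D_(delta_mx 0 j) g (f x)).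
  apply: Ck_on_sum => // j; apply: Ck_onM => //.
    exact: ((Ck_on_mx k _ oU).1 (Df v)).
  exact: (IH (fun z => 'D_(delta_mx 0 j) g z) (Ck_onS Cf) (Dg _)).
apply: Ck_on_ext => // x Ux.
have dfx := df x Ux; have dgx := dg _ (fU x Ux).
by rewrite derive_comp // (@derive_sum_coord _ _ _ g).
Qed.

Lemma smooth_on_comp (R : realType) (V : normedModType R) m p q (U : set V)
    (U' : set 'rV[R]_m) (f : V -> 'rV[R]_m) (g : 'rV[R]_m -> 'M[R]_(p, q)) :
  open U -> open U' -> (forall x, U x -> U' (f x)) ->
  smooth_on U f -> smooth_on U' g -> smooth_on U (fun x => g (f x)).
Proof.
move=> oU oU' fU fs gs; apply: smooth_on_mx => // i j k.
by apply: (Ck_on_comp (g := fun z => g z i j) oU fU (fs k)); apply: smooth_on_entry.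
Qed.

Lemma smooth_on_comp1 (R : realType) (V : normedModType R) m (U : set V)
    (U' : set 'rV[R]_m) (f : V -> 'rV[R]_m) (g : 'rV[R]_m -> R) :
  open U -> (forall x, U x -> U' (f x)) ->
  smooth_on U f -> smooth_on U' g -> smooth_on U (fun x => g (f x)).
Proof. by move=> oU fU fs gs k; exact: (Ck_on_comp oU fU (fs k) (gs k)). Qed.

Lemma smooth_on_id (R : realType) m n (U : set 'M[R]_(m, n)) : smooth_on U id.
Proof.
have : smooth_on setT (id : 'M[R]_(m, n) -> _).
  apply: smooth_on_mx; [exact: openT|move=> i j; exact: smooth_on_coord].
exact: smooth_on_sub.
Qed.

Lemma continuous_on_open (R : realType) (V W : normedModType R) (U : set V)
   (O : set W) (f : V -> W) :
  open U -> smooth_on U f -> open O -> open [set x | U x /\ O (f x)].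
Proof.
move=> oU fs oO; rewrite openE => x [Ux Ofx]; rewrite /interior.
have fc : {for x, continuous f} by exact: (fs 0%N).
have nU : nbhs x U by exact: open_nbhs_nbhs.
have nO : nbhs x (f @^-1` O) by apply: fc; exact: open_nbhs_nbhs.
exact: filterI.
Qed.

Lemma derive_shiftE (R : realType) (V W : normedModType R) (f : V -> W) (w x v : V) :
  'D_v (fun z => f (z + w)) x = 'D_v f (x + w).
Proof.
rewrite /derive; set g1 := fun h => h^-1 *: _; set g2 := fun h => h^-1 *: _.
suff -> : g1 = g2 by [].
by apply/funext => h; rewrite /g1 /g2 /= addrA.
Qed.

Lemma differentiable_shift (R : realType) (V W : normedModType R) (f : V -> W) (w x : V) :
  differentiable f (x + w) -> differentiable (fun z => f (z + w)) x.
Proof.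
by move=> df; apply: (@differentiable_comp _ _ _ _ (fun z : V => z + w) f).
Qed.

Lemma MVT_line (R : realType) (V : normedModType R) (F : V -> R) (y u : V) (s : R) :
  0 <= s -> (forall t, 0 <= t <= s -> differentiable F (y + t *: u)) ->
  exists2 c, 0 <= c <= s & F (y + s *: u) - F y = 'D_u F (y + c *: u) * s.
Proof.
move=> s0 dF.
have dl (t : R) : differentiable (fun t : R => y + t *: u) t.
  by apply: (@differentiableD _ _ _ (cst y) (fun t : R => t *: u)); exact: ex_diff.
have dFt t : 0 <= t <= s -> differentiable (fun t : R => F (y + t *: u)) t.
  move=> ts; apply: (@differentiable_comp _ _ _ _ (fun t : R => y + t *: u) F) => //.
  exact: dF.
have DFt t : 0 <= t <= s -> is_derive t 1 (fun t : R => F (y + t *: u)) ('D_u F (y + t *: u)).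
  move=> ts; apply: DeriveDef; first exact/diff_derivable/dFt.
  rewrite /derive; set g1 := fun h => h^-1 *: _; set g2 := fun h => h^-1 *: _.
  suff -> : g1 = g2 by [].
  apply/funext => h; rewrite /g1 /g2 /=.
  by rewrite [_%:A]mulr1 scalerDl addrCA.
have [||c cs E] := @MVT_segment R (fun t => F (y + t *: u))
    (fun t => 'D_u F (y + t *: u)) 0 s s0.
- by move=> t /[!in_itv]/= /andP[/ltW t0 /ltW ts]; apply: DFt; rewrite t0 ts.
- apply: derivable_within_continuous => t; rewrite in_itv /= => ts.
  exact/diff_derivable/dFt.
exists c; first by move: cs; rewrite in_itv.
by move: E; rewrite scale0r addr0 subr0.
Qed.

(** The mean value theorem is applied twice: along [u] to z |-> f (z + s v) - f z, then along [v] to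
    the derivative of [f] in direction [u]. *)
Lemma second_difference (R : realType) (V : normedModType R) (U : set V)
    (f : V -> R) (x u v : V) (s : R) :
  open U -> Ck_on 2 U f -> 0 < s ->
  (forall a b, 0 <= a <= s -> 0 <= b <= s -> U (x + a *: u + b *: v)) ->
  exists c d, [/\ 0 <= c <= s, 0 <= d <= s &
    f (x + s *: u + s *: v) - f (x + s *: u) - (f (x + s *: v) - f x) =
    'D_v (fun z => 'D_u f z) (x + c *: u + d *: v) * s * s].
Proof.
move=> oU [df Df] s0 Us.
have s00 : 0 <= (0 : R) <= s by rewrite lexx ltW.
have ss : 0 <= s <= s by rewrite lexx ltW.
have Ux a : 0 <= a <= s -> U (x + a *: u).
  by move=> as_; have := Us a 0 as_ s00; rewrite scale0r addr0.
have dg t : 0 <= t <= s ->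
    differentiable (fun z => f (z + s *: v) - f z) (x + t *: u).
  move=> ts; apply: (@differentiableB _ _ _ (fun z => f (z + s *: v)) f).
    by apply: differentiable_shift; apply: df; exact: Us.
  by apply: df; exact: Ux.
have [c cs E] := MVT_line (ltW s0) dg.
have [d ds E'] : exists2 d, 0 <= d <= s &
   'D_u f (x + c *: u + s *: v) - 'D_u f (x + c *: u) =
   'D_v (fun z => 'D_u f z) (x + c *: u + d *: v) * s.
  have [Dfu _] := Df u; apply: (@MVT_line _ _ (fun z => 'D_u f z)) (ltW s0) _.
  by move=> t ts; apply: Dfu; exact: Us.
exists c, d; split => //; rewrite -E' E; congr (_ * _).
rewrite (@deriveB _ _ _ (fun z => f (z + s *: v)) f).
- by rewrite derive_shiftE.
- by apply: diff_derivable; apply: differentiable_shift; apply: df; exact: Us.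
- by apply: diff_derivable; apply: df; exact: Ux.
Qed.

Lemma ltr_dist2 (R : numDomainType) (a b c e : R) :
  `|a - c| < e -> `|b - c| < e -> `|a - b| < e + e.
Proof.
move=> ac bc; rewrite -(subrKA c) (le_lt_trans (ler_normD _ _)) //.
by rewrite ltrD // distrC.
Qed.

Lemma eq_derive (R : realType) (V W : normedModType R) (f g : V -> W) (x v : V) :
  (forall y, f y = g y) -> 'D_v f x = 'D_v g x.
Proof. by move=> fg; have -> : f = g by exact/funext. Qed.

(* Both mixed derivatives are, at points close to x, the value of the same second
   difference quotient. *)
Lemma deriveC (R : realType) (V : normedModType R) (U : set V)
    (f : V -> R) (x u v : V) :
  open U -> smooth_on U f -> U x ->
  'D_v (fun z => 'D_u f z) x = 'D_u (fun z => 'D_v f z) x.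
Proof.
move=> oU fs Ux; apply: contrapT => /eqP neq.
pose g (z : V) : R := 'D_v (fun z => 'D_u f z) z.
pose h (z : V) : R := 'D_u (fun z => 'D_v f z) z.
pose e : R := `|g x - h x| / 2.
have e0 : 0 < e by rewrite divr_gt0 // normr_gt0 subr_eq0.
have gc : {for x, continuous g}.
  exact: (smooth_on_derive v (smooth_on_derive u fs) 0%N).
have hc : {for x, continuous h}.
  exact: (smooth_on_derive u (smooth_on_derive v fs) 0%N).
have nU : \forall z \near x, [/\ U z, `|g x - g z| < e & `|h x - h z| < e].
  have n1 := open_nbhs_nbhs (conj oU Ux).
  have n2 : \forall z \near x, `|g x - g z| < e by have /cvgrPdist_lt := gc; apply.
  have n3 : \forall z \near x, `|h x - h z| < e by have /cvgrPdist_lt := hc; apply.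
  by apply: filterS3 n1 n2 n3.
have /nbhs_ballP[r /= r0 rU] := nU.
(* With [s * k = r / 2] the whole parallelogram with sides [s *: u] and [s *: v] stays in the ball
   of radius [r]; the summand 1 keeps [k] positive even if [u] and [v] vanish. *)
pose k := `|u| + `|v| + 1.
have k0 : 0 < k by rewrite /k ltr_wpDl // addr_ge0.
pose s := r / (2 * k).
have s0 : 0 < s by rewrite divr_gt0 // mulr_gt0.
have Us a b : 0 <= a <= s -> 0 <= b <= s -> ball x r (x + a *: u + b *: v).
  move=> /andP[a0 as_] /andP[b0 bs].
  rewrite -ball_normE /= -addrA opprD addrA subrr sub0r normrN.
  have : `|a *: u + b *: v| <= s * `|u| + s * `|v|.
    rewrite (le_trans (ler_normD _ _)) // !normrZ !ger0_norm // lerD //;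
    exact: ler_wpM2r.
  move=> /le_lt_trans; apply.
  have : s * k = r / 2 by rewrite /s; field; rewrite lt0r_neq0.
  rewrite /k mulrDr mulr1 -[s * `|u| + _]mulrDr => sk.
  rewrite -(addrK s (_ * _)) sk ltrBlDr (@lt_trans _ _ r) ?ltrDl //.
  by rewrite gtr_pMr // invf_lt1 ?ltr1n.
have Us' a b : 0 <= a <= s -> 0 <= b <= s -> U (x + a *: u + b *: v).
  by move=> ? ?; have [] := rU _ (Us a b _ _).
have Us2 a b : 0 <= a <= s -> 0 <= b <= s -> U (x + a *: v + b *: u).
  by move=> ? ?; rewrite addrAC; exact: Us'.
have [c [d [cs ds E1]]] := second_difference oU (fs 2%N) s0 Us'.
have [c' [d' [cs' ds' E2]]] := second_difference oU (fs 2%N) s0 Us2.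
have E : g (x + c *: u + d *: v) = h (x + c' *: v + d' *: u).
  apply: (mulIf (lt0r_neq0 s0)); apply: (mulIf (lt0r_neq0 s0)).
  rewrite -[LHS]E1 -[RHS]E2 [x + s *: v + s *: u]addrAC.
  by rewrite !opprB !addrA; ring.
have [_ g1 _] := rU _ (Us _ _ cs ds).
have [_ _] := rU _ (Us _ _ ds' cs'); rewrite addrAC -E => h1.
by have := ltr_dist2 g1 h1; rewrite /e -splitr ltxx.
Qed.

(** * Complex-valued functions and complex vector fields *)

Lemma ReD (R : rcfType) (x y : R[i]) : complex.Re (x + y) = complex.Re x + complex.Re y.
Proof. by case: x; case: y. Qed.
Lemma ImD (R : rcfType) (x y : R[i]) : complex.Im (x + y) = complex.Im x + complex.Im y.
Proof. by case: x; case: y. Qed.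
Lemma ReM (R : rcfType) (x y : R[i]) :
  complex.Re (x * y) = complex.Re x * complex.Re y - complex.Im x * complex.Im y.
Proof. by case: x; case: y. Qed.
Lemma ImM (R : rcfType) (x y : R[i]) :
  complex.Im (x * y) = complex.Re x * complex.Im y + complex.Im x * complex.Re y.
Proof. by case: x; case: y. Qed.
Lemma ReV (R : rcfType) (x : R[i]) :
  complex.Re x^-1 = complex.Re x / (complex.Re x ^+ 2 + complex.Im x ^+ 2).
Proof. by case: x. Qed.
Lemma ImV (R : rcfType) (x : R[i]) :
  complex.Im x^-1 = - complex.Im x / (complex.Re x ^+ 2 + complex.Im x ^+ 2).
Proof. by case: x => a b; rewrite mulNr. Qed.
Lemma eqC (R : rcfType) (x y : R[i]) :
  complex.Re x = complex.Re y -> complex.Im x = complex.Im y -> x = y.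
Proof. by case: x; case: y => a b c d /= -> ->. Qed.
Lemma norm2_neq0 (R : rcfType) (x : R[i]) :
  x != 0 -> complex.Re x ^+ 2 + complex.Im x ^+ 2 != 0.
Proof.
apply: contra; rewrite paddr_eq0 ?sqr_ge0 // !sqrf_eq0 => /andP[/eqP Er /eqP Ei].
exact/eqP/eqC.
Qed.

Definition csmooth (R : realType) (V : normedModType R) (U : set V) (u : V -> R[i]) :=
  smooth_on U (fun x => complex.Re (u x) : R) /\
  smooth_on U (fun x => complex.Im (u x) : R).

Definition cdifferentiable (R : realType) (V : normedModType R) (x : V) (u : V -> R[i]) :=
  differentiable (fun y => complex.Re (u y) : R) x /\
  differentiable (fun y => complex.Im (u y) : R) x.

Definition derivec (R : realType) (V : normedModType R) (v x : V) (u : V -> R[i]) : R[i] :=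
  ('D_v (fun y => complex.Re (u y) : R) x +i*
   'D_v (fun y => complex.Im (u y) : R) x)%C.

Section csmooth.
Variables (R : realType) (V : normedModType R) (U : set V).
Hypothesis oU : open U.
Implicit Types u w : V -> R[i].

Lemma csmooth_cdifferentiable u x : csmooth U u -> U x -> cdifferentiable x u.
Proof. by move=> [ur ui] Ux; split; exact: smooth_on_differentiable Ux. Qed.

Lemma csmooth_ext u w : (forall x, U x -> u x = w x) -> csmooth U u -> csmooth U w.
Proof.
by move=> uw [ur ui]; split; [apply: smooth_on_ext ur|apply: smooth_on_ext ui] => // x Ux; rewrite uw.
Qed.

Lemma csmooth_cst a : csmooth U (fun=> a).
Proof. by split; exact: smooth_on_cst. Qed.

Lemma csmooth_real (f : V -> R) : smooth_on U f -> csmooth U (fun x => (f x)%:C%C).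
Proof. by move=> fs; split => //; exact: smooth_on_cst. Qed.

Lemma csmooth_pair (f g : V -> R) : smooth_on U f -> smooth_on U g ->
  csmooth U (fun x => (f x +i* g x)%C).
Proof. by []. Qed.

Lemma csmoothD u w : csmooth U u -> csmooth U w -> csmooth U (fun x => u x + w x).
Proof.
move=> [ur ui] [wr wi]; split.
  by apply: (smooth_on_ext oU _ (smooth_onD oU ur wr)) => x _; rewrite ReD.
by apply: (smooth_on_ext oU _ (smooth_onD oU ui wi)) => x _; rewrite ImD.
Qed.

Lemma csmoothM u w : csmooth U u -> csmooth U w -> csmooth U (fun x => u x * w x).
Proof.
move=> [ur ui] [wr wi]; split.
  apply: (smooth_on_ext oU _ (smooth_onB oU (smooth_onM oU ur wr) (smooth_onM oU ui wi))).
  by move=> x _; rewrite ReM.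
apply: (smooth_on_ext oU _ (smooth_onD oU (smooth_onM oU ur wi) (smooth_onM oU ui wr))).
by move=> x _; rewrite ImM.
Qed.

Lemma csmoothN u : csmooth U u -> csmooth U (fun x => - u x).
Proof.
move=> us; apply: csmooth_ext (csmoothM (csmooth_cst (-1)) us) => x _.
by rewrite mulN1r.
Qed.

Lemma csmoothB u w : csmooth U u -> csmooth U w -> csmooth U (fun x => u x - w x).
Proof. by move=> us ws; apply: csmoothD => //; exact: csmoothN. Qed.

Lemma csmoothV u : (forall x, U x -> u x != 0) -> csmooth U u -> csmooth U (fun x => (u x)^-1).
Proof.
move=> u0 [ur ui].
have dV : smooth_on U (fun x => (complex.Re (u x) * complex.Re (u x) +
    complex.Im (u x) * complex.Im (u x))^-1 : R).
  apply: smooth_onV => // [x Ux|]; first by rewrite -!expr2 norm2_neq0 // u0.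
  by apply: smooth_onD => //; exact: smooth_onM.
split.
  apply: (smooth_on_ext oU _ (smooth_onM oU ur dV)) => x _.
  by rewrite ReV !expr2.
apply: (smooth_on_ext oU _ (smooth_onM oU (smooth_onN oU ui) dV)) => x _.
by rewrite ImV !expr2.
Qed.

Lemma csmoothJ u : csmooth U u -> csmooth U (fun x => conjc (u x)).
Proof.
move=> [ur ui]; split.
  by apply: smooth_on_ext ur => // x _; case: (u x).
by apply: (smooth_on_ext oU _ (smooth_onN oU ui)) => x _; case: (u x).
Qed.

Lemma csmooth_sum (I : Type) (s : seq I) (u : I -> V -> R[i]) :
  (forall i, csmooth U (u i)) -> csmooth U (fun x => \sum_(i <- s) u i x).
Proof.
move=> us; elim: s => [|i s IH].
  by apply: csmooth_ext (csmooth_cst 0) => x _; rewrite big_nil.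
by apply: csmooth_ext (csmoothD (us i) IH) => x _; rewrite big_cons.
Qed.

Lemma csmooth_derivec u v : csmooth U u -> csmooth U (fun x => derivec v x u).
Proof.
move=> [ur ui]; split.
  exact: (smooth_on_derive v ur).
exact: (smooth_on_derive v ui).
Qed.

Lemma derivecC u (v w x : V) : csmooth U u -> U x ->
  derivec v x (fun y => derivec w y u) = derivec w x (fun y => derivec v y u).
Proof.
move=> [ur ui] Ux; apply: eqC; first exact: (deriveC w v oU ur Ux).
exact: (deriveC w v oU ui Ux).
Qed.

Lemma derivec_ext u w v x : U x -> (forall y, U y -> u y = w y) -> derivec v x u = derivec v x w.
Proof.
move=> Ux uw; rewrite /derivec; congr (_ +i* _)%C; apply: near_eq_derive;
  apply: (near_open oU Ux) => y Uy; by rewrite uw.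
Qed.

Lemma csmooth_comp m (W : set 'rV[R]_m) (f : V -> 'rV[R]_m) (u : 'rV[R]_m -> R[i]) :
  (forall x, U x -> W (f x)) -> smooth_on U f -> csmooth W u -> csmooth U (fun x => u (f x)).
Proof.
by move=> fU fs [ur ui]; split; [exact: (smooth_on_comp1 oU fU fs ur)|exact: (smooth_on_comp1 oU fU fs ui)].
Qed.

End csmooth.

Section derivec.
Variables (R : realType) (V : normedModType R) (x : V).
Implicit Types u w : V -> R[i].

Lemma derivecD v u w : cdifferentiable x u -> cdifferentiable x w ->
  derivec v x (fun y => u y + w y) = derivec v x u + derivec v x w.
Proof.
move=> [ur ui] [wr wi]; rewrite /derivec; apply: eqC; rewrite ?(ReD,ImD) /=.
  rewrite -(deriveDf v ur wr); apply: eq_derive => y; exact: ReD.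
rewrite -(deriveDf v ui wi); apply: eq_derive => y; exact: ImD.
Qed.

Lemma derivec_cst v a : derivec v x (fun=> a) = 0.
Proof. by rewrite /derivec; apply: eqC => /=; exact: derive_cst. Qed.

Lemma derivecM v u w : cdifferentiable x u -> cdifferentiable x w ->
  derivec v x (fun y => u y * w y) = derivec v x u * w x + u x * derivec v x w.
Proof.
move=> [ur ui] [wr wi]; rewrite /derivec; apply: eqC; rewrite ?(ReD,ImD,ReM,ImM) /=.
  rewrite (eq_derive x v (fun y => ReM (u y) (w y))).
  have := @deriveB _ _ _ _ _ x v (diff_derivable (differentiableM ur wr))
    (diff_derivable (differentiableM ui wi)).
  by rewrite (deriveMf v ur wr) (deriveMf v ui wi) => E; rewrite [LHS]E; ring.
rewrite (eq_derive x v (fun y => ImM (u y) (w y))).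
have := deriveDf v (differentiableM ur wi) (differentiableM ui wr).
by rewrite (deriveMf v ur wi) (deriveMf v ui wr) => E; rewrite [LHS]E; ring.
Qed.

Lemma derivecJ v u : cdifferentiable x u -> derivec v x (fun y => conjc (u y)) = conjc (derivec v x u).
Proof.
move=> [ur ui]; rewrite /derivec; apply: eqC => /=.
  by apply: eq_derive => y; case: (u y).
rewrite -(deriveN (diff_derivable ui)).
apply: eq_derive => y; rewrite -[RHS]/(- complex.Im (u y)).
by case: (u y).
Qed.

Lemma derivec_real v (f : V -> R) : derivec v x (fun y => (f y)%:C%C) = ('D_v f x)%:C%C.
Proof. by rewrite /derivec; apply: eqC => //=; exact: derive_cst. Qed.

Lemma cdifferentiable_real (f : V -> R) : differentiable f x -> cdifferentiable x (fun y => (f y)%:C%C).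
Proof. by move=> df; split => //; exact: differentiable_cst. Qed.

Lemma cdifferentiable_cst a : cdifferentiable x (fun _ : V => a).
Proof. by split; exact: differentiable_cst. Qed.

End derivec.

Opaque derive diff.

Lemma derive_sum_entry (R : realType) n p q (f : 'rV[R]_n -> 'M[R]_(p, q)) x v i k :
  differentiable f x ->
  ('D_v f x) i k = \sum_j v 0 j * ('D_(delta_mx 0 j) f x) i k.
Proof.
move=> df; rewrite (derive_sum_coord v df) summxE.
by apply: eq_bigr => j _; rewrite mxE.
Qed.

(* The derivative of u in the complexified direction v. *)
Definition cderive (R : realType) n (v : 'rV[R[i]]_n) (x : 'rV[R]_n)
    (u : 'rV[R]_n -> R[i]) : R[i] :=
  \sum_j v 0 j * derivec (delta_mx 0 j) x u.

Lemma remx_cplxmx (R : realType) m n (A B : 'M[R]_(m, n)) : remx (cplxmx A B) = A.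
Proof. by apply/matrixP => i j; rewrite !mxE. Qed.
Lemma immx_cplxmx (R : realType) m n (A B : 'M[R]_(m, n)) : immx (cplxmx A B) = B.
Proof. by apply/matrixP => i j; rewrite !mxE. Qed.
Lemma cplxmxK (R : realType) m n (A : 'M[R[i]]_(m, n)) : cplxmx (remx A) (immx A) = A.
Proof. by apply/matrixP => i j; rewrite !mxE; case: (A i j). Qed.

Section cderive.
Variables (R : realType) (n : nat).
Implicit Types (u w : 'rV[R]_n -> R[i]) (v : 'rV[R[i]]_n) (x : 'rV[R]_n).

Lemma cderive_lin (a : R[i]) v v' x u : cderive (a *: v + v') x u = a * cderive v x u + cderive v' x u.
Proof.
rewrite /cderive mulr_sumr -big_split; apply: eq_bigr => j _ /=.
by rewrite !mxE mulrDl mulrA.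
Qed.

Lemma cderive0v x u : cderive 0 x u = 0.
Proof. by rewrite /cderive big1 // => j _; rewrite mxE mul0r. Qed.

Lemma cderiveDv v v' x u : cderive (v + v') x u = cderive v x u + cderive v' x u.
Proof. by have := cderive_lin 1 v v' x u; rewrite scale1r mul1r. Qed.

Lemma cderiveZv a v x u : cderive (a *: v) x u = a * cderive v x u.
Proof. by have := cderive_lin a v 0 x u; rewrite addr0 cderive0v addr0. Qed.

Lemma cderive_cst v x a : cderive v x (fun=> a) = 0.
Proof. by rewrite /cderive big1 // => j _; rewrite derivec_cst mulr0. Qed.

Lemma cderiveD v x u w : cdifferentiable x u -> cdifferentiable x w ->
  cderive v x (fun y => u y + w y) = cderive v x u + cderive v x w.
Proof.
move=> du dw; rewrite /cderive -big_split; apply: eq_bigr => j _ /=.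
by rewrite derivecD // mulrDr.
Qed.

Lemma cderiveM v x u w : cdifferentiable x u -> cdifferentiable x w ->
  cderive v x (fun y => u y * w y) = cderive v x u * w x + u x * cderive v x w.
Proof.
move=> du dw; rewrite /cderive mulr_suml mulr_sumr -big_split; apply: eq_bigr => j _ /=.
by rewrite derivecM // mulrDr !mulrA [u x * _]mulrC.
Qed.

Lemma cderiveZ v x a u : cdifferentiable x u -> cderive v x (fun y => a * u y) = a * cderive v x u.
Proof. by move=> du; rewrite cderiveM ?cderive_cst ?mul0r ?add0r //; exact: cdifferentiable_cst. Qed.

Lemma cderive_ext (U : set 'rV[R]_n) u w v x : open U -> U x ->
  (forall y, U y -> u y = w y) -> cderive v x u = cderive v x w.
Proof.
by move=> oU Ux uw; apply: eq_bigr => j _; rewrite (derivec_ext oU _ Ux uw).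
Qed.

Lemma cderiveJ v x u : cdifferentiable x u ->
  cderive (conjmx v) x (fun y => conjc (u y)) = conjc (cderive v x u).
Proof.
move=> du; rewrite /cderive rmorph_sum; apply: eq_bigr => j _.
by rewrite derivecJ // mxE rmorphM.
Qed.

Lemma csmooth_cderive (U : set 'rV[R]_n) (X : 'rV[R]_n -> 'rV[R[i]]_n) u : open U ->
  (forall j, csmooth U (fun x => X x 0 j)) -> csmooth U u -> csmooth U (fun x => cderive (X x) x u).
Proof.
move=> oU Xs us; apply: csmooth_sum => // j; apply: csmoothM => //; exact: csmooth_derivec.
Qed.

Lemma csmoothP (U : set 'rV[R]_n) (X : 'rV[R]_n -> 'rV[R[i]]_n) : open U ->
  csmooth_on U X <-> forall j, csmooth U (fun x => X x 0 j).
Proof.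
move=> oU; split.
  move=> [Xr Xi] j; split.
    by apply: (smooth_on_ext oU _ (smooth_on_entry 0 j oU Xr)) => x _; rewrite mxE.
  by apply: (smooth_on_ext oU _ (smooth_on_entry 0 j oU Xi)) => x _; rewrite mxE.
move=> Xs; split; apply: smooth_on_mx => // i j; have [Xr Xi] := Xs j.
  by apply: (smooth_on_ext oU _ Xr) => x _; rewrite mxE ord1.
by apply: (smooth_on_ext oU _ Xi) => x _; rewrite mxE ord1.
Qed.

(** Both sides are the C-bilinear expression in [v] and [X]: the left one splits into real and
    imaginary parts, the right one sums over coordinates. The right one is a derivation, which is
    the form used from here on. *)
Lemma cfield_diffE (U : set 'rV[R]_n) (X : 'rV[R]_n -> 'rV[R[i]]_n) x v k :
  open U -> csmooth_on U X -> U x ->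
  cfield_diff X x v 0 k = cderive v x (fun y => X y 0 k).
Proof.
move=> oU [Xr Xi] Ux; rewrite /cfield_diff /cdiff.
have dr := smooth_on_differentiable Xr Ux; have di := smooth_on_differentiable Xi Ux.
have A0 (A B C D : 'rV[R]_n) : (cplxmx A B + 'i%C *: cplxmx C D) 0 k =
    ((A 0 k - D 0 k) +i* (B 0 k + C 0 k))%C.
  by rewrite !mxE; apply: eqC => /=; ring.
rewrite A0 {A0}.
transitivity (((\sum_j remx v 0 j * ('D_(delta_mx 0 j) (fun y => remx (X y)) x) 0 k -
   \sum_j immx v 0 j * ('D_(delta_mx 0 j) (fun y => immx (X y)) x) 0 k)) +i*
   (\sum_j immx v 0 j * ('D_(delta_mx 0 j) (fun y => remx (X y)) x) 0 k +
   \sum_j remx v 0 j * ('D_(delta_mx 0 j) (fun y => immx (X y)) x) 0 k))%C.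
  by congr ((_ - _) +i* (_ + _))%C; exact: derive_sum_entry.
rewrite /cderive.
have E : forall j, derivec (delta_mx 0 j) x (fun y => X y 0 k) =
   (('D_(delta_mx 0 j) (fun y => remx (X y)) x) 0 k +i*
    ('D_(delta_mx 0 j) (fun y => immx (X y)) x) 0 k)%C.
  move=> j; rewrite -(derive_entry _ 0 k dr) -(derive_entry _ 0 k di).
  by apply: eqC; apply: eq_derive => y; rewrite mxE.
under [RHS]eq_bigr do rewrite E.
apply: eqC.
  rewrite [LHS]/= (big_morph (@complex.Re R) (@ReD R) (erefl _)) -sumrB.
  apply: eq_bigr => j _; rewrite ReM [LHS]/=.
  by congr (_ - _); congr (_ * _); rewrite mxE.
rewrite [LHS]/= (big_morph (@complex.Im R) (@ImD R) (erefl _)) -big_split.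
apply: eq_bigr => j _; rewrite ImM [LHS]/= addrC.
by congr (_ + _); congr (_ * _); rewrite mxE.
Qed.

Lemma lie_bracketE (U : set 'rV[R]_n) (X Y : 'rV[R]_n -> 'rV[R[i]]_n) x k :
  open U -> csmooth_on U X -> csmooth_on U Y -> U x ->
  lie_bracket X Y x 0 k =
  cderive (X x) x (fun y => Y y 0 k) - cderive (Y x) x (fun y => X y 0 k).
Proof.
move=> oU Xs Ys Ux; rewrite -(cfield_diffE _ k oU Xs Ux) -(cfield_diffE _ k oU Ys Ux).
by rewrite [LHS]mxE [X in _ + X]mxE.
Qed.

Lemma csmooth_lie_bracket (U : set 'rV[R]_n) (X Y : 'rV[R]_n -> 'rV[R[i]]_n) :
  open U -> csmooth_on U X -> csmooth_on U Y -> csmooth_on U (lie_bracket X Y).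
Proof.
move=> oU Xs Ys; apply/(csmoothP _ oU) => k.
have Xc := (csmoothP _ oU).1 Xs; have Yc := (csmoothP _ oU).1 Ys.
apply: (csmooth_ext oU (u := fun x =>
    cderive (X x) x (fun y => Y y 0 k) - cderive (Y x) x (fun y => X y 0 k))).
  by move=> x Ux; rewrite (lie_bracketE _ oU).
by apply: csmoothB => //; exact: csmooth_cderive.
Qed.

(** The coordinate definition of the bracket is the first-order part of the commutator of the two
    derivations; the second-order parts cancel by symmetry of the Hessian. *)
Lemma cderive_lie_bracket (U : set 'rV[R]_n) (X Y : 'rV[R]_n -> 'rV[R[i]]_n) u x :
  open U -> csmooth_on U X -> csmooth_on U Y -> csmooth U u -> U x ->
  cderive (lie_bracket X Y x) x u =
  cderive (X x) x (fun y => cderive (Y y) y u) - cderive (Y x) x (fun y => cderive (X y) y u).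
Proof.
move=> oU Xs Ys us Ux.
have Xc := (csmoothP _ oU).1 Xs; have Yc := (csmoothP _ oU).1 Ys.
(* The product rule separates the derivatives of the coefficients of [T] from the Hessian of [u]. *)
have E (Z T : 'rV[R]_n -> 'rV[R[i]]_n) : (forall j, csmooth U (fun x => T x 0 j)) ->
  cderive (Z x) x (fun y => cderive (T y) y u) =
  \sum_k cderive (Z x) x (fun y => T y 0 k) * derivec (delta_mx 0 k) x u +
  \sum_j \sum_k Z x 0 j * T x 0 k * derivec (delta_mx 0 j) x (fun y => derivec (delta_mx 0 k) y u).
  move=> Tc; rewrite {1 2}/cderive.
  transitivity (\sum_j Z x 0 j *
    \sum_k derivec (delta_mx 0 j) x (fun y => T y 0 k * derivec (delta_mx 0 k) y u)).
    apply: eq_bigr => j _; congr (_ * _).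
    have cs k : csmooth U (fun y => T y 0 k * derivec (delta_mx 0 k) y u).
      by apply: csmoothM => //; exact: csmooth_derivec.
    elim: (index_enum _) => [|k s IH].
      rewrite big_nil -[RHS](derivec_cst x (delta_mx 0 j) 0).
      by apply: (derivec_ext oU _ Ux) => y _; rewrite big_nil.
    rewrite big_cons -IH -derivecD.
    - by apply: (derivec_ext oU _ Ux) => y _; rewrite big_cons.
    - exact: (csmooth_cdifferentiable (cs k)).
    - exact: (csmooth_cdifferentiable (csmooth_sum oU _ cs)).
  under [X in X + _]eq_bigr do rewrite mulr_suml.
  rewrite exchange_big -big_split; apply: eq_bigr => j _ /=.
  rewrite mulr_sumr -big_split; apply: eq_bigr => k _ /=.
  rewrite (derivecM _ (csmooth_cdifferentiable (Tc k) Ux)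
    (csmooth_cdifferentiable (csmooth_derivec _ us) Ux)).
  by rewrite mulrDr !mulrA.
rewrite (E X Y) // (E Y X) // opprD addrACA [X in _ = _ + X](_ : _ = 0); last first.
  apply/eqP; rewrite subr_eq0 exchange_big; apply/eqP; apply: eq_bigr => j _.
  apply: eq_bigr => k _; rewrite [Y x 0 j * _]mulrC.
  by rewrite (derivecC oU _ _ us Ux).
rewrite addr0 -sumrB /cderive; apply: eq_bigr => k _.
by rewrite (lie_bracketE _ oU) // mulrBl.
Qed.

End cderive.

Section cdiff.
Variables (R : realType) (n p q : nat).
Implicit Types (F : 'rV[R]_n -> 'M[R]_(p, q)) (v : 'rV[R[i]]_n) (x : 'rV[R]_n).

Lemma cdiffE F v x i j : differentiable F x ->
  cdiff F x v i j = cderive v x (fun y => (F y i j)%:C%C).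
Proof.
move=> dF; rewrite mxE /cderive; apply: eqC; rewrite [LHS]/=.
  etransitivity; first exact: (derive_sum_entry (remx v) i j dF).
  rewrite (big_morph (@complex.Re R) (@ReD R) (erefl _)).
  by apply: eq_bigr => k _; rewrite derivec_real (derive_entry _ i j dF) ReM !mxE /= mulr0 subr0.
etransitivity; first exact: (derive_sum_entry (immx v) i j dF).
rewrite (big_morph (@complex.Im R) (@ImD R) (erefl _)).
by apply: eq_bigr => k _; rewrite derivec_real (derive_entry _ i j dF) ImM !mxE /= mulr0 add0r.
Qed.

Opaque cdiff cderive.

Lemma cdiffZ F a v x : differentiable F x -> cdiff F x (a *: v) = a *: cdiff F x v.
Proof.
move=> dF; apply/matrixP => i j; rewrite [in RHS]mxE.
etransitivity; first exact: cdiffE.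
by rewrite cderiveZv; congr (_ * _); symmetry; apply: cdiffE.
Qed.

Lemma cdiffD F v v' x : differentiable F x ->
  cdiff F x (v + v') = cdiff F x v + cdiff F x v'.
Proof.
move=> dF; apply/matrixP => i j; rewrite [in RHS]mxE.
etransitivity; first exact: cdiffE.
by rewrite cderiveDv; congr (_ + _); symmetry; apply: cdiffE.
Qed.

Lemma cdiff_conj F v x : differentiable F x ->
  cdiff F x (conjmx v) = conjmx (cdiff F x v).
Proof.
move=> dF; apply/matrixP => i j; rewrite [in RHS]mxE.
etransitivity; first exact: cdiffE.
transitivity (conjc (cderive v x (fun y => (F y i j)%:C%C))); last first.
  by congr conjc; symmetry; apply: cdiffE.
rewrite -cderiveJ; last by apply: cdifferentiable_real; exact: differentiable_entry.
congr cderive; apply/funext => y; by apply: eqC => //=; rewrite oppr0.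
Qed.

Transparent cdiff cderive.

Lemma cdiff_ext (U : set 'rV[R]_n) F G v x : open U -> U x ->
  (forall y, U y -> F y = G y) -> cdiff F x v = cdiff G x v.
Proof.
move=> oU Ux FG; rewrite /cdiff; congr cplxmx; apply: near_eq_derive;
exact: (near_open oU Ux).
Qed.

End cdiff.

Lemma cdiff_cplxmx (R : realType) n p q (F : 'rV[R]_n -> 'M[R]_(p, q)) x v :
  cdiff F x v = cplxmx ('D_(remx v) F x) ('D_(immx v) F x).
Proof. by []. Qed.

Lemma cdiff_comp (R : realType) n m p q (F : 'rV[R]_n -> 'rV[R]_m)
    (G : 'rV[R]_m -> 'M[R]_(p, q)) v x :
  differentiable F x -> differentiable G (F x) ->
  cdiff (fun y => G (F y)) x v = cdiff G (F x) (cdiff F x v).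
Proof.
move=> dF dG; rewrite /cdiff (derive_comp (remx v) dF dG) (derive_comp (immx v) dF dG).
by rewrite remx_cplxmx immx_cplxmx.
Qed.

Lemma cdiff_id (R : realType) n v (x : 'rV[R]_n) : cdiff id x v = v.
Proof. by rewrite /cdiff !derive_id cplxmxK. Qed.

Opaque cdiff cderive derivec.

(** * Charts, submanifolds and diffeomorphisms *)

Lemma open_setP (V : topologicalType) (A : set V) :
  (forall x, A x -> exists W, [/\ open W, W x & W `<=` A]) -> open A.
Proof.
move=> H; rewrite openE => x /H [W [oW Wx WA]].
exact: filterS WA (open_nbhs_nbhs (conj oW Wx)).
Qed.

(** [smooth_map] speaks of every chart around the image point and says nothing if there is none;
    this condition supplies one. It is stated apart from [smooth_manifold] so that the lemmas on
    smooth maps can be used in proving that a space is a manifold. *)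
Definition covered (R : realType) (T : Type) n (M : space R T n) :=
  forall p, pts M p -> exists c x, [/\ atlas M c, pdom c x & pmap c x = p].

Section local_rep.
Variables (R : realType).

Lemma local_rep_at T1 T2 n1 n2 (c : param R T1 n1) (d : param R T2 n2) f x F :
  local_rep c d f x F ->
  [/\ pdom c x, pdom d (F x), pmap d (F x) = f (pmap c x) & differentiable F x].
Proof.
move=> [W [oW Wx Wc sF FW]]; have [? ?] := FW x Wx; split=> //; first exact: Wc.
exact: smooth_on_differentiable sF Wx.
Qed.

Lemma local_rep_near T1 T2 n1 n2 (c : param R T1 n1) (d : param R T2 n2) f x F :
  local_rep c d f x F ->
  exists W, [/\ open W, W x, W `<=` pdom c, smooth_on W F & forall y, W y -> local_rep c d f y F].
Proof. by move=> [W [oW Wx Wc sF FW]]; exists W; split => // y Wy; exists W. Qed.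

Lemma local_rep_ext T1 T2 n1 n2 (c : param R T1 n1) (d : param R T2 n2) f g x F W :
  open W -> W x -> (forall y, W y -> pdom c y -> f (pmap c y) = g (pmap c y)) ->
  local_rep c d f x F -> local_rep c d g x F.
Proof.
move=> oW Wx fg [W' [oW' W'x W'c sF FW]]; exists (W `&` W'); split.
- exact: openI.
- by [].
- by move=> y [_ /W'c].
- by apply: smooth_on_sub sF => y [].
- by move=> y [Wy W'y]; have [? ?] := FW y W'y; split => //; rewrite -fg //; exact: W'c.
Qed.

Lemma local_rep_comp T1 T2 T3 n1 n2 n3 (c : param R T1 n1) (d : param R T2 n2)
    (e : param R T3 n3) f g x F G :
  local_rep c d f x F -> local_rep d e g (F x) G ->
  local_rep c e (fun p => g (f p)) x (fun y => G (F y)).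
Proof.
move=> [W [oW Wx Wc sF FW]] [W' [oW' W'x W'd sG GW']].
exists [set y | W y /\ W' (F y)]; split.
- exact: continuous_on_open.
- by [].
- by move=> y [/Wc].
- apply: (smooth_on_comp _ oW' _ _ sG); first exact: continuous_on_open.
    by move=> y [].
  by apply: smooth_on_sub sF => y [].
- move=> y [Wy W'y]; have [? E] := FW y Wy; have [? E'] := GW' _ W'y.
  by split => //; rewrite E' E.
Qed.

Lemma local_rep_uniq T1 T2 n1 n2 (c : param R T1 n1) (d : param R T2 n2) f x F G :
  (forall y z, pdom d y -> pdom d z -> pmap d y = pmap d z -> y = z) ->
  local_rep c d f x F -> local_rep c d f x G ->
  exists W, [/\ open W, W x & forall y, W y -> F y = G y].
Proof.
move=> dI [W [oW Wx Wc sF FW]] [W' [oW' W'x W'c sG GW']].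
exists (W `&` W'); split => //; first exact: openI.
move=> y [Wy W'y]; have [? E] := FW y Wy; have [? E'] := GW' y W'y.
by apply: dI => //; rewrite E E'.
Qed.

Lemma local_rep_id T n (c : param R T n) x : open (pdom c) -> pdom c x -> local_rep c c id x id.
Proof.
by move=> oc cx; exists (pdom c); split => //; exact: smooth_on_id.
Qed.

(** Injectivity of the chart turns g o f = id into G o F = id near [x], and the chain rule does the
    rest. The equation is asked on a neighbourhood only, because local equivalences are inverted on
    open subsets. *)
Lemma local_rep_cancel T1 T2 n1 n2 (c : param R T1 n1) (d : param R T2 n2) f g x F G W :
  open W -> W x -> (forall y, W y -> pdom c y -> g (f (pmap c y)) = pmap c y) ->
  open (pdom c) ->
  (forall y z, pdom c y -> pdom c z -> pmap c y = pmap c z -> y = z) ->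
  local_rep c d f x F -> local_rep d c g (F x) G ->
  G (F x) = x /\ forall v, cdiff G (F x) (cdiff F x v) = v.
Proof.
move=> oW Wx gf oc cI rF rG.
have [cx _ _ dF] := local_rep_at rF; have [_ _ _ dG] := local_rep_at rG.
have [W' [oW' W'x FG]] := local_rep_uniq cI
  (local_rep_ext (g := id) oW Wx gf (local_rep_comp rF rG)) (local_rep_id oc cx).
split; first exact: FG.
move=> v; rewrite -(cdiff_comp v dF dG) -[RHS](cdiff_id v x).
exact: cdiff_ext oW' W'x FG.
Qed.

Lemma local_rep_open T1 T2 n1 n2 (c : param R T1 n1) (N : space R T2 n2) d f x F O :
  atlas N d -> local_rep c d f x F -> open_in N O -> O (f (pmap c x)) ->
  exists W, [/\ open W, W x, W `<=` pdom c & forall y, W y -> O (f (pmap c y))].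
Proof.
move=> Nd [W [oW Wx Wc sF FW]] [_ /(_ d Nd) oO] Ox.
exists [set y | W y /\ [set z | pdom d z /\ O (pmap d z)] (F y)]; split.
- exact: (continuous_on_open oW sF oO).
- by have [? E] := FW x Wx; split => //; split => //; rewrite E.
- by move=> y [/Wc].
- by move=> y [Wy [_]]; have [_ ->] := FW y Wy.
Qed.

End local_rep.

Section smooth_map.
Variables (R : realType) (T1 T2 T3 : Type) (n1 n2 n3 : nat).
Variables (M : space R T1 n1) (N : space R T2 n2) (P : space R T3 n3).

Lemma smooth_map_restr (O O' : set T1) f :
  O' `<=` O -> smooth_map M O N f -> smooth_map M O' N f.
Proof. by move=> O'O sf c x d y Mc cx /O'O; exact: sf. Qed.

Lemma smooth_map_at (O : set T1) f c x : covered N -> smooth_map M O N f ->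
  atlas M c -> pdom c x -> O (pmap c x) -> pts N (f (pmap c x)) ->
  exists d F, [/\ atlas N d & local_rep c d f x F].
Proof.
move=> cN sf Mc cx Ox /cN [d [y [Nd dy E]]].
by have [F rF] := sf c x d y Mc cx Ox Nd dy E; exists d, F.
Qed.

Lemma smooth_map_comp (O1 : set T1) (O2 : set T2) f g : covered N ->
  smooth_map M O1 N f -> smooth_map N O2 P g ->
  (forall p, O1 p -> O2 (f p) /\ pts N (f p)) -> smooth_map M O1 P (fun p => g (f p)).
Proof.
move=> cN sf sg fO c x d y Mc cx Ox Pd dy E.
have [ O2f Nf] := fO _ Ox.
have [e [F [Ne rF]]] := smooth_map_at cN sf Mc cx Ox Nf.
have [_ eF EF _] := local_rep_at rF.
have [||G rG] := sg e (F x) d y Ne eF _ Pd dy; rewrite ?EF //.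
by exists (fun y => G (F y)); exact: local_rep_comp rG.
Qed.

Lemma open_in_preim (O1 : set T1) (O : set T2) f : covered N ->
  open_in M O1 -> smooth_map M O1 N f -> open_in N O ->
  open_in M [set p | O1 p /\ O (f p)].
Proof.
move=> cN [ O1M oO1] sf oO; split; first by move=> p [/O1M].
move=> c Mc; apply: open_setP => x [cx [ O1x Ox]].
have [d [F [Nd rF]]] := smooth_map_at cN sf Mc cx O1x (oO.1 _ Ox).
have [W [oW Wx Wc OW]] := local_rep_open Nd rF oO Ox.
exists (W `&` [set x | pdom c x /\ O1 (pmap c x)]); split => //.
  by apply: openI => //; exact: oO1.
by move=> y [Wy [cy O1y]]; split => //; split => //; exact: OW.
Qed.

End smooth_map.

Section sub_space.
Variables (R : realType).

Lemma sub_param_inj T N m (X : space R T N) (S : set T) (c : param R T m) x y :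
  sub_param X S c -> pdom c x -> pdom c y -> pmap c x = pmap c y -> x = y.
Proof.
move=> [_ _ _ cr] cx cy E; have [ O [r [_ Ox _ _ rO]]] := cr x cx.
by rewrite -(rO x cx Ox) E rO // -E.
Qed.

(** One function [F] plays two roles: it expresses [pmap c] as a smooth map from R^m, and the
    inclusion of [S] read from the chart [c] to an ambient chart. *)
Lemma sub_param_rep T N m (X : space R T N) (S : set T) (c : param R T m) x :
  covered X -> S `<=` pts X ->
  sub_param X S c -> pdom c x -> exists a F,
  [/\ atlas X a, local_rep (Param setT id) a (pmap c) x F & local_rep c a id x F].
Proof.
move=> cX SX [oc cS cs _] cx.
have [a [F [Xa rF]]] := smooth_map_at (x := x) cX cs
  (erefl _ : atlas (euclid R m) (Param setT id)) Logic.I cx (SX _ (cS _ cx)).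
exists a, F; split => //.
move: rF => [W [oW Wx _ sF FW]]; exists (W `&` pdom c); split => //.
- exact: openI.
- by apply: smooth_on_sub sF => y [].
- by move=> y [Wy _]; exact: FW.
Qed.

(** Three representatives are composed: the inclusion of [S] into [X], the map [f] from [X] to [Y],
    and the local retraction of [Y] onto the coordinates of [S'] that comes with every chart of
    [S']. On points of [S'] this retraction inverts the chart. *)
Lemma smooth_map_sub T1 T2 N1 N2 m1 m2 (X : space R T1 N1) (Y : space R T2 N2)
    (S O1 O : set T1) (S' : set T2) f :
  covered X -> covered Y -> S `<=` pts X -> S' `<=` pts Y ->
  open_in X O -> smooth_map X O Y f ->
  (forall p, S p -> O1 p -> O p) -> (forall p, S p -> O p -> S' (f p)) ->
  smooth_map (sub_space m1 X S) O1 (sub_space m2 Y S') f.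
Proof.
move=> cX cY SX S'Y oO sf O1O fS c x d y sc cx O1x sd dy E.
have [oc cS _ _] := sc; have [_ _ _ rd] := sd.
have Ox : O (pmap c x) by apply: O1O => //; exact: cS.
have [a [F1 [Xa rF1 rF1']]] := sub_param_rep cX SX sc cx.
have [_ aF1 E1 _] := local_rep_at rF1.
have [b [F2 [Yb rF2]]] := smooth_map_at (c := a) (x := F1 x) cY sf Xa aF1
   (eq_ind_r O Ox E1) (eq_ind_r (fun p => pts Y (f p)) (S'Y _ (fS _ (cS _ cx) Ox)) E1).
have rF21 := local_rep_comp rF1 rF2.
have [_ bF2 E2 _] := local_rep_at rF21.
have [ Od [r [oOd Ody sr Sr rK]]] := rd y dy.
have Odx : Od (f (pmap c x)) by rewrite -E.
have [F3 rF3] := sr b (F2 (F1 x)) (Param setT id) (r (f (pmap c x))) Yb bF2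
  (eq_ind_r Od Odx E2) (erefl _) Logic.I (eq_ind_r (fun p => r (f (pmap c x)) = r p) (erefl _) E2).
have [W [oW Wx _ sF FW]] := local_rep_comp rF21 rF3.
have [W1 [oW1 W1x _ OW1]] := local_rep_open Yb rF21 oOd Odx.
have [W2 [oW2 W2x _ OW2]] := local_rep_open Xa rF1 oO Ox.
exists (fun y => F3 (F2 (F1 y))); exists (W `&` W1 `&` W2 `&` pdom c); split => //.
- by do !apply: openI.
- by apply: smooth_on_sub sF => z [[[]]].
move=> z [[[Wz W1z] W2z] cz].
have Sz := fS _ (cS _ cz) (OW2 _ W2z); have Oz := OW1 _ W1z.
have [z' dz' Ez'] := Sr _ Sz Oz.
have [_ /= ->] := FW z Wz; rewrite /= -Ez' rK //.
by rewrite Ez'.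
Qed.

Lemma open_in_sub T N m (X : space R T N) (S O : set T) :
  covered X -> S `<=` pts X -> open_in X O -> open_in (sub_space m X S) (O `&` S).
Proof.
move=> cX SX oO; split; first by move=> p [].
move=> c sc; apply: open_setP => x [cx [ Ox Sx]].
have [a [F [Xa rF rF']]] := sub_param_rep cX SX sc cx.
have [W [oW Wx Wc OW]] := local_rep_open Xa rF' oO Ox.
exists W; split => // y Wy; split; first exact: Wc.
split; first exact: OW.
by have [_ cS _ _] := sc; exact/cS/Wc.
Qed.

(** Compatibility of charts is smoothness of the identity, restricted from [X]; separating open sets
    are intersected with [S]. The countable cover is asked for explicitly: two charts will do for
    E_2. *)
Lemma sub_space_manifold T N m (X : space R T N) (S : set T) :
  smooth_manifold X -> submanifold m X S ->
  (exists D : set (param R T m), [/\ D `<=` sub_param X S, countable D &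
        forall p, S p -> exists c x, [/\ D c, pdom c x & pmap c x = p]]) ->
  smooth_manifold (sub_space m X S).
Proof.
move=> mX [SX cS] derivec.
have cX : covered X by move=> p /(mfd_cover mX).
split => //.
- move=> p; split; first by move=> /cS.
  by move=> [c [x [[_ cSx _ _] cx <-]]]; exact: cSx.
- by move=> c [].
- by move=> c x y sc; exact: (sub_param_inj sc).
- apply: (smooth_map_sub cX cX SX SX _ (mfd_compat mX)) => //; last by move=> p /SX.
  split => // c Xc; have := mfd_open mX Xc; congr open.
  apply/seteqP; split => x //=; last by case.
  by move=> cx; split => //; apply/(mfd_cover mX); exists c, x.
- move=> p q Sp Sq pq.
  have [ O1 [ O2 [oO1 oO2 O1p O2q O12]]] := mfd_hausdorff mX (SX _ Sp) (SX _ Sq) pq.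
  exists (O1 `&` S), (O2 `&` S); split => //; try exact: open_in_sub.
  by rewrite setIACA O12 set0I.
Qed.

End sub_space.

(** * Transport of submanifolds along maps between open sets of the ambient spaces *)

Section transfer.
Variables (R : realType) (T1 T2 : Type) (N1 N2 m : nat).
Variables (X : space R T1 N1) (Y : space R T2 N2) (S : set T1) (S' : set T2).
Variables (phi : T1 -> T2) (psi : T2 -> T1) (OX : set T1) (OY : set T2).
Hypotheses (cX : covered X) (cY : covered Y).
Hypotheses (SO : S `<=` OX) (SO' : S' `<=` OY).
Hypotheses (oX : open_in X OX) (oY : open_in Y OY).
Hypotheses (sphi : smooth_map X OX Y phi) (spsi : smooth_map Y OY X psi).
Hypotheses (phiS : forall p, S p -> S' (phi p) /\ psi (phi p) = p).
Hypotheses (psiS : forall q, S' q -> S (psi q) /\ phi (psi q) = q).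

Let SX : S `<=` pts X. Proof. by move=> p /SO; exact: oX.1. Qed.
Let SY : S' `<=` pts Y. Proof. by move=> p /SO'; exact: oY.1. Qed.

(** If [r] retracts onto the coordinates of [S], then [r] after [psi] does so for [S']. The maps
    [phi] and [psi] are inverse to each other between [S] and [S'] only, so the ambient dimensions
    may differ, as they do for E_2 in the 3 x 3 matrices and the tube in C^2. *)
Lemma sub_param_map (c : param R T1 m) : sub_param X S c ->
  sub_param Y S' (Param (pdom c) (fun x => phi (pmap c x))).
Proof.
move=> [oc cS sc rc]; split => //=.
- by move=> x /cS /phiS [].
- apply: (smooth_map_comp cX sc sphi) => x /cS Sx.
  by split; [exact: SO|exact: SX].
- move=> x cx; have [ O [r [oO Ox sr Sr rK]]] := rc x cx.
  exists [set q | OY q /\ O (psi q)], (fun q => r (psi q)); split.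
  + exact: (open_in_preim cX oY spsi oO).
  + have [S'x E] := phiS (cS _ cx); split; last by rewrite E.
    exact: SO'.
  + apply: (smooth_map_comp cX _ sr); last first.
      by move=> p [_ Op]; split => //; exact: oO.1.
    by apply: smooth_map_restr spsi => q [].
  + move=> q S'q [_ Oq]; have [Sq E] := psiS S'q.
    by have [y cy Ey] := Sr _ Sq Oq; exists y => //; rewrite Ey.
  + move=> y cy [_]; have [_ ->] := phiS (cS _ cy); exact: rK.
Qed.

Lemma submanifold_map : submanifold m X S -> submanifold m Y S'.
Proof.
move=> [_ cS]; split => // q S'q; have [Sq E] := psiS S'q.
have [c [x [sc cx Ex]]] := cS _ Sq.
exists (Param (pdom c) (fun x => phi (pmap c x))), x; split => //=.
  exact: sub_param_map.
by rewrite Ex.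
Qed.

Lemma diffeo_sub m1 m2 : diffeo_on (sub_space m1 X S) S (sub_space m2 Y S') S' phi.
Proof.
exists psi; split => //.
- apply: (smooth_map_sub cX cY SX SY oX sphi) => [p Sp _|p /phiS [] //].
  exact: SO.
- apply: (smooth_map_sub cY cX SY SX oY spsi) => [p Sp _|p /psiS [] //].
  exact: SO'.
Qed.

End transfer.

(** * Spaces with one global chart: C^n and the space of matrices *)

Section one_chart.
Variables (R : realType).

Definition one_chart (T : Type) n (f : 'rV[R]_n -> T) : space R T n :=
  Space setT [set Param setT f].

Lemma one_chart_smooth T1 T2 n1 n2 (f1 : 'rV[R]_n1 -> T1) (f2 : 'rV[R]_n2 -> T2)
    (g2 : T2 -> 'rV[R]_n2) (O : set T1) h :
  cancel g2 f2 -> cancel f2 g2 -> open [set x | O (f1 x)] ->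
  smooth_on [set x | O (f1 x)] (fun x => g2 (h (f1 x))) ->
  smooth_map (one_chart f1) O (one_chart f2) h.
Proof.
move=> g2K f2K oO hs c x d y -> _ /= Ox -> _ /= E.
by exists (fun x => g2 (h (f1 x))); exists [set x | O (f1 x)]; split.
Qed.

Lemma one_chart_manifold T n (f : 'rV[R]_n -> T) (g : T -> 'rV[R]_n) :
  cancel g f -> cancel f g -> smooth_manifold (one_chart f).
Proof.
move=> gK fK; split.
- move=> p; split=> // _; exists (Param setT f), (g p); split => //=.
- by move=> c ->; exact: openT.
- by move=> c x y -> _ _; exact: (can_inj fK).
- have oT : open [set x | pts (one_chart f) (f x)].
    by rewrite (_ : [set x | _] = setT) //; exact: openT.
  apply: (one_chart_smooth gK fK oT).
  apply: (smooth_on_ext oT (f := id)); last exact: smooth_on_id.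
  by move=> x _; rewrite fK.
- move=> p q _ _ pq.
  have gpq : g p != g q by apply/eqP => /(can_inj gK).
  have := @norm_hausdorff R 'rV[R]_n; rewrite open_hausdorff.
  move=> /(_ _ _ gpq) [[A B] /= [Ap Bq] [oA oB /eqP AB]].
  exists (g @^-1` A), (g @^-1` B); split.
  + split => // c -> /=; rewrite (_ : [set x | _] = A) //.
    by apply/seteqP; split => x /=; rewrite fK //; case.
  + split => // c -> /=; rewrite (_ : [set x | _] = B) //.
    by apply/seteqP; split => x /=; rewrite fK //; case.
  + by rewrite inE in Ap.
  + by rewrite inE in Bq.
  + by rewrite -preimage_setI AB preimage_set0.
- exists [set Param setT f]; split => //.
  by move=> p _; exists (Param setT f), (g p); split => //=.
Qed.

Lemma one_chart_covered T n (f : 'rV[R]_n -> T) (g : T -> 'rV[R]_n) :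
  cancel g f -> covered (one_chart f).
Proof. by move=> gK p _; exists (Param setT f), (g p); split => //=. Qed.

Lemma one_chart_open T n (f : 'rV[R]_n -> T) (O : set T) :
  open [set x | O (f x)] -> open_in (one_chart f) O.
Proof.
move=> oO; split => // c -> /=; congr open: oO.
by apply/seteqP; split => x //=; case.
Qed.

Definition ccoord n (z : 'rV[R[i]]_n) : 'rV[R]_(n + n) := row_mx (remx z) (immx z).

Lemma ccoordK n : cancel (@ccoord n) (@cvec R n).
Proof. by move=> z; rewrite /cvec row_mxKl row_mxKr cplxmxK. Qed.

Lemma cvecK n : cancel (@cvec R n) (@ccoord n).
Proof. by move=> z; rewrite /ccoord remx_cplxmx immx_cplxmx hsubmxK. Qed.

Lemma cspace_manifold n : smooth_manifold (cspace R n).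
Proof. exact: (one_chart_manifold (@ccoordK n) (@cvecK n)). Qed.

Lemma cspace_covered n : covered (cspace R n).
Proof. exact: (one_chart_covered (@ccoordK n)). Qed.

Lemma cspace_complex n : complex_manifold (cspace R n).
Proof.
split; first exact: cspace_manifold.
move=> c d x F v -> -> [W [oW Wx _ sF FW]].
have FE y : W y -> F y = y.
  by move=> Wy; have [_ /= E] := FW y Wy; exact: (can_inj (@cvecK n)).
have E w : 'D_w F x = w.
  rewrite -[RHS](derive_id x w); apply: near_eq_derive.
  exact: (near_open oW Wx).
by rewrite !E.
Qed.

Lemma mxspace3_manifold : smooth_manifold (mxspace3 R).
Proof. exact: (one_chart_manifold (@mxvecK R 3 3) (@vec_mxK R 3 3)). Qed.

Lemma mxspace3_covered : covered (mxspace3 R).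
Proof. exact: (one_chart_covered (@mxvecK R 3 3)). Qed.

End one_chart.

Lemma Ck_on_local (R : realType) (V W : normedModType R) k (U : set V) (f : V -> W) :
  (forall x, U x -> exists A, A x /\ Ck_on k A f) -> Ck_on k U f.
Proof.
elim: k f => [|k IH] f H /=.
  by move=> x /H [A [Ax]]; apply.
split=> [x /H [A [Ax [df _]]]|v]; first exact: df.
by apply: IH => x /H [A [Ax [_ Df]]]; exists A; split => //; exact: Df.
Qed.

Lemma smooth_on_local (R : realType) (V W : normedModType R) (U : set V) (f : V -> W) :
  (forall x, U x -> exists A, A x /\ smooth_on A f) -> smooth_on U f.
Proof. by move=> H k; apply: Ck_on_local => x /H [A [Ax /(_ k) ?]]; exists A. Qed.

(** * Linear maps of matrices and their differentials *)

Section linear_mx.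
Variables (R : realType) (m n p q : nat) (l : {linear 'M[R]_(m, n) -> 'M[R]_(p, q)}).

Lemma smooth_on_linear (U : set 'M[R]_(m, n)) : smooth_on U l.
Proof.
apply: (@smooth_on_sub _ _ _ setT) => //.
have lE A : l A = \sum_i \sum_j A i j *: l (delta_mx i j).
  rewrite {1}(matrix_sum_delta A) linear_sum; apply: eq_bigr => i _.
  by rewrite linear_sum; apply: eq_bigr => j _; rewrite linearZ.
apply: smooth_on_mx; first exact: openT.
move=> i j; apply: (@smooth_on_ext R 'M[R]_(m, n) R setT
  (fun A : 'M[R]_(m, n) => \sum_(k < m) \sum_(k' < n) A k k' * l (delta_mx k k') i j)).
    exact: openT.
  move=> A _; rewrite lE summxE; apply: eq_bigr => k _; rewrite summxE.
  by apply: eq_bigr => k' _; rewrite mxE.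
apply: smooth_on_sum => [|k]; first exact: openT.
apply: smooth_on_sum => [|k']; first exact: openT.
apply: smooth_onM; [exact: openT|exact: smooth_on_coord|exact: smooth_on_cst].
Qed.

Lemma differentiable_linear (A : 'M[R]_(m, n)) : differentiable l A.
Proof. exact: (smooth_on_differentiable (smooth_on_linear setT)). Qed.

Lemma derive_linear (V : normedModType R) (h : V -> 'M[R]_(m, n)) x v :
  differentiable h x -> 'D_v (fun y => l (h y)) x = l ('D_v h x).
Proof.
move=> dh; have dl := differentiable_linear (h x).
rewrite deriveE; last exact: differentiable_comp.
have lc : continuous l by move=> A; exact/differentiable_continuous/differentiable_linear.
by rewrite (diff_comp dh dl) /= (diff_lin _ lc) -(deriveE v dh).
Qed.

Lemma Ck_on_linear (V : normedModType R) k (U : set V) (h : V -> 'M[R]_(m, n)) :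
  open U -> Ck_on k U h -> Ck_on k U (fun y => l (h y)).
Proof.
move=> oU; elim: k h => [|k IH] h.
  move=> hc x Ux; apply: (@continuous_comp _ _ _ h l); first exact: hc.
  exact/differentiable_continuous/differentiable_linear.
move=> [dh Dh]; split=> [x Ux|v].
  by apply: (@differentiable_comp _ _ _ _ h l); [exact: dh|exact: differentiable_linear].
apply: (Ck_on_ext oU _ (IH _ (Dh v))) => x Ux.
by rewrite derive_linear //; exact: dh.
Qed.

Lemma smooth_on_linear_comp (V : normedModType R) (U : set V) (h : V -> 'M[R]_(m, n)) :
  open U -> smooth_on U h -> smooth_on U (fun y => l (h y)).
Proof. by move=> oU hs k; exact: Ck_on_linear. Qed.

End linear_mx.

Section cplx.
Variable R : realType.

Lemma cplxmx_mulmx m n p q (a : 'M[R]_(m, n)) (A B : 'M[R]_(n, p)) (b : 'M[R]_(p, q)) :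
  cplxmx (a *m A *m b) (a *m B *m b) = tocmx a *m cplxmx A B *m tocmx b.
Proof.
apply/matrixP => i j; rewrite !mxE; apply: eqC => /=.
  rewrite (big_morph (@complex.Re R) (@ReD R) (erefl _)); apply: eq_bigr => k _.
  rewrite ReM !mxE /= mulr0 subr0; congr (_ * _).
  rewrite (big_morph (@complex.Re R) (@ReD R) (erefl _)); apply: eq_bigr => l _.
  by rewrite ReM !mxE /= mul0r subr0.
rewrite (big_morph (@complex.Im R) (@ImD R) (erefl _)); apply: eq_bigr => k _.
rewrite ImM !mxE /= mulr0 add0r; congr (_ * _).
rewrite (big_morph (@complex.Im R) (@ImD R) (erefl _)); apply: eq_bigr => l _.
by rewrite ImM !mxE /= mul0r addr0.
Qed.

Lemma tocmx1 n : tocmx (1%:M : 'M[R]_n) = 1%:M.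
Proof. exact: map_mx1. Qed.

Lemma tocmxM m n p (A : 'M[R]_(m, n)) (B : 'M[R]_(n, p)) :
  tocmx (A *m B) = tocmx A *m tocmx B.
Proof. exact: map_mxM. Qed.

Lemma cdiff_mulmx n m p q r (h : 'rV[R]_n -> 'M[R]_(p, q)) (a : 'M[R]_(m, p))
    (b : 'M[R]_(q, r)) x (v : 'rV[R[i]]_n) : differentiable h x ->
  cdiff (fun y => a *m h y *m b) x v = tocmx a *m cdiff h x v *m tocmx b.
Proof.
move=> dh; have D w : 'D_w (fun y => a *m h y *m b) x = a *m 'D_w h x *m b.
  exact: (derive_linear (mulmxr b \o mulmx a) w dh).
by rewrite !cdiff_cplxmx !D cplxmx_mulmx.
Qed.

Lemma cplxmx_mulmxl m n p (a : 'M[R]_(m, n)) (A B : 'M[R]_(n, p)) :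
  cplxmx (a *m A) (a *m B) = tocmx a *m cplxmx A B.
Proof. by have := cplxmx_mulmx a A B 1%:M; rewrite !mulmx1 tocmx1 mulmx1. Qed.

Lemma cdiff_mulmxl n m p q (h : 'rV[R]_n -> 'M[R]_(p, q)) (a : 'M[R]_(m, p))
    x (v : 'rV[R[i]]_n) : differentiable h x ->
  cdiff (fun y => a *m h y) x v = tocmx a *m cdiff h x v.
Proof.
move=> dh; have D w : 'D_w (fun y => a *m h y) x = a *m 'D_w h x.
  exact: (derive_linear (mulmx a) w dh).
by rewrite !cdiff_cplxmx !D cplxmx_mulmxl.
Qed.

Lemma cplxmx_mxvec p q (A B : 'M[R]_(p, q)) :
  cplxmx (mxvec A) (mxvec B) = mxvec (cplxmx A B).
Proof.
by apply/rowP => k; case/mxvec_indexP: k => i j; rewrite mxE !mxvecE mxE.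
Qed.

Lemma cdiff_mxvec n p q (h : 'rV[R]_n -> 'M[R]_(p, q)) x (v : 'rV[R[i]]_n) : differentiable h x ->
  cdiff (fun y => mxvec (h y)) x v = mxvec (cdiff h x v).
Proof.
move=> dh; have D w : 'D_w (fun y => mxvec (h y)) x = mxvec ('D_w h x).
  exact: (derive_linear mxvec w dh).
by rewrite !cdiff_cplxmx !D cplxmx_mxvec.
Qed.

End cplx.

(** * Submanifolds of the space of 3 x 3 matrices *)

Section mx_param.
Variables (R : realType) (m : nat) (S : set 'M[R]_3) (c : param R 'M[R]_3 m).
Hypothesis sc : sub_param (mxspace3 R) S c.

Lemma mx_param_smooth : smooth_on (pdom c) (pmap c).
Proof.
apply: smooth_on_local => x cx.
have [a [F [-> rF _]]] := sub_param_rep (@mxspace3_covered R) (fun _ _ => Logic.I) sc cx.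
have [W [oW Wx _ sF FW]] := rF; exists W; split => //.
apply: (smooth_on_ext oW _ (smooth_on_linear_comp vec_mx oW sF)) => y Wy.
by have [_] := FW y Wy.
Qed.

Lemma mx_param_diff x : pdom c x -> differentiable (pmap c) x.
Proof. by move=> cx; exact: smooth_on_differentiable mx_param_smooth cx. Qed.

(** The retraction in the definition of [sub_param] is read in the global chart of the matrix space.
    Matrices are flattened by [mxvec] because the complexified differential is set up for functions
    of row vectors. *)
Lemma mx_param_retract x : pdom c x -> exists rho U W,
  [/\ open U, smooth_on U rho, open W & W x] /\ W `<=` pdom c /\
  forall y, W y -> U (mxvec (pmap c y)) /\ rho (mxvec (pmap c y)) = y.
Proof.
move=> cx; have [oc _ _ cr] := sc.
have [ O [r [oO Ox sr _ rK]]] := cr x cx.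
have Ox' : O (vec_mx (mxvec (pmap c x))) by rewrite mxvecK.
have rx : x = r (vec_mx (mxvec (pmap c x))) by rewrite mxvecK rK.
have [rho [U [oU Ux _ sU rU]]] := sr (Param setT (@vec_mx R 3 3)) (mxvec (pmap c x))
   (Param setT id) x (erefl _) Logic.I Ox' (erefl _) Logic.I rx.
exists rho, U, ([set y | pdom c y /\ (U `&` [set z | setT z /\ O (vec_mx z)]) (mxvec (pmap c y))]).
split; [split => //|split].
- apply: continuous_on_open => //.
    exact: (smooth_on_linear_comp mxvec oc mx_param_smooth).
  apply: openI => //; exact: (oO.2 (Param setT (@vec_mx R 3 3)) (erefl _)).
- by move=> y [].
- move=> y [cy [Uy /= [_]]]; rewrite mxvecK => Oy; split => //.
  by have [_ /= ->] := rU _ Uy; rewrite mxvecK rK.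
Qed.

Lemma mx_param_cdiffK x rho U W : open U -> smooth_on U rho -> open W -> W x -> W `<=` pdom c ->
  (forall y, W y -> U (mxvec (pmap c y)) /\ rho (mxvec (pmap c y)) = y) ->
  forall v, cdiff rho (mxvec (pmap c x)) (mxvec (cdiff (pmap c) x v)) = v.
Proof.
move=> oU sr oW Wx Wc rK v; have dc := mx_param_diff (Wc _ Wx).
transitivity (cdiff rho (mxvec (pmap c x)) (cdiff (fun y => mxvec (pmap c y)) x v)).
  by congr (cdiff _ _ _); symmetry; exact: cdiff_mxvec.
have d1 : differentiable (fun y => mxvec (pmap c y)) x.
  exact: (differentiable_comp dc (differentiable_linear mxvec _)).
have d2 : differentiable rho (mxvec (pmap c x)).
  by apply: (smooth_on_differentiable sr); have [] := rK x Wx.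
have E := @cdiff_comp R m _ _ _ (fun y => mxvec (pmap c y)) rho v x d1 d2.
etransitivity; first (symmetry; exact: E).
rewrite -[RHS](cdiff_id v x); apply: (cdiff_ext _ oW Wx) => y Wy.
by have [] := rK y Wy.
Qed.

(** A parametrization is an immersion, since the differential of the retraction is a left inverse.
    Equality of tangent vectors can thus be checked on matrices, whatever the chart. *)
Lemma mx_param_cdiff_inj x v w : pdom c x ->
  cdiff (pmap c) x v = cdiff (pmap c) x w -> v = w.
Proof.
move=> cx E; have [rho [U [W [[oU sr oW Wx] [Wc rK]]]]] := mx_param_retract cx.
have K := mx_param_cdiffK oU sr oW Wx Wc rK.
by rewrite -[LHS](K v) -[RHS](K w) E.
Qed.

End mx_param.

(** * Induced CR structures *)

Section cr_lemmas.
Variable R : realType.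

(** For w = (a, b) the equation J w = - i w reads (- b, a) = (- i a, - i b). The two halves are
    equivalent, and each says a + i b = 0. *)
Lemma T01P n (w : 'rV[R[i]]_(n + n)) :
  T01 w <-> lsubmx w + 'i%C *: rsubmx w = 0.
Proof.
have ii : 'i%C * 'i%C = -1 :> R[i] by apply: eqC => /=; ring.
have E : - 'i%C *: w = row_mx (- 'i%C *: lsubmx w) (- 'i%C *: rsubmx w).
  by rewrite -scale_row_mx hsubmxK.
split.
  rewrite /T01 /= => H; have := etrans H E.
  by case/eq_row_mx => _ ->; rewrite scaleNr addNr.
move=> /eqP; rewrite addr_eq0 => /eqP l; rewrite /T01 /= E /cJ l !scaleNr scalerN opprK.
by rewrite scalerA ii scaleN1r.
Qed.

Lemma cJ_cplxmx n (A B : 'rV[R]_(n + n)) : cJ (cplxmx A B) = cplxmx (cJ A) (cJ B).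
Proof.
by apply/rowP => k; rewrite !mxE; case: (fintype.split k) => j; rewrite !mxE.
Qed.

Lemma T01_cdiff n (K : 'rV[R]_(n + n) -> 'rV[R]_(n + n)) z w :
  differentiable K z -> (forall v, 'D_(cJ v) K z = cJ ('D_v K z)) ->
  T01 w -> T01 (cdiff K z w).
Proof.
move=> dK KJ Tw; rewrite /T01 /=.
have -> : cJ (cdiff K z w) = cdiff K z (cJ w).
  have Er : remx (cJ w) = cJ (remx w) by rewrite -{1}(cplxmxK w) cJ_cplxmx remx_cplxmx.
  have Ei : immx (cJ w) = cJ (immx w) by rewrite -{1}(cplxmxK w) cJ_cplxmx immx_cplxmx.
  rewrite !cdiff_cplxmx cJ_cplxmx Er Ei; congr cplxmx; symmetry; exact: KJ.
by rewrite (Tw : cJ w = _) cdiffZ.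
Qed.

(** Two ambient charts differ by a map [K] whose differential commutes with J, so the
    (0,1)-condition does not depend on the chart in which it is tested. *)
Lemma T01_chart T1 T2 n1 n (N : space R T2 (n + n)) (c : param R T1 n1) e e' f x G H v :
  complex_manifold N -> atlas N e -> atlas N e' ->
  local_rep c e f x G -> local_rep c e' f x H ->
  T01 (cdiff G x v) -> T01 (cdiff H x v).
Proof.
move=> [mN hN] Ne Ne' rG rH TG.
have [cx eG EG dG] := local_rep_at rG; have [_ e'H EH dH] := local_rep_at rH.
have NG : pts N (pmap e (G x)) by apply/(mfd_cover mN); exists e, (G x).
have [K rK] := mfd_compat mN Ne eG NG Ne' e'H (etrans EH (esym EG)).
have [_ _ _ dK] := local_rep_at rK.
have rKG := local_rep_comp rG rK.
have [W [oW Wx HE]] := local_rep_uniq (fun y z => mfd_inj mN Ne') rH rKG.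
have -> : cdiff H x v = cdiff K (G x) (cdiff G x v).
  by rewrite (cdiff_ext v oW Wx HE); exact: cdiff_comp.
by apply: T01_cdiff => // w; exact: hN rK.
Qed.

(** This reduces a CR equivalence to a diffeomorphism and one pointwise test in a single ambient
    chart. That [V] goes into the induced structure is independence of the chart; conversely a
    (0,1)-vector is the image of its image under the differential of the inverse map [g]. *)
Lemma cr_equiv_induced T1 T2 n1 (X : space R T1 n1) (S0 : set T1) (V : cr_field R T1)
    (N : space R T2 (2 + 2)) (S : set T2) f :
  covered X -> S0 `<=` pts X -> complex_manifold N -> S `<=` pts N ->
  diffeo_on (sub_space 3 X S0) S0 (sub_space 3 N S) S f ->
  (forall c x, sub_param X S0 c -> pdom c x -> exists e G,
     [/\ atlas N e, local_rep c e f x G & forall v, V c x v <-> T01 (cdiff G x v)]) ->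
  cr_equiv (sub_space 3 X S0) V (sub_space 3 N S) (induced_cr N) f.
Proof.
move=> cX S0X hN SN df H; split => // c d x F sc sd S0x rF.
have cN : covered N by move=> p /(mfd_cover hN.1).
have [cx dF EF _] := local_rep_at rF.
have [e [G [Ne rG VG]]] := H c x sc cx.
have [g [fg gf sf sg]] := df.
apply/seteqP; split => w /=.
  move=> [v Vv <-]; have [e' [F' [Ne' _ rF']]] := sub_param_rep cN SN sd dF.
  exists e', F'; split => //.
  have [_ _ _ dF'] := local_rep_at rF'; have [_ _ _ dFx] := local_rep_at rF.
  rewrite -(cdiff_comp v dFx dF').
  by apply: (T01_chart hN Ne Ne' rG (local_rep_comp rF rF')); exact/VG.
move=> [e' [F' [Ne' rF' TF']]].
have [G' rG'] : exists G', local_rep d c g (F x) G'.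
  have [_ dS _ _] := sd; apply: (sg d (F x) c x sd dF (dS _ dF) sc cx).
  by rewrite EF; have [_ ->] := fg _ S0x.
have [oc cS _ _] := sc; have [od dS _ _] := sd.
have [GF _] := local_rep_cancel (W := setT) (openT) Logic.I
   (fun y _ cy => (fg _ (cS _ cy)).2) oc (fun y z => sub_param_inj sc) rF rG'.
have [FG K] := local_rep_cancel (W := setT) (openT) Logic.I
   (fun y _ dy => (gf _ (dS _ dy)).2) od (fun y z => sub_param_inj sd) rG'
   (eq_ind_r (fun z => local_rep c d f z F) rF GF).
rewrite GF in K.
exists (cdiff G' (F x) w); last exact: K.
apply/VG; have [_ _ _ dF'] := local_rep_at rF'; have [_ _ _ dFx] := local_rep_at rF.
apply: (T01_chart hN Ne' Ne (local_rep_comp rF rF') rG).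
have -> : cdiff (fun y => F' (F y)) x (cdiff G' (F x) w) = cdiff F' (F x) w; last by [].
etransitivity; first exact: cdiff_comp.
by congr (cdiff _ _ _); exact: K.
Qed.

End cr_lemmas.

(** * The group E_2 *)

Definition mx3 (K : pzRingType) (a b c d e f g h i : K) : 'M[K]_3 :=
  mx3_of_rows [:: [:: a; b; c]; [:: d; e; f]; [:: g; h; i]].

Lemma ord3P (P : 'I_3 -> Prop) : P 0 -> P 1 -> P 2%:R -> forall i, P i.
Proof.
move=> P0 P1 P2 [[|[|[|//]]] lt]; [move: P0|move: P1|move: P2]; congr P; exact: val_inj.
Qed.

Lemma mx3_inj (K : pzRingType) (a b c d e f g h i a' b' c' d' e' f' g' h' i' : K) :
  mx3 a b c d e f g h i = mx3 a' b' c' d' e' f' g' h' i' ->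
  [/\ a = a', b = b' & c = c'] /\ [/\ d = d', e = e' & f = f'] /\ [/\ g = g', h = h' & i = i'].
Proof.
move=> E; have F j k := congr1 (fun A : 'M[K]_3 => A j k) E.
split; last split; split.
- by have := F 0 0; rewrite !mxE.
- by have := F 0 1; rewrite !mxE.
- by have := F 0 2%:R; rewrite !mxE.
- by have := F 1 0; rewrite !mxE.
- by have := F 1 1; rewrite !mxE.
- by have := F 1 2%:R; rewrite !mxE.
- by have := F 2%:R 0; rewrite !mxE.
- by have := F 2%:R 1; rewrite !mxE.
- by have := F 2%:R 2%:R; rewrite !mxE.
Qed.

Lemma sum3 (K : nmodType) (F : 'I_3 -> K) : \sum_i F i = F 0 + F 1 + F 2%:R.
Proof.
by rewrite !big_ord_recl big_ord0 addr0 addrA; congr (_ + F _ + F _); apply: val_inj.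
Qed.

Lemma mul_mx3 (K : pzRingType) (a b c d e f g h i a' b' c' d' e' f' g' h' i' : K) :
  mx3 a b c d e f g h i *m mx3 a' b' c' d' e' f' g' h' i' =
  mx3 (a * a' + b * d' + c * g') (a * b' + b * e' + c * h') (a * c' + b * f' + c * i')
      (d * a' + e * d' + f * g') (d * b' + e * e' + f * h') (d * c' + e * f' + f * i')
      (g * a' + h * d' + i * g') (g * b' + h * e' + i * h') (g * c' + h * f' + i * i').
Proof.
by apply/matrixP; elim/ord3P; elim/ord3P; rewrite mxE sum3 !mxE.
Qed.

Lemma mx3_1 (K : pzRingType) : 1%:M = mx3 1 0 0 0 1 0 0 0 1 :> 'M[K]_3.
Proof. by apply/matrixP; elim/ord3P; elim/ord3P; rewrite !mxE. Qed.

Lemma tocmx_mx3 (R : realType) (a b c d e f g h i : R) :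
  tocmx (mx3 a b c d e f g h i) =
  mx3 (a%:C)%C (b%:C)%C (c%:C)%C (d%:C)%C (e%:C)%C (f%:C)%C (g%:C)%C (h%:C)%C (i%:C)%C.
Proof. by apply/matrixP; elim/ord3P; elim/ord3P; rewrite !mxE. Qed.

Lemma cplxmx_mx3 (R : realType) (a b c d e f g h i a' b' c' d' e' f' g' h' i' : R) :
  cplxmx (mx3 a b c d e f g h i) (mx3 a' b' c' d' e' f' g' h' i') =
  mx3 (a +i* a')%C (b +i* b')%C (c +i* c')%C (d +i* d')%C
    (e +i* e')%C (f +i* f')%C (g +i* g')%C (h +i* h')%C (i +i* i')%C.
Proof. by apply/matrixP; elim/ord3P; elim/ord3P; rewrite !mxE. Qed.

Lemma smooth_on_mx3 (R : realType) (V : normedModType R) (U : set V)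
    (a b c d e f g h i : V -> R) : open U ->
  smooth_on U a -> smooth_on U b -> smooth_on U c ->
  smooth_on U d -> smooth_on U e -> smooth_on U f ->
  smooth_on U g -> smooth_on U h -> smooth_on U i ->
  smooth_on U (fun x => mx3 (a x) (b x) (c x) (d x) (e x) (f x) (g x) (h x) (i x)).
Proof.
move=> oU *; apply: smooth_on_mx => //.
elim/ord3P; elim/ord3P; first [by apply: (smooth_on_ext oU (f := a)) => // x _; rewrite mxE
| by apply: (smooth_on_ext oU (f := b)) => // x _; rewrite mxE
| by apply: (smooth_on_ext oU (f := c)) => // x _; rewrite mxE
| by apply: (smooth_on_ext oU (f := d)) => // x _; rewrite mxE
| by apply: (smooth_on_ext oU (f := e)) => // x _; rewrite mxE
| by apply: (smooth_on_ext oU (f := f)) => // x _; rewrite mxE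
| by apply: (smooth_on_ext oU (f := g)) => // x _; rewrite mxE
| by apply: (smooth_on_ext oU (f := h)) => // x _; rewrite mxE
| by apply: (smooth_on_ext oU (f := i)) => // x _; rewrite mxE].
Qed.

Section E2.
Variable R : realType.

Definition e2g (a b x y : R) : 'M[R]_3 := mx3 a (- b) x b a y 0 0 1.

Lemma block_mx3 (A : 'M[R]_2) (w : 'cV[R]_2) :
  block_mx A w (0 : 'rV[R]_2) (1%:M : 'M[R]_1) =
  mx3 (A 0 0) (A 0 1) (w 0 0) (A 1 0) (A 1 1) (w 1 0) 0 0 1.
Proof.
have L0 : (0 : 'I_3) = lshift 1 (0 : 'I_2) by exact: val_inj.
have L1 : (1 : 'I_3) = lshift 1 (1 : 'I_2) by exact: val_inj.
have L2 : (2%:R : 'I_3) = rshift 2 (0 : 'I_1) by exact: val_inj.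
apply/matrixP; elim/ord3P; elim/ord3P; rewrite [RHS]mxE [RHS]/=.
- by rewrite L0 block_mxEul.
- by rewrite L0 L1 block_mxEul.
- by rewrite L2 L0 block_mxEur.
- by rewrite L0 L1 block_mxEul.
- by rewrite L1 block_mxEul.
- by rewrite L2 L1 block_mxEur.
- by rewrite L2 L0 block_mxEdl mxE.
- by rewrite L2 L1 block_mxEdl mxE.
- by rewrite L2 block_mxEdr mxE.
Qed.

Lemma det_mx2 (A : 'M[R]_2) : \det A = A 0 0 * A 1 1 - A 0 1 * A 1 0.
Proof.
rewrite (expand_det_row _ 0) !big_ord_recl big_ord0 addr0 /cofactor !det_mx11 !mxE /=.
rewrite expr0 expr1 mul1r mulN1r mulrN.
by congr (_ * A _ _ - A _ _ * A _ _); exact: val_inj.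
Qed.

Lemma E2P (g : 'M[R]_3) :
  E2 g <-> exists a b x y, a ^+ 2 + b ^+ 2 = 1 /\ g = e2g a b x y.
Proof.
have S2 (F : 'I_2 -> R) : \sum_i F i = F 0 + F 1.
  by rewrite !big_ord_recl big_ord0 addr0; congr (_ + F _); exact: val_inj.
split.
  move=> [A [w [[AA dA] ->]]].
  have := congr1 (fun M : 'M[R]_2 => M 0 0) AA; rewrite /= !mxE S2 !mxE /= => E00.
  have := congr1 (fun M : 'M[R]_2 => M 1 1) AA; rewrite /= !mxE S2 !mxE /= => E11.
  move: dA E00 E11; rewrite det_mx2 block_mx3.
  move: (A 0 0) (A 0 1) (A 1 0) (A 1 1) => p q r s dA E00 E11.
  (* The sum is the two row norms minus twice the determinant, that is 1 + 1 - 2; it forces the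
     rotation form s = p, q = - r. *)
  have : (p - s) ^+ 2 + (q + r) ^+ 2 = 0.
    transitivity ((p * p + q * q) + (r * r + s * s) - 2 * (p * s - q * r)); first ring.
    by rewrite E00 E11 dA; ring.
  move=> /eqP; rewrite paddr_eq0 ?sqr_ge0 // !sqrf_eq0 subr_eq0 addr_eq0 => /andP[/eqP ps /eqP qr].
  exists p, r, (w 0 0), (w 1 0); split.
    have -> : r = - q by rewrite qr opprK.
    by rewrite sqrrN !expr2.
  by rewrite -ps qr.
move=> [a [b [x [y [ab ->]]]]].
pose A : 'M[R]_2 := \matrix_(i, j) if i == 0 then (if j == 0 then a else - b) else (if j == 0 then b else a).
pose w : 'cV[R]_2 := \col_i if i == 0 then x else y.
exists A, w; split; last by rewrite block_mx3 !mxE.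
have I2 (P : 'I_2 -> Prop) : P 0 -> P 1 -> forall i, P i.
  move=> P0 P1 [[|[|//]] lt]; [move: P0|move: P1]; congr P; exact: val_inj.
split; last by rewrite det_mx2 !mxE /= -ab; ring.
apply/matrixP; elim/I2; elim/I2; rewrite !mxE S2 !mxE /= ?mulr1n ?mulr0n -?ab; ring.
Qed.

Lemma e2g_mul a b x y a' b' x' y' :
  e2g a b x y *m e2g a' b' x' y' =
  e2g (a * a' - b * b') (b * a' + a * b') (a * x' - b * y' + x) (b * x' + a * y' + y).
Proof. by rewrite /e2g mul_mx3; congr mx3; ring. Qed.

Lemma E2_mul (g h : 'M[R]_3) : E2 g -> E2 h -> E2 (g *m h).
Proof.
move=> /E2P [a [b [x [y [ab ->]]]]] /E2P [a' [b' [x' [y' [ab' ->]]]]].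
apply/E2P; rewrite e2g_mul; do 4!eexists; split; last reflexivity.
transitivity ((a ^+ 2 + b ^+ 2) * (a' ^+ 2 + b' ^+ 2)); first ring.
by rewrite ab ab' mulr1.
Qed.

Lemma e2g_inv a b x y : a ^+ 2 + b ^+ 2 = 1 ->
  e2g a (- b) (- (a * x + b * y)) (b * x - a * y) *m e2g a b x y = 1%:M /\
  e2g a b x y *m e2g a (- b) (- (a * x + b * y)) (b * x - a * y) = 1%:M.
Proof.
move=> ab; rewrite !e2g_mul mx3_1 /e2g; split; congr mx3; try (rewrite -ab; ring); try ring.
- transitivity (x - (a ^+ 2 + b ^+ 2) * x); first ring.
  by rewrite ab; ring.
- transitivity (y - (a ^+ 2 + b ^+ 2) * y); first ring.
  by rewrite ab; ring.
Qed.

Lemma E2_inv (g : 'M[R]_3) : E2 g ->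
  [/\ g \in unitmx, E2 (invmx g) & (invmx g *m g = 1%:M) /\ (g *m invmx g = 1%:M)].
Proof.
move=> /E2P [a [b [x [y [ab ->]]]]].
have [li ri] := e2g_inv x y ab.
have [_ ug] := mulmx1_unit li.
have E : invmx (e2g a b x y) = e2g a (- b) (- (a * x + b * y)) (b * x - a * y).
  by rewrite -[LHS]mulmx1 -ri mulKmx.
split => //; last by rewrite mulVmx // mulmxV.
by rewrite E; apply/E2P; do 4!eexists; split; last reflexivity; rewrite sqrrN.
Qed.

Lemma E2_1 : E2 (1%:M : 'M[R]_3).
Proof.
apply/E2P; exists 1, 0, 0, 0; split; first ring.
by rewrite mx3_1 /e2g oppr0.
Qed.

(* The rational parametrization of the circle keeps trigonometry out of the
   charts. It misses the rotations by pi, which are reached by translating. *)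
Definition tau (y : 'rV[R]_3) : R := 1 + y 0 0 * y 0 0.
Definition cosc (y : 'rV[R]_3) : R := (1 - y 0 0 * y 0 0) * (tau y)^-1.
Definition sinc (y : 'rV[R]_3) : R := (y 0 0 + y 0 0) * (tau y)^-1.

Definition cay (y : 'rV[R]_3) : 'M[R]_3 := e2g (cosc y) (sinc y) (y 0 1) (y 0 2%:R).

Lemma tau_gt0 y : 0 < tau y.
Proof. by rewrite /tau ltr_pwDl // -expr2 sqr_ge0. Qed.

Lemma tau_neq0 y : tau y != 0.
Proof. by rewrite lt0r_neq0 // tau_gt0. Qed.

Lemma cosc_sinc y : cosc y ^+ 2 + sinc y ^+ 2 = 1.
Proof.
rewrite /cosc /sinc; have := tau_neq0 y; rewrite /tau => t0.
by field.
Qed.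

Lemma E2_cay y : E2 (cay y).
Proof. by apply/E2P; exists (cosc y), (sinc y), (y 0 1), (y 0 2%:R); rewrite cosc_sinc. Qed.

Lemma smooth_tau U : open U -> smooth_on U tau.
Proof.
move=> oU; apply: (smooth_onD oU); first exact: smooth_on_cst.
by apply: smooth_onM => //; exact: smooth_on_coord.
Qed.

Lemma smooth_cosc U : open U -> smooth_on U cosc.
Proof.
move=> oU; apply: (smooth_onM oU).
  apply: (smooth_onB oU); first exact: smooth_on_cst.
  by apply: smooth_onM => //; exact: smooth_on_coord.
by apply: (smooth_onV oU) => [x _|]; [exact: tau_neq0|exact: smooth_tau].
Qed.

Lemma smooth_sinc U : open U -> smooth_on U sinc.
Proof.
move=> oU; apply: (smooth_onM oU).
  by apply: smooth_onD => //; exact: smooth_on_coord.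
by apply: (smooth_onV oU) => [x _|]; [exact: tau_neq0|exact: smooth_tau].
Qed.

Lemma smooth_cay U : open U -> smooth_on U cay.
Proof.
move=> oU; apply: smooth_on_mx3 => //; try exact: smooth_on_cst; try exact: smooth_on_coord.
- exact: smooth_cosc.
- by apply: smooth_onN => //; exact: smooth_sinc.
- exact: smooth_sinc.
- exact: smooth_cosc.
Qed.

Definition row3 (K : pzRingType) (a b c : K) : 'rV[K]_3 :=
  \row_j nth 0 [:: a; b; c] j.

Lemma row3_eta (K : pzRingType) (v : 'rV[K]_3) : v = row3 (v 0 0) (v 0 1) (v 0 2%:R).
Proof. by apply/rowP; elim/ord3P; rewrite mxE. Qed.

(** The half-angle formula tan(t/2) = sin t / (1 + cos t). It makes sense for all matrices with
    [1 + M 0 0 != 0], which is what the retraction of a submanifold chart requires. *)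
Definition uncay (M : 'M[R]_3) : 'rV[R]_3 :=
  row3 (M 1 0 * (1 + M 0 0)^-1) (M 0 2%:R) (M 1 2%:R).

Lemma cayK y : 1 + cay y 0 0 != 0 /\ uncay (cay y) = y.
Proof.
have t0 := tau_neq0 y.
have E : 1 + cay y 0 0 = 2 / tau y.
  by rewrite mxE /= /cosc; move: t0; rewrite /tau => t0; field.
split; first by rewrite E mulf_neq0 ?invr_neq0 ?pnatr_eq0.
rewrite [RHS]row3_eta /uncay E !mxE /=; congr row3.
by rewrite /sinc; field.
Qed.

Lemma uncayK g : E2 g -> 1 + g 0 0 != 0 -> cay (uncay g) = g.
Proof.
move=> /E2P [a [b [x [y [ab ->]]]]]; rewrite mxE /= => a1.
have t : tau (uncay (e2g a b x y)) = 2 / (1 + a).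
  rewrite /tau /uncay !mxE /=.
  transitivity ((1 + 2 * a + (a ^+ 2 + b ^+ 2)) / (1 + a) ^+ 2); first by field.
  by rewrite ab; field.
have b2 : b * b = (1 - a) * (1 + a) by rewrite -(addrK (a ^+ 2) (b * b)) -expr2 [_ + a ^+ 2]addrC ab; ring.
rewrite /cay /cosc /sinc t /uncay !mxE /=.
have -> : b / (1 + a) * (b / (1 + a)) = (1 - a) / (1 + a).
  by transitivity (b * b / (1 + a) ^+ 2); [field|rewrite b2; field].
by congr e2g; field.
Qed.

Definition cay_param (g : 'M[R]_3) : param R 'M[R]_3 3 :=
  Param setT (fun y => g *m cay y).

(** The retraction is [uncay] after left multiplication by [invmx g], on the open set of all
    matrices where the denominator of [uncay] does not vanish. *)
Lemma cay_sub_param g : E2 g -> sub_param (mxspace3 R) (@E2 R) (cay_param g).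
Proof.
move=> Eg; have [ug Eig [iL iR]] := E2_inv Eg; split => /=.
- exact: openT.
- by move=> y _; apply: E2_mul => //; exact: E2_cay.
- have oT : open [set x : 'rV[R]_3 | setT (id x)] by exact: openT.
  apply: (one_chart_smooth (@mxvecK R 3 3) (@vec_mxK R 3 3) oT) => /=.
  apply: smooth_on_linear_comp => //.
  by apply: (smooth_on_linear_comp (mulmx g)) => //; exact: smooth_cay.
- move=> y _.
  pose N (v : 'rV[R]_(3 * 3)) : 'M[R]_3 := invmx g *m vec_mx v.
  have sN U : open U -> smooth_on U N.
    move=> oU; apply: (smooth_on_linear_comp (mulmx (invmx g)) oU).
    by apply: (smooth_on_linear vec_mx).
  have oN : open [set v | 1 + N v 0 0 != 0].
    have sF : smooth_on setT (fun v => 1 + N v 0 0).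
      apply: (smooth_onD openT); first exact: smooth_on_cst.
      by apply: smooth_on_entry; [exact: openT|apply: sN; exact: openT].
    have := continuous_on_open openT sF (@open_neq R 0).
    by congr open; apply/seteqP; split => [v []|v ?].
  exists [set M | 1 + (invmx g *m M) 0 0 != 0], (fun M => uncay (invmx g *m M)); split.
  + exact: one_chart_open.
  + by rewrite /= mulKmx //; have [] := cayK y.
  + apply: (@one_chart_smooth R _ _ _ _ (@vec_mx R 3 3) id id) => //=.
    apply: smooth_on_mx => // i j; rewrite ord1; move: j.
    have sNij k l : smooth_on [set v | 1 + N v 0 0 != 0] (fun v => N v k l : R).
      by apply: smooth_on_entry => //; exact: sN.
    elim/ord3P.
    * apply: (smooth_on_ext oN (f := fun v => N v 1 0 * (1 + N v 0 0)^-1)).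
        by move=> v _; rewrite /uncay [RHS]mxE.
      apply: (smooth_onM oN) => //; apply: (smooth_onV oN) => //.
      by apply: (smooth_onD oN) => //; exact: smooth_on_cst.
    * by apply: (smooth_on_ext oN (f := fun v => N v 0 2%:R)) => // v _; rewrite /uncay [RHS]mxE.
    * by apply: (smooth_on_ext oN (f := fun v => N v 1 2%:R)) => // v _; rewrite /uncay [RHS]mxE.
  + move=> h Eh /= h0; exists (uncay (invmx g *m h)) => //.
    by rewrite uncayK //; [rewrite mulKVmx|exact: E2_mul].
  + by move=> z _ _; rewrite mulKmx //; have [] := cayK z.
Qed.

Lemma E2_submanifold : submanifold 3 (mxspace3 R) (@E2 R).
Proof.
split => // g Eg; exists (cay_param g), 0; split => //=; first exact: cay_sub_param.
have -> : cay 0 = 1%:M; last by rewrite mulmx1.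
by rewrite /cay /cosc /sinc /tau !mxE mx3_1 /e2g; congr mx3; rewrite ?mul0r ?addr0 ?subr0 ?invr1 ?mulr1 ?oppr0.
Qed.

Lemma E2_manifold : smooth_manifold (E2_space R).
Proof.
apply: sub_space_manifold; [exact: mxspace3_manifold|exact: E2_submanifold|].
(* The rotation by pi. An element outside the chart at the identity has [a = -1], and multiplication
   by [g0] changes this entry to 1, so that the denominator becomes 2. *)
pose g0 := e2g (-1) 0 0 0.
have E0 : E2 g0 by apply/E2P; do 4!eexists; split; last reflexivity; ring.
exists [set cay_param 1%:M; cay_param g0]; split.
- by move=> c [] ->; apply: cay_sub_param => //; exact: E2_1.
- by apply: finite_set_countable; rewrite finite_setU; split; exact: finite_set1.
- move=> h Eh; have /E2P[a [b [x [y [ab hE]]]]] := Eh.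
  have [a1|a1] := eqVneq (1 + a) 0; last first.
    exists (cay_param 1%:M), (uncay h); split; [by left|by []|].
    by rewrite /= mul1mx uncayK // hE mxE.
  exists (cay_param g0), (uncay (g0 *m h)); split; [by right|by []|] => /=.
  have gg : g0 *m g0 = 1%:M.
    by rewrite /g0 e2g_mul mx3_1 /e2g; congr mx3; ring.
  rewrite uncayK; first by rewrite mulmxA gg mul1mx.
    exact: E2_mul.
  rewrite hE /g0 e2g_mul mxE /= mul0r subr0 mulN1r.
  have -> : a = -1 by apply/eqP; rewrite -subr_eq0 opprK addrC a1.
  by rewrite opprK -[1 + 1]/(2%:R) pnatr_eq0.
Qed.

End E2.

(** * Left-invariant fields on E_2 *)

Section E2cr.
Variable R : realType.
Implicit Types (y : 'rV[R]_3) (c d : param R 'M[R]_3 3).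

Lemma e2_mxE (K : pzRingType) (a b e : K) : e2_mx a b e = mx3 0 (- e) a e 0 b 0 0 0.
Proof. by []. Qed.

Lemma derive_sq0 (w y : 'rV[R]_3) :
  'D_w (fun y => y 0 0 * y 0 0 : R) y = 2 * y 0 0 * w 0 0.
Proof.
have d0 := differentiable_coord y 0 0.
by rewrite (deriveMf w d0 d0) derive_coord; ring.
Qed.

Lemma differentiable_sq0 y : differentiable (fun y : 'rV[R]_3 => y 0 0 * y 0 0 : R) y.
Proof.
have d0 := differentiable_coord y 0 0.
exact: (differentiableM d0 d0).
Qed.

Lemma derive_tau (w y : 'rV[R]_3) : 'D_w (@tau R) y = 2 * y 0 0 * w 0 0.
Proof.
have := deriveDf w (differentiable_cst (1 : R) y) (differentiable_sq0 y).
by rewrite derive_cst add0r derive_sq0.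
Qed.

Lemma differentiable_tau y : differentiable (@tau R) y.
Proof. exact: (smooth_on_differentiable (smooth_tau openT)). Qed.

Lemma derive_cosc (w y : 'rV[R]_3) :
  'D_w (@cosc R) y = - sinc y * (2 * w 0 0 / tau y).
Proof.
have t0 := tau_neq0 y.
have dV := differentiableV (differentiable_tau y) t0.
have d1 := differentiableB (differentiable_cst (1 : R) y) (differentiable_sq0 y).
have E := deriveMf w d1 dV.
etransitivity; first exact: E.
rewrite (deriveVf w t0 (differentiable_tau y)) derive_tau.
have -> : 'D_w (cst 1 \- (fun y : 'rV[R]_3 => y 0 0 * y 0 0)) y = - (2 * y 0 0 * w 0 0).
  have := @deriveB _ _ _ _ _ y w
    (diff_derivable (differentiable_cst (1 : R) y)) (diff_derivable (differentiable_sq0 y)).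
  by rewrite derive_cst sub0r derive_sq0.
rewrite [(cst 1 \- _) y](_ : _ = 1 - y 0 0 * y 0 0) //.
move: t0; rewrite /sinc /tau => t0; field.
by rewrite t0.
Qed.

Lemma derive_sinc (w y : 'rV[R]_3) :
  'D_w (@sinc R) y = cosc y * (2 * w 0 0 / tau y).
Proof.
have t0 := tau_neq0 y.
have dV := differentiableV (differentiable_tau y) t0.
have d0 := differentiable_coord y 0 0.
have d1 := differentiableD d0 d0.
have E := deriveMf w d1 dV.
etransitivity; first exact: E.
rewrite (deriveVf w t0 (differentiable_tau y)) derive_tau.
have -> : 'D_w ((fun y : 'rV[R]_3 => y 0 0 : R) \+ (fun y : 'rV[R]_3 => y 0 0)) y = 2 * w 0 0.
  by have := deriveDf w d0 d0; rewrite derive_coord => ->; ring.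
rewrite [X in X * (- _ * _)](_ : _ = y 0 0 + y 0 0) //.
move: t0; rewrite /cosc /tau => t0; field.
by rewrite t0.
Qed.

Lemma differentiable_cay y : differentiable (@cay R) y.
Proof. exact: (smooth_on_differentiable (smooth_cay openT)). Qed.

(** The second factor is the left Maurer-Cartan form. The coordinate [y 0 0] is tan(t/2), whence dt
    = 2 dy_0 / (1 + y_0^2); the translation part is the derivative of the translation, turned back
    by the inverse rotation. *)
Lemma derive_cay (w y : 'rV[R]_3) : 'D_w (@cay R) y = cay y *m
  e2_mx (cosc y * w 0 1 + sinc y * w 0 2%:R) (cosc y * w 0 2%:R - sinc y * w 0 1)
    (2 * w 0 0 / tau y).
Proof.
have dC : 'D_w (@cay R) y = mx3 ('D_w (@cosc R) y) (- 'D_w (@sinc R) y) (w 0 1)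
    ('D_w (@sinc R) y) ('D_w (@cosc R) y) (w 0 2%:R) 0 0 0.
  have ds : differentiable (@sinc R) y := smooth_on_differentiable (smooth_sinc openT) Logic.I.
  apply/matrixP; elim/ord3P; elim/ord3P; rewrite -(derive_entry w _ _ (differentiable_cay y)) mxE [RHS]/=.
  - by apply: eq_derive => z; rewrite mxE.
  - rewrite -(deriveN (diff_derivable ds)).
    by apply: eq_derive => z; rewrite mxE.
  - rewrite -[RHS](derive_coord 0 1 w y).
    by apply: eq_derive => z; rewrite mxE.
  - by apply: eq_derive => z; rewrite mxE.
  - by apply: eq_derive => z; rewrite mxE.
  - rewrite -[RHS](derive_coord 0 2%:R w y).
    by apply: eq_derive => z; rewrite mxE.
  - rewrite -[RHS](derive_cst (0 : R) y w).
    by apply: eq_derive => z; rewrite mxE.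
  - rewrite -[RHS](derive_cst (0 : R) y w).
    by apply: eq_derive => z; rewrite mxE.
  - rewrite -[RHS](derive_cst (1 : R) y w).
    by apply: eq_derive => z; rewrite mxE.
rewrite dC derive_cosc derive_sinc e2_mxE /cay /e2g mul_mx3.
have cs := cosc_sinc y; congr mx3; try ring.
- by transitivity ((cosc y ^+ 2 + sinc y ^+ 2) * w 0 1); [rewrite cs mul1r|ring].
- by transitivity ((cosc y ^+ 2 + sinc y ^+ 2) * w 0 2%:R); [rewrite cs mul1r|ring].
Qed.

Lemma cplxmx_e2 (a b e a' b' e' : R) : cplxmx (e2_mx a b e) (e2_mx a' b' e') =
  e2_mx (a +i* a')%C (b +i* b')%C (e +i* e')%C.
Proof. by rewrite !e2_mxE cplxmx_mx3. Qed.

Lemma cdiff_cay y v : cdiff (@cay R) y v = tocmx (cay y) *m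
  e2_mx ((cosc y)%:C * v 0 1 + (sinc y)%:C * v 0 2%:R)%C
        ((cosc y)%:C * v 0 2%:R - (sinc y)%:C * v 0 1)%C
        ((2 / tau y)%:C * v 0 0)%C.
Proof.
rewrite cdiff_cplxmx !derive_cay cplxmx_mulmxl cplxmx_e2 !mxE; congr (_ *m e2_mx _ _ _).
- by case: (v 0 1) (v 0 2%:R) => p q [p' q']; apply: eqC => /=; ring.
- by case: (v 0 1) (v 0 2%:R) => p q [p' q']; apply: eqC => /=; ring.
- by case: (v 0 0) => p q; apply: eqC => /=; field; exact: tau_neq0.
Qed.

(** The formula of [cdiff_cay] solved for [v]: the coordinates of the left-invariant field with
    value [e2_mx a b e] at the identity. *)
Definition cfld (a b e : R[i]) y : 'rV[R[i]]_3 :=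
  row3 ((tau y / 2)%:C * e)%C ((cosc y)%:C * a - (sinc y)%:C * b)%C
       ((sinc y)%:C * a + (cosc y)%:C * b)%C.

Lemma cdiff_cfld a b e y :
  cdiff (@cay R) y (cfld a b e y) = tocmx (cay y) *m e2_mx a b e.
Proof.
have t0 := tau_neq0 y.
have cs : ((cosc y)%:C * (cosc y)%:C + (sinc y)%:C * (sinc y)%:C = 1)%C.
  by rewrite -!rmorphM -rmorphD -!expr2 cosc_sinc.
rewrite cdiff_cay /cfld !mxE [nth _ _ _]/= [nth _ _ _]/= [nth _ _ _]/=.
congr (_ *m e2_mx _ _ _).
- by rewrite -[RHS]mul1r -cs; ring.
- by rewrite -[RHS]mul1r -cs; ring.
- rewrite mulrA -rmorphM.
  have -> : 2 / tau y * (tau y / 2) = 1 by field.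
  by rewrite mul1r.
Qed.

(** The chain rule for f o pmap c = pmap d o F. It moves computations from an unknown chart to a
    chosen one. *)
Lemma mx_rep_cdiff S c d f x F v : sub_param (mxspace3 R) S d ->
  local_rep c d f x F ->
  cdiff (fun y => f (pmap c y)) x v = cdiff (pmap d) (F x) (cdiff F x v).
Proof.
move=> sd rF; have [_ dF _ diF] := local_rep_at rF.
have [W [oW Wx _ _ FW]] := rF.
rewrite -(cdiff_comp v diF (mx_param_diff sd dF)).
by apply: (cdiff_ext v oW Wx) => y Wy; have [_ ->] := FW y Wy.
Qed.

Lemma cay0 : cay 0 = 1%:M :> 'M[R]_3.
Proof.
rewrite /cay /cosc /sinc /tau !mxE mx3_1 /e2g; congr mx3;
by rewrite ?mul0r ?addr0 ?subr0 ?invr1 ?mulr1 ?mul0r ?oppr0.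
Qed.

Lemma cay_param_cdiff g y v : cdiff (pmap (cay_param g)) y v = tocmx g *m cdiff (@cay R) y v.
Proof. exact: (cdiff_mulmxl g v (differentiable_cay y)). Qed.

Notation E2atlas := (sub_param (mxspace3 R) (@E2 R)).

Lemma E2_rep c d x z : E2atlas c -> E2atlas d -> pdom c x -> pdom d z -> pmap d z = pmap c x ->
  exists F, local_rep c d id x F /\ F x = z.
Proof.
move=> sc sd cx dz E; have [_ cS _ _] := sc.
have [F rF] := mfd_compat (@E2_manifold R) sc cx (cS _ cx) sd dz E.
exists F; split => //; have [_ dF EF _] := local_rep_at rF.
by apply: (sub_param_inj sd) => //; rewrite EF E.
Qed.

(** The chart [c] is compared with the explicit chart translated to the point itself, in which the
    point has coordinate 0 and [cay 0 = 1%:M]. *)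
Lemma E2_tangent c x v : E2atlas c -> pdom c x -> exists a b e,
  cdiff (pmap c) x v = tocmx (pmap c x) *m e2_mx a b e.
Proof.
move=> sc cx; have [_ cS _ _] := sc.
have Eg := cS _ cx.
have sd := cay_sub_param Eg.
have [|F [rF F0]] := E2_rep (z := 0) sc sd cx Logic.I; first by rewrite /= cay0 mulmx1.
rewrite (mx_rep_cdiff v sd rF) cay_param_cdiff cdiff_cay mulmxA -tocmxM F0 cay0 mulmx1.
by do 3!eexists.
Qed.

Lemma E2_tangent_surj c x a b e : E2atlas c -> pdom c x -> exists v,
  cdiff (pmap c) x v = tocmx (pmap c x) *m e2_mx a b e.
Proof.
move=> sc cx; have [_ cS _ _] := sc.
have Eg := cS _ cx.
have sd := cay_sub_param Eg.
have [|G [rG G0]] := E2_rep (x := 0) sd sc Logic.I cx; first by rewrite /= cay0 mulmx1.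
exists (cdiff G 0 (cfld a b e 0)).
rewrite -G0 -(mx_rep_cdiff _ sc rG) cay_param_cdiff cdiff_cfld cay0 mulmxA -tocmxM mulmx1.
by rewrite G0.
Qed.

Lemma csmooth_mx_entry c (W : set 'rV[R]_3) i j : E2atlas c -> open W -> W `<=` pdom c ->
  csmooth W (fun y => (pmap c y i j)%:C%C).
Proof.
move=> sc oW Wc; apply: csmooth_real; apply: smooth_on_entry => //.
exact: smooth_on_sub Wc (mx_param_smooth sc).
Qed.

(** In an arbitrary chart a left-invariant field is the image of the matrix g A under the
    differential of the local retraction, hence smooth. One neighbourhood [W] serves all [a b e], so
    that several fields can be bracketed on it. *)
Lemma E2_field c x : E2atlas c -> pdom c x -> exists W,
  [/\ open W, W x, W `<=` pdom c & forall a b e, exists X, csmooth_on W X /\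
   forall y, W y -> cdiff (pmap c) y (X y) = tocmx (pmap c y) *m e2_mx a b e].
Proof.
move=> sc cx; have [rho [U [W [[oU sr oW Wx] [Wc rK]]]]] := mx_param_retract sc cx.
exists W; split => // a b e.
exists (fun y => cdiff rho (mxvec (pmap c y)) (mxvec (tocmx (pmap c y) *m e2_mx a b e))).
split; last first.
  move=> y Wy; have [v Ev] := E2_tangent_surj a b e sc (Wc _ Wy).
  rewrite -Ev; congr (cdiff _ _ _).
  exact: (mx_param_cdiffK sc oU sr oW Wy Wc rK).
apply/(csmoothP _ oW) => k.
pose r z := (rho z 0 k)%:C%C.
have csr : csmooth U r by apply: csmooth_real; exact: smooth_on_entry.
apply: (csmooth_ext oW (u := fun y => \sum_j mxvec (tocmx (pmap c y) *m e2_mx a b e) 0 j *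
    derivec (delta_mx 0 j) (mxvec (pmap c y)) r)).
  move=> y Wy; symmetry; apply: cdiffE.
  by apply: (smooth_on_differentiable sr); have [] := rK y Wy.
apply: (csmooth_sum oW) => j; apply: (csmoothM oW); last first.
  apply: (csmooth_comp oW (W := U) (f := fun y => mxvec (pmap c y)) (u := fun z => derivec (delta_mx 0 j) z r)).
  - by move=> y Wy; have [] := rK y Wy.
  - apply: smooth_on_linear_comp => //.
    exact: smooth_on_sub Wc (mx_param_smooth sc).
  - exact: csmooth_derivec.
case/mxvec_indexP: j => i l.
apply: (csmooth_ext oW (u := fun y => \sum_m (pmap c y i m)%:C%C * e2_mx a b e m l)).
  by move=> y Wy; rewrite mxvecE [RHS]mxE; apply: eq_bigr => m _; rewrite [in RHS]mxE.
apply: (csmooth_sum oW) => m; apply: (csmoothM oW); last exact: csmooth_cst.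
exact: csmooth_mx_entry.
Qed.

Lemma cderive_sum n (I : Type) (s : seq I) (u : I -> 'rV[R]_n -> R[i]) v x U :
  open U -> U x -> (forall i, csmooth U (u i)) ->
  cderive v x (fun z => \sum_(i <- s) u i z) = \sum_(i <- s) cderive v x (u i).
Proof.
move=> oU Ux us; elim: s => [|i s IH].
  rewrite big_nil -[RHS](cderive_cst v x 0).
  by apply: (cderive_ext _ oU Ux) => z _; rewrite big_nil.
rewrite big_cons -IH -cderiveD.
- by apply: (cderive_ext _ oU Ux) => z _; rewrite big_cons.
- exact: (csmooth_cdifferentiable (us i)).
- exact: (csmooth_cdifferentiable (csmooth_sum oU s us)).
Qed.

(** The matrix entries are used as functions: X maps the matrix function g to g A, so X applied
    after Y maps it to g A B, the factor B being constant. The commutator gives g (A B - B A),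
    without coordinates of the fields. *)
Lemma E2_bracket c W X Y A B : E2atlas c -> open W -> W `<=` pdom c ->
  csmooth_on W X -> csmooth_on W Y ->
  (forall y, W y -> cdiff (pmap c) y (X y) = tocmx (pmap c y) *m A) ->
  (forall y, W y -> cdiff (pmap c) y (Y y) = tocmx (pmap c y) *m B) ->
  forall y, W y ->
   cdiff (pmap c) y (lie_bracket X Y y) = tocmx (pmap c y) *m (A *m B - B *m A).
Proof.
move=> sc oW Wc sX sY.
pose u i j y := (pmap c y i j)%:C%C.
have us i j : csmooth W (u i j) by exact: csmooth_mx_entry.
have cE y v i j : W y -> cdiff (pmap c) y v i j = cderive v y (u i j).
  by move=> Wy; apply: cdiffE; apply: (mx_param_diff sc); exact: Wc.
have main X' Y' A' B' :
  (forall y, W y -> cdiff (pmap c) y (X' y) = tocmx (pmap c y) *m A') ->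
  (forall y, W y -> cdiff (pmap c) y (Y' y) = tocmx (pmap c y) *m B') ->
  forall y i j, W y -> cderive (X' y) y (fun z => cderive (Y' z) z (u i j)) =
    (tocmx (pmap c y) *m (A' *m B')) i j.
  move=> XA YB y i j Wy.
  transitivity (cderive (X' y) y (fun z => \sum_k u i k z * B' k j)).
    apply: (cderive_ext _ oW Wy) => z Wz; rewrite -cE // YB // mxE.
    by apply: eq_bigr => k _; rewrite mxE.
  rewrite (cderive_sum _ _ oW Wy); last first.
    by move=> k; apply: (csmoothM oW); [exact: us|exact: csmooth_cst].
  rewrite mulmxA mxE; apply: eq_bigr => k _.
  rewrite cderiveM; [|exact: csmooth_cdifferentiable (us i k) Wy|exact: cdifferentiable_cst].
  by rewrite cderive_cst mulr0 addr0 -cE // XA.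
move=> XA YB y Wy; apply/matrixP => i j.
rewrite cE // (cderive_lie_bracket oW sX sY (us i j) Wy) (main X Y A B) // (main Y X B A) //.
by rewrite mulmxBr [RHS]mxE [X in _ = _ + X]mxE.
Qed.

End E2cr.

(** * Left-invariant line fields under matrix multiplication, and the structure spanned by L *)

Section E2V.
Variable R : realType.
Notation E2atlas := (sub_param (mxspace3 R) (@E2 R)).
Implicit Types (c d : param R 'M[R]_3 3) (X : 'M[R[i]]_3).

Lemma unit_tocmx n (a : 'M[R]_n) : a \in unitmx -> tocmx a \in unitmx.
Proof. by rewrite map_unitmx. Qed.

Lemma conj_cancel (K : comUnitRingType) (A B g Z : 'M[K]_3) (l : K) :
  A \in unitmx -> B \in unitmx ->
  invmx A *m (l *: (A *m g *m B *m (invmx B *m Z *m B))) *m invmx B = l *: (g *m Z).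
Proof.
move=> uA uB; rewrite -scalemxAr -scalemxAl !mulmxA mulVmx // mul1mx.
by rewrite mulmxK // mulmxK.
Qed.

(** The reason is a (g X) b = (a g b) (b^-1 X b): the left factor is absorbed by the base point, the
    right one conjugates [X]. The map [G] is there to show that every vector of the target line is
    attained. *)
Lemma left_line_field_map c d x F G (a b : 'M[R]_3) X :
  a \in unitmx -> b \in unitmx -> E2atlas c -> E2atlas d ->
  local_rep c d (fun g => a *m g *m b) x F ->
  local_rep d c (fun g => invmx a *m g *m invmx b) (F x) G ->
  cdiff F x @` left_line_field X c x =
  left_line_field (invmx (tocmx b) *m X *m tocmx b) d (F x).
Proof.
move=> ua ub sc sd rF rG.
have [cx dF EF diF] := local_rep_at rF; have [_ cG EG diG] := local_rep_at rG.
have Gx : G (F x) = x.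
  by apply: (sub_param_inj sc) => //; rewrite EG EF mulmxA mulmxK // mulKmx.
have ua' := unit_tocmx ua; have ub' := unit_tocmx ub.
have Fc v : cdiff (pmap d) (F x) (cdiff F x v) = tocmx a *m cdiff (pmap c) x v *m tocmx b.
  rewrite -(mx_rep_cdiff v sd rF); exact: (cdiff_mulmx a b v (mx_param_diff sc cx)).
apply/seteqP; split => w /=.
  move=> [v [l _ Ev] <-]; exists l => //; rewrite Fc -Ev EF !tocmxM.
  by rewrite -scalemxAr -scalemxAl !mulmxA mulmxK.
move=> [l _ Ew].
have Gc : cdiff (pmap c) x (cdiff G (F x) w) = invmx (tocmx a) *m cdiff (pmap d) (F x) w *m invmx (tocmx b).
  have := mx_rep_cdiff w sc rG; rewrite Gx => <-.
  rewrite -!map_invmx; exact: (cdiff_mulmx (invmx a) (invmx b) w (mx_param_diff sd dF)).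
exists (cdiff G (F x) w).
  exists l => //; rewrite Gc -Ew EF (tocmxM (a *m pmap c x) b) (tocmxM a (pmap c x)).
  by symmetry; apply: conj_cancel.
apply: (mx_param_cdiff_inj sd dF); rewrite Fc Gc !mulmxA mulmxV // mul1mx.
by rewrite mulmxKV.
Qed.

Lemma mx_bilin_smooth (a b : 'M[R]_3) :
  smooth_map (mxspace3 R) setT (mxspace3 R) (fun g => a *m g *m b).
Proof.
have oT : open [set x : 'rV[R]_(3 * 3) | setT (@vec_mx R 3 3 x)].
  by rewrite (_ : [set x | _] = setT) //; exact: openT.
apply: (one_chart_smooth (@mxvecK R 3 3) (@vec_mxK R 3 3) oT).
exact: (smooth_on_linear (mxvec \o mulmxr b \o mulmx a \o vec_mx)).
Qed.

Lemma open_in_setT : open_in (mxspace3 R) setT.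
Proof.
apply: (@one_chart_open R _ _ (@vec_mx R 3 3)).
by rewrite (_ : [set x | _] = setT) //; exact: openT.
Qed.

Lemma E2_diffeo (a b : 'M[R]_3) : a \in unitmx -> b \in unitmx ->
  (forall g, E2 g -> E2 (a *m g *m b)) ->
  (forall g, E2 g -> E2 (invmx a *m g *m invmx b)) ->
  diffeo_on (E2_space R) (@E2 R) (E2_space R) (@E2 R) (fun g => a *m g *m b).
Proof.
move=> ua ub Eab Eab'.
apply: (@diffeo_sub R _ _ _ _ (mxspace3 R) (mxspace3 R) (@E2 R) (@E2 R)
  (fun g => a *m g *m b) (fun g => invmx a *m g *m invmx b) setT setT) => //.
- exact: mxspace3_covered.
- exact: mxspace3_covered.
- exact: open_in_setT.
- exact: open_in_setT.
- exact: mx_bilin_smooth.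
- exact: mx_bilin_smooth.
- move=> g Eg; split; first exact: Eab.
  by rewrite mulmxA mulmxK // mulKmx.
- move=> g Eg; split; first exact: Eab'.
  by rewrite mulmxA mulmxKV // mulKVmx.
Qed.

(** Two-sided multiplication covers both uses: [b = 1%:M] gives left translations, and [b = invmx a]
    gives the automorphisms that are conjugations by similarities. *)
Lemma left_line_field_cr_equiv (a b : 'M[R]_3) X (V : cr_field R 'M[R]_3) :
  a \in unitmx -> b \in unitmx ->
  (forall g, E2 g -> E2 (a *m g *m b)) ->
  (forall g, E2 g -> E2 (invmx a *m g *m invmx b)) ->
  (forall c x, E2atlas c -> pdom c x -> V c x = left_line_field X c x) ->
  cr_equiv (E2_space R) V (E2_space R)
    (left_line_field (invmx (tocmx b) *m X *m tocmx b)) (fun g => a *m g *m b).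
Proof.
move=> ua ub Eab Eab' VX; split; first exact: E2_diffeo.
move=> c d x F sc sd Ex rF; have [cx dF EF diF] := local_rep_at rF.
have [g [fg gf sf sg]] : diffeo_on (E2_space R) (@E2 R) (E2_space R) (@E2 R)
  (fun g => invmx a *m g *m invmx b).
  by apply: E2_diffeo; rewrite ?unitmx_inv //= => g Eg; rewrite !invmxK; exact: Eab.
have [_ dS _ _] := sd.
have [|G rG] := sf d (F x) c x sd dF (dS _ dF) sc cx.
  by rewrite EF mulmxA mulmxK // mulKmx.
by rewrite VX // (left_line_field_map X ua ub sc sd rF rG).
Qed.

Lemma E2_V_left_invariant : left_invariant (@E2_V R).
Proof.
move=> h Eh; have [uh Eih _] := E2_inv Eh.
have := @left_line_field_cr_equiv h 1%:M (e2_L R) (@E2_V R) uh (unitmx1 _ _).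
have -> : invmx (tocmx 1%:M) *m e2_L R *m tocmx 1%:M = e2_L R.
  by rewrite tocmx1 invmx1 mul1mx mulmx1.
have -> : (fun g : 'M[R]_3 => h *m g *m 1%:M) = (fun g => h *m g).
  by apply/funext => g; rewrite mulmx1.
apply => //.
- by move=> g Eg; rewrite mulmx1; exact: E2_mul.
- by move=> g Eg; rewrite invmx1 mulmx1; exact: E2_mul.
Qed.

Lemma e2_LE : e2_L R = e2_mx 1 0 'i%C.
Proof. by []. Qed.

Lemma e2_mx_lin (k a b e a' b' e' : R[i]) :
  k *: e2_mx a b e + e2_mx a' b' e' = e2_mx (k * a + a') (k * b + b') (k * e + e').
Proof.
rewrite !e2_mxE; apply/matrixP; elim/ord3P; elim/ord3P; rewrite !mxE /=; ring.
Qed.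

Lemma e2_mxZ (k a b e : R[i]) : k *: e2_mx a b e = e2_mx (k * a) (k * b) (k * e).
Proof.
rewrite !e2_mxE; apply/matrixP; elim/ord3P; elim/ord3P; rewrite !mxE /=; ring.
Qed.

Lemma e2_mxD (a b e a' b' e' : R[i]) :
  e2_mx a b e + e2_mx a' b' e' = e2_mx (a + a') (b + b') (e + e').
Proof. by rewrite -[e2_mx a b e]scale1r e2_mx_lin !mul1r. Qed.

Lemma e2_mx_inj (a b e a' b' e' : R[i]) : e2_mx a b e = e2_mx a' b' e' ->
  [/\ a = a', b = b' & e = e'].
Proof. by rewrite !e2_mxE => /mx3_inj [[_ _ ->] [[-> _ ->] _]]. Qed.

Lemma e2_bracket (a b e a' b' e' : R[i]) :
  e2_mx a b e *m e2_mx a' b' e' - e2_mx a' b' e' *m e2_mx a b e =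
  e2_mx (e' * b - e * b') (e * a' - e' * a) 0.
Proof.
rewrite !e2_mxE !mul_mx3; apply/matrixP; elim/ord3P; elim/ord3P; rewrite !mxE /=; ring.
Qed.

Lemma conjmx_e2 (a b e : R[i]) :
  conjmx (e2_mx a b e) = e2_mx (conjc a) (conjc b) (conjc e).
Proof.
apply/matrixP; elim/ord3P; elim/ord3P; rewrite !mxE //= ?oppr0 //.
by rewrite rmorphN.
Qed.

Lemma conjmx_tocmx_mul (g : 'M[R]_3) (A : 'M[R[i]]_3) :
  conjmx (tocmx g *m A) = tocmx g *m conjmx A.
Proof.
apply/matrixP => i j; rewrite !mxE rmorph_sum; apply: eq_bigr => k _.
by rewrite !mxE rmorphM /= oppr0.
Qed.

Lemma E2_pt_unit c x : E2atlas c -> pdom c x -> tocmx (pmap c x) \in unitmx.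
Proof.
move=> [_ cS _ _] cx; apply: unit_tocmx.
by have [] := E2_inv (cS _ cx).
Qed.

Lemma mulmx_inj (g A B : 'M[R[i]]_3) : g \in unitmx -> g *m A = g *m B -> A = B.
Proof. by move=> ug E; rewrite -(mulKmx ug A) E mulKmx. Qed.

Lemma left_line_fieldE c x v X : E2atlas c -> pdom c x ->
  cdiff (pmap c) x v = tocmx (pmap c x) *m X ->
  left_line_field X c x = cline v.
Proof.
move=> sc cx Ev; have dc := mx_param_diff sc cx.
apply/seteqP; split => w /= [l _ E].
  exists l => //; apply: (mx_param_cdiff_inj sc cx).
  by rewrite cdiffZ // Ev.
by exists l => //; rewrite -E cdiffZ // Ev.
Qed.

Lemma E2_cr_structure : cr_structure (E2_space R) (@E2_V R).
Proof.
have mE := @E2_manifold R.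
have ii : 'i%C * 'i%C = -1 :> R[i] by apply: eqC => /=; ring.
have i0 : 'i%C != 0 :> R[i] by apply/eqP => /(congr1 (@complex.Im R)) /= /eqP; rewrite oner_eq0.
have ic : conjc 'i%C = - 'i%C :> R[i] by apply: eqC => /=; rewrite ?oppr0.
have icN : conjc (- 'i%C) = 'i%C :> R[i] by apply: eqC => /=; rewrite ?oppr0 ?opprK.
split => //.
- split.
  + move=> c d x F sc sd rF.
    have [cx dF EF _] := local_rep_at rF; have [_ dS _ _] := sd.
    have [|G [rG _]] := E2_rep (x := F x) (z := x) sd sc dF cx; first by rewrite EF.
    (* A change of charts represents the identity, so independence of the chart is the case of
       trivial factors of [left_line_field_map]. *)
    have eid : (id : 'M[R]_3 -> 'M[R]_3) = fun g => 1%:M *m g *m 1%:M.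
      by apply/funext => g; rewrite mul1mx mulmx1.
    have eid' : (id : 'M[R]_3 -> 'M[R]_3) = fun g => invmx 1%:M *m g *m invmx 1%:M.
      by apply/funext => g; rewrite invmx1 mul1mx mulmx1.
    rewrite eid in rF; rewrite eid' in rG.
    rewrite (left_line_field_map (e2_L R) (unitmx1 _ _) (unitmx1 _ _) sc sd rF rG).
    by rewrite tocmx1 invmx1 mul1mx mulmx1.
  + move=> c x sc cx; have [W [oW Wx Wc /(_ 1 0 'i%C) [X [sX XL]]]] := E2_field sc cx.
    exists W, X; split => // y Wy; split; last exact: (left_line_fieldE sc (Wc _ Wy) (XL _ Wy)).
    move=> X0; have := XL y Wy; rewrite X0.
    have -> : cdiff (pmap c) y 0 = tocmx (pmap c y) *m 0.
      rewrite mulmx0 -(scale0r 0) cdiffZ ?scale0r //; exact: (mx_param_diff sc (Wc _ Wy)).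
    move=> /(mulmx_inj (E2_pt_unit sc (Wc _ Wy))).
    have -> : (0 : 'M[R[i]]_3) = e2_mx 0 0 0.
      by apply/matrixP; elim/ord3P; elim/ord3P; rewrite !mxE /= ?oppr0.
    by move=> /e2_mx_inj [/eqP]; rewrite eq_sym oner_eq0.
- move=> c x sc cx; have [v Ev] := E2_tangent_surj 1 0 'i%C sc cx.
  rewrite /E2_V (left_line_fieldE sc cx Ev) ; have dc := mx_param_diff sc cx.
  apply/seteqP; split => w /=; last first.
    move=> ->; split; first by exists 0 => //; rewrite scale0r.
    exists 0; first by exists 0 => //; rewrite scale0r.
    by apply/rowP => j; rewrite !mxE conjc0.
  move=> [[l _ <-] [_ [k _ <-] E]].
  have : cdiff (pmap c) x (conjmx (k *: v)) = cdiff (pmap c) x (l *: v) by rewrite E.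
  rewrite cdiff_conj // !cdiffZ // Ev !scalemxAr conjmx_tocmx_mul.
  move=> /(mulmx_inj (E2_pt_unit sc cx)).
  rewrite !e2_mxZ conjmx_e2 => /e2_mx_inj [E1 _ E3].
  (* The translation entries give [conjc k = l] and the rotation entries give - i l = i l. *)
  have : l = 0.
    have {}E1 : conjc k = l by rewrite -[LHS](congr1 conjc (mulr1 k)) E1 mulr1.
    have {}E3 : conjc k * conjc 'i%C = l * 'i%C by rewrite -E3 rmorphM.
    move: E3; rewrite E1 ic mulrN => /eqP.
    rewrite eq_sym -addr_eq0 -mulr2n -mulr_natr -mulrA mulf_eq0 => /orP[/eqP //|].
    by rewrite mulf_eq0 (negPf i0) pnatr_eq0.
  by move=> ->; rewrite scale0r.
- move=> c x sc cx; have [W [oW Wx Wc fW]] := E2_field sc cx.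
  have [X [sX XL]] := fW 1 0 'i%C; have [Y [sY YL]] := fW 1 0 (- 'i%C).
  exists W; split => // w.
  have [a [b [e Ew]]] := E2_tangent w sc cx.
  have iX : iterated_bracket (@E2_V R) c W X.
    apply: ib_section => // y Wy; exists (X y).
      by rewrite /E2_V (left_line_fieldE sc (Wc _ Wy) (XL _ Wy)); exists 1 => //; rewrite scale1r.
    exists 0; first by rewrite /E2_V (left_line_fieldE sc (Wc _ Wy) (XL _ Wy)); exists 0 => //; rewrite scale0r.
    by rewrite -[RHS]addr0; congr (_ + _); apply/rowP => j; rewrite !mxE conjc0.
  have iY : iterated_bracket (@E2_V R) c W Y.
    apply: ib_section => // y Wy; exists 0.
      by rewrite /E2_V (left_line_fieldE sc (Wc _ Wy) (XL _ Wy)); exists 0 => //; rewrite scale0r.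
    exists (conjmx (Y y)); last first.
      by rewrite add0r; apply/rowP => j; rewrite !mxE conjcK.
    exists 1 => //; rewrite scale1r cdiff_conj; last exact: (mx_param_diff sc (Wc _ Wy)).
    by rewrite YL // conjmx_tocmx_mul conjmx_e2 conjc1 conjc0 icN.
  (* These are the coordinates of (a, b, e) in the basis L = (1, 0, i), conj L = (1, 0, - i),
     [L, conj L] = (0, 2 i, 0). *)
  exists 3, (fun j : 'I_3 => nth 0 [:: (a - 'i%C * e) / 2; (a + 'i%C * e) / 2; b / (2 * 'i%C)] j).
  exists (fun j : 'I_3 => nth X [:: X; Y; lie_bracket X Y] j); split.
    elim/ord3P => //=; exact: ib_bracket.
  rewrite sum3 /=; have dc := mx_param_diff sc cx.
  apply: (mx_param_cdiff_inj sc cx).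
  rewrite cdiffD // cdiffD // !cdiffZ // XL // YL // (E2_bracket sc oW Wc sX sY XL YL Wx) Ew.
  rewrite !scalemxAr -!mulmxDr; congr (_ *m _).
  rewrite e2_bracket !e2_mxZ !e2_mxD; congr e2_mx.
  - by field.
  - by field.
  - symmetry; transitivity (- ('i%C * 'i%C) * e); first by field.
    by rewrite ii opprK mul1r.
Qed.

End E2V.

(** * Classification of the left-invariant CR structures *)

Section left_invariant.
Variable R : realType.
Notation E2atlas := (sub_param (mxspace3 R) (@E2 R)).
Implicit Types (c d : param R 'M[R]_3 3) (W : cr_field R 'M[R]_3).

(** The line at the identity fixes (a, b, e), up to the choice of the spanning vector. The line at
    [g = pmap c x] is compared with it through the left translation by [invmx g], a CR equivalence
    that sends [g] to the identity. *)
Lemma left_invariant_field W :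
  cr_structure (E2_space R) W -> left_invariant W -> exists a b e,
  forall c x, E2atlas c -> pdom c x -> W c x = left_line_field (e2_mx a b e) c x.
Proof.
move=> crW lW.
have s0 := cay_sub_param (@E2_1 R).
have [U [X [oU U0 Uc sX XW]]] := (cr_line crW).2 _ 0 s0 Logic.I.
have [_ W0] := XW 0 U0.
have [a [b [e Ev]]] := E2_tangent (X 0) s0 (Logic.I : pdom (cay_param 1%:M) 0).
exists a, b, e => c x sc cx; have [_ cS _ _] := sc.
have Eg := cS _ cx; have [ug Eig [ig gi]] := E2_inv Eg.
have [df H] := lW _ Eig; have [f [fg gf sf sg]] := df.
have E0 : pmap (cay_param 1%:M) 0 = invmx (pmap c x) *m pmap c x by rewrite /= mul1mx cay0 ig.
have [F rF] := sf c x _ 0 sc cx Eg s0 Logic.I E0.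
have [_ _ EF _] := local_rep_at rF.
have F0 : F x = 0 by apply: (sub_param_inj s0) => //; rewrite EF E0.
have HF := H c _ x F sc s0 Eg rF.
rewrite F0 W0 in HF.
have p0 : pmap (cay_param 1%:M) 0 = 1%:M :> 'M[R]_3 by rewrite /= mul1mx cay0.
have Fc v : cdiff (pmap (cay_param 1%:M)) 0 (cdiff F x v) =
    tocmx (invmx (pmap c x)) *m cdiff (pmap c) x v.
  rewrite -{1}F0 -(mx_rep_cdiff v s0 rF).
  exact: (cdiff_mulmxl (invmx (pmap c x)) v (mx_param_diff sc cx)).
(* A vector is carried to a multiple of the spanning vector at the identity exactly if its matrix is
   that multiple of g (a, b, e); both inclusions follow from this. *)
have Fl v l : cdiff F x v = l *: X 0 <-> cdiff (pmap c) x v = tocmx (pmap c x) *m (l *: e2_mx a b e).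
  have dp := mx_param_diff s0 (Logic.I : pdom (cay_param 1%:M) 0).
  split=> Eq.
    have := Fc v; rewrite Eq cdiffZ // Ev p0 tocmx1 mul1mx => ->.
    by rewrite mulmxA -tocmxM gi tocmx1 mul1mx.
  apply: (@mx_param_cdiff_inj R 3 _ _ s0 0 _ _ Logic.I); rewrite Fc Eq mulmxA -tocmxM ig tocmx1 mul1mx.
  by rewrite cdiffZ // Ev p0 tocmx1 mul1mx.
apply/seteqP; split => v /=.
  move=> Wv; have : cline (X 0) (cdiff F x v) by rewrite -HF; exists v.
  by move=> [l _ E]; exists l => //; have := (Fl v l).1 (esym E); rewrite -scalemxAr => ->.
move=> [l _ E]; have Ev' := (Fl v l).2 (etrans (esym E) (scalemxAr _ _ _)).
have : (cdiff F x @` W c x) (cdiff F x v) by rewrite HF Ev'; exists l.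
move=> [v' Wv' E'].
have E1 := (Fl v' l).1 (etrans E' Ev').
suff <- : v' = v by [].
apply: (mx_param_cdiff_inj sc cx).
by rewrite E1 -E -scalemxAr.
Qed.

(* If e = 0, every section lies in the abelian ideal of translations, on which the
   rotation entry (1, 0) has zero derivative, and so do all iterated brackets. *)
Lemma E2_cr_nonabelian W a b e :
  cr_structure (E2_space R) W ->
  (forall c x, E2atlas c -> pdom c x -> W c x = left_line_field (e2_mx a b e) c x) ->
  e != 0.
Proof.
move=> crW WX; apply/eqP => e0; rewrite e0 in WX.
have s0 := cay_sub_param (@E2_1 R).
set c0 := cay_param 1%:M in s0.
have [U [oU U0 Uc HU]] := cr_nondegenerate crW s0 (Logic.I : pdom c0 0).
pose u i j (y : 'rV[R]_3) := (pmap c0 y i j)%:C%C.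
have us i j : csmooth U (u i j) by exact: csmooth_mx_entry.
have uE i j v y : U y -> cderive v y (u i j) = cdiff (pmap c0) y v i j.
  by move=> Uy; symmetry; apply: cdiffE; apply: (mx_param_diff s0).
have flat v y : W c0 y v -> cdiff (pmap c0) y v 1 0 = 0.
  rewrite WX // => -[l _ <-]; rewrite !mxE sum3 !mxE /=; ring.
have key X : iterated_bracket W c0 U X ->
    csmooth_on U X /\ forall y, U y -> cderive (X y) y (u 1 0) = 0.
  elim=> [{}X sX XV|X1 X2 _ [s1 z1] _ [s2 z2]].
    split => // y Uy; have [v Wv [v' Wv' <-]] := XV y Uy.
    etransitivity; first exact: cderiveDv.
    have -> : cderive v y (u 1 0) = 0 by exact: etrans (uE _ _ _ _ Uy) (flat _ _ Wv).
    rewrite add0r; etransitivity; first exact: uE.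
    have dp : differentiable (pmap c0) y by exact: (mx_param_diff s0).
    have /(congr1 (fun A : 'M[R[i]]_3 => A 1 0)) E := cdiff_conj v' dp.
    etransitivity; first exact: E.
    rewrite mxE; etransitivity; last exact: conjc0.
    by congr conjc; exact: (flat _ _ Wv').
  split; first exact: csmooth_lie_bracket.
  move=> y Uy; rewrite (cderive_lie_bracket oU s1 s2 (us 1 0) Uy).
  rewrite (cderive_ext _ oU Uy z2) (cderive_ext _ oU Uy z1) !cderive_cst subr0 //.
have [v Ev] := E2_tangent_surj 0 0 1 s0 (Logic.I : pdom c0 0).
have [k [l [X [iX vE]]]] := HU v.
have : cderive v 0 (u 1 0) = 0.
  rewrite vE; have : forall s : seq 'I_k, cderive (\sum_(j <- s) l j *: X j 0) 0 (u 1 0) = 0.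
    elim=> [|j s IH]; first by rewrite big_nil cderive0v.
    by rewrite big_cons cderiveDv cderiveZv IH (key _ (iX j)).2 // mulr0 addr0.
  by apply.
have p0 : pmap c0 0 = 1%:M :> 'M[R]_3 by rewrite /= mul1mx cay0.
rewrite uE // Ev p0 tocmx1 mul1mx mxE /= => /eqP.
by rewrite oner_eq0.
Qed.

(** Such a proportionality would put the conjugate of the spanning vector into the line and into its
    conjugate, whose intersection is zero. *)
Lemma E2_cr_nonreal W a b e :
  cr_structure (E2_space R) W ->
  (forall c x, E2atlas c -> pdom c x -> W c x = left_line_field (e2_mx a b e) c x) ->
  forall l : R[i], conjmx (e2_mx a b e) <> l *: e2_mx a b e.
Proof.
move=> crW WX l E.
have s0 := cay_sub_param (@E2_1 R).
set c0 := cay_param 1%:M in s0.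
have cx : pdom c0 0 by [].
have dp := mx_param_diff s0 cx.
have p0 : pmap c0 0 = 1%:M :> 'M[R]_3 by rewrite /= mul1mx cay0.
have [v Ev] := E2_tangent_surj a b e s0 cx.
have Wv : W c0 0 = cline v by rewrite WX //; exact: (left_line_fieldE s0 cx Ev).
have [U [X [oU U0 _ _ XW]]] := (cr_line crW).2 _ 0 s0 cx.
have [X0 WX0] := XW 0 U0.
have vn : v <> 0.
  move=> v0; have : cline (X 0) (X 0) by exists 1; rewrite ?scale1r.
  by rewrite -WX0 Wv v0 => -[k _]; rewrite scaler0 => /esym.
have : (W c0 0 `&` [set conjmx v | v in W c0 0]) (conjmx v).
  rewrite Wv; split; last by exists v => //; exists 1; rewrite ?scale1r.
  exists l => //; apply: (mx_param_cdiff_inj s0 cx).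
  by rewrite cdiffZ // cdiff_conj // Ev p0 tocmx1 !mul1mx E.
rewrite (cr_transverse crW) // => /(congr1 (@conjmx R _ _)) E0.
apply: vn; apply/rowP => j; have := congr1 (fun w : 'rV[R[i]]_3 => w 0 j) E0.
by rewrite !mxE conjcK conjc0.
Qed.

(* m is a similarity of the plane: the rotation and homothety make the real part of
   the translation vector a unit vector, and the translation kills its imaginary part. *)
Lemma e2_normal_form (a b e : R[i]) : e != 0 ->
  (forall l : R[i], conjmx (e2_mx a b e) <> l *: e2_mx a b e) ->
  exists (m : 'M[R]_3) (k : R[i]), [/\ m \in unitmx, k != 0,
   tocmx m *m e2_mx a b e *m invmx (tocmx m) = k *: e2_L R &
   forall g, E2 g -> E2 (m *m g *m invmx m) /\ E2 (invmx m *m g *m m)].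
Proof.
move=> e0 nr.
have ii : 'i%C * 'i%C = -1 :> R[i] by apply: eqC => /=; ring.
have i0 : 'i%C != 0 :> R[i] by apply/eqP => /(congr1 (@complex.Im R)) /= /eqP; rewrite oner_eq0.
(* After division by [k] the rotation entry is i, as in L. *)
pose k := - 'i%C * e.
have k0 : k != 0 by rewrite mulf_neq0 // oppr_eq0.
have ki : k * 'i%C = e.
  by transitivity (- ('i%C * 'i%C) * e); [rewrite /k; ring|rewrite ii opprK mul1r].
have [A Ea] : exists A, a = k * A by exists (a / k); field.
have [B Eb] : exists B, b = k * B by exists (b / k); field.
have XE : e2_mx a b e = k *: e2_mx A B 'i%C by rewrite e2_mxZ ki Ea Eb.
case: A Ea XE => a1 a2 Ea XE; case: B Eb XE => b1 b2 Eb XE.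
pose n := a1 ^+ 2 + b1 ^+ 2.
(* If the real parts of [A] and [B] vanish, then (A, B, i) is i times a real matrix, which is
   proportional to its conjugate. *)
have n0 : n != 0.
  apply/eqP => /eqP; rewrite paddr_eq0 ?sqr_ge0 // !sqrf_eq0 => /andP[/eqP a10 /eqP b10].
  apply: (nr (- conjc k / k)); rewrite XE a10 b10 !e2_mxZ conjmx_e2.
  have E (z : R[i]) : conjc z = - z -> conjc (k * z) = - conjc k / k * (k * z).
    move=> Ez; transitivity (conjc k * conjc z); first exact: rmorphM.
    by rewrite Ez; field.
  by congr e2_mx; apply: E; apply: eqC => /=; rewrite ?oppr0.
(* u + i v = 1 / (a1 + i b1), so the similarity turns the real translation (a1, b1) into (1, 0). The
   vector (p, q) is then determined by m X = k L m, in the entries of the last column. *)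
pose u := a1 / n; pose v := - b1 / n.
pose p := v * a2 + u * b2; pose q := - (u * a2 - v * b2).
pose m : 'M[R]_3 := e2g u v p q.
have uv0 : u ^+ 2 + v ^+ 2 != 0.
  have -> : u ^+ 2 + v ^+ 2 = n^-1 by rewrite /u /v /n; field.
  by rewrite invr_neq0.
pose u' := u / (u ^+ 2 + v ^+ 2); pose v' := - v / (u ^+ 2 + v ^+ 2).
have uv1 : u * u' - v * v' = 1 by rewrite /u' /v'; field.
have uv2 : v * u' + u * v' = 0 by rewrite /u' /v'; field.
pose mi : 'M[R]_3 := e2g u' v' (- (u' * p - v' * q)) (- (v' * p + u' * q)).
have mmi : m *m mi = 1%:M.
  rewrite e2g_mul uv1 uv2 mx3_1 /e2g oppr0; congr mx3.
    by transitivity (p - (u * u' - v * v') * p + (v * u' + u * v') * q); [ring|rewrite uv1 uv2; ring].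
  by transitivity (q - (u * u' - v * v') * q - (v * u' + u * v') * p); [ring|rewrite uv1 uv2; ring].
have [um _] := mulmx1_unit mmi.
have miE : invmx m = mi by rewrite -[LHS]mulmx1 -mmi mulKmx.
exists m, k; split => //.
  have um' := unit_tocmx um.
  suff -> : tocmx m *m e2_mx a b e = k *: e2_L R *m tocmx m by rewrite mulmxK.
  rewrite XE -scalemxAr -scalemxAl; congr (_ *: _).
  rewrite e2_LE !e2_mxE tocmx_mx3 !mul_mx3.
  have E1 : u * a1 - v * b1 = 1 by rewrite /u /v /n; field.
  have E2 : v * a1 + u * b1 = 0 by rewrite /u /v; field.
  congr mx3; apply: eqC => /=; rewrite ?(mulr0, mul0r, mul1r, mulr1, addr0, add0r, subr0, sub0r, oppr0, opprK) //.
  all: try by [rewrite mulNr E1 | rewrite ?mulN1r ?mulrN1 // /q opprK mulNr].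
move=> g /E2P [x [y [s [t [xy ->]]]]]; rewrite miE; split; apply/E2P; rewrite !e2g_mul;
  do 4!eexists; split; try reflexivity; rewrite -xy.
- transitivity (((u * u' - v * v') * x - (v * u' + u * v') * y) ^+ 2 +
    ((u * u' - v * v') * y + (v * u' + u * v') * x) ^+ 2); first ring.
  by rewrite uv1 uv2; ring.
- transitivity (((u * u' - v * v') * x - (v * u' + u * v') * y) ^+ 2 +
    ((u * u' - v * v') * y + (v * u' + u * v') * x) ^+ 2); first ring.
  by rewrite uv1 uv2; ring.
Qed.

Lemma left_line_fieldZ (k : R[i]) X : k != 0 -> left_line_field (k *: X) = left_line_field X.
Proof.
move=> k0; apply/funext => c; apply/funext => x; apply/seteqP; split => v /= [l _ E].
  by exists (l * k) => //; rewrite -E -scalemxAr scalerA.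
by exists (l / k) => //; rewrite -E -scalemxAr scalerA divfK.
Qed.

Lemma E2_classification W : cr_structure (E2_space R) W -> left_invariant W ->
  exists phi, E2_aut phi /\ cr_equiv (E2_space R) W (E2_space R) (@E2_V R) phi.
Proof.
move=> crW lW; have [a [b [e WX]]] := left_invariant_field crW lW.
have e0 := E2_cr_nonabelian crW WX.
have [m [k [um k0 mX mE]]] := e2_normal_form e0 (E2_cr_nonreal crW WX).
have uim : invmx m \in unitmx by rewrite unitmx_inv.
have E1 g : E2 g -> E2 (m *m g *m invmx m) by move=> /mE [].
have E1' g : E2 g -> E2 (invmx m *m g *m invmx (invmx m)) by rewrite invmxK => /mE [].
exists (fun g => m *m g *m invmx m); split.
  split; first exact: E2_diffeo.
  move=> g h _ _; rewrite !mulmxA; congr (_ *m _ *m _).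
  by rewrite mulmxKV.
have := left_line_field_cr_equiv um uim E1 E1' WX.
have -> : tocmx (invmx m) = invmx (tocmx m) by exact: map_invmx.
by rewrite invmxK mX left_line_fieldZ.
Qed.

End left_invariant.

(** * The projective plane of the complexified Lie algebra *)

Section P_e2.
Variable R : realType.
Implicit Types (X Y : 'M[R[i]]_3) (z w : 'rV[R[i]]_3).

Lemma e2_of_rowE z : e2_of_row z = e2_mx (z 0 0) (z 0 1) (z 0 2%:R).
Proof. by []. Qed.

Lemma e2_of_row_inj z w : e2_of_row z = e2_of_row w -> z = w.
Proof.
rewrite !e2_of_rowE => /e2_mx_inj [E0 E1 E2].
by apply/rowP; elim/ord3P.
Qed.

Lemma e2_of_rowZ (k : R[i]) z : e2_of_row (k *: z) = k *: e2_of_row z.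
Proof. by rewrite !e2_of_rowE e2_mxZ !mxE. Qed.

Lemma e2_of_row_surj X : e2_alg X -> exists z, X = e2_of_row z.
Proof.
by move=> [a [b [c ->]]]; exists (row3 a b c); rewrite e2_of_rowE !mxE.
Qed.

Lemma cline_eq m n (A B : 'M[R[i]]_(m, n)) : A <> 0 ->
  cline A = cline B -> exists2 k, k != 0 & A = k *: B.
Proof.
move=> A0 E; have : cline A A by exists 1 => //; rewrite scale1r.
rewrite E => -[k _ Ek]; exists k => //; apply/eqP => k0; apply: A0.
by rewrite -Ek k0 scale0r.
Qed.

Lemma cline_scale m n (k : R[i]) (A : 'M[R[i]]_(m, n)) : k != 0 -> cline (k *: A) = cline A.
Proof.
move=> k0; apply/seteqP; split => B [l _ <-].
  by exists (l * k) => //; rewrite scalerA.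
by exists (l / k) => //; rewrite scalerA divfK.
Qed.

Lemma homog_k k (z : 'rV[R[i]]_2) : homog k z 0 k = 1.
Proof. by rewrite mxE unlift_none. Qed.

Lemma homog_lift k (z : 'rV[R[i]]_2) j : homog k z 0 (lift k j) = z 0 j.
Proof. by rewrite mxE liftK. Qed.

Lemma homog_neq0 k (z : 'rV[R[i]]_2) : homog k z <> 0.
Proof.
move=> /(congr1 (fun w : 'rV[R[i]]_3 => w 0 k)); rewrite homog_k mxE => /eqP.
by rewrite oner_eq0.
Qed.

Definition dehom k (w : 'rV[R[i]]_3) : 'rV[R[i]]_2 := \row_j (w 0 (lift k j) / w 0 k).

Lemma homog_dehom k w : w 0 k != 0 -> w = w 0 k *: homog k (dehom k w).
Proof.
move=> w0; apply/rowP => j; rewrite mxE.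
by case: (unliftP k j) => [l|] ->; rewrite ?homog_lift ?homog_k ?mulr1 // mxE mulrC divfK.
Qed.

Lemma dehomZ k a w : a != 0 -> dehom k (a *: w) = dehom k w.
Proof.
by move=> a0; apply/rowP => j; rewrite !mxE invfM mulrACA divff // mul1r.
Qed.

Lemma dehom_homog k (z : 'rV[R[i]]_2) : dehom k (homog k z) = z.
Proof. by apply/rowP => j; rewrite mxE homog_lift homog_k divr1. Qed.

Definition pchart (k : 'I_3) : param R (set 'M[R[i]]_3) (2 + 2) :=
  Param setT (fun v : 'rV[R]_(2 + 2) => cline (e2_of_row (homog k (cvec v)))).

Lemma e2_row_neq0 z : z <> 0 -> e2_of_row z <> 0.
Proof.
move=> z0 E; apply: z0; apply: e2_of_row_inj; rewrite E.
by rewrite -[in RHS](scale0r (0 : 'rV[R[i]]_3)) e2_of_rowZ scale0r.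
Qed.

Lemma pline_eq z w : z <> 0 -> cline (e2_of_row z) = cline (e2_of_row w) ->
  exists2 k, k != 0 & z = k *: w.
Proof.
move=> z0 /(cline_eq (e2_row_neq0 z0)) [k k0 E]; exists k => //.
by apply: e2_of_row_inj; rewrite e2_of_rowZ.
Qed.

Lemma pchart_eq k v w : pmap (pchart k) v = cline (e2_of_row w) ->
  w 0 k != 0 /\ cvec v = dehom k w.
Proof.
move=> /= /(pline_eq (@homog_neq0 _ _)) [a a0 E].
have wk : a * w 0 k = 1 by have := congr1 (fun w : 'rV[R[i]]_3 => w 0 k) E; rewrite homog_k mxE.
split; first by apply/eqP => w0; move: wk; rewrite w0 mulr0 => /esym/eqP; rewrite oner_eq0.
by rewrite -[LHS](dehom_homog k) E dehomZ.
Qed.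

Lemma pchart_dehom k w : w 0 k != 0 ->
  pmap (pchart k) (ccoord (dehom k w)) = cline (e2_of_row w).
Proof.
move=> w0; rewrite /= ccoordK [in RHS](homog_dehom w0) e2_of_rowZ cline_scale //.
Qed.

Lemma P_pts P : pts (P_e2 R) P <-> exists2 w, w <> 0 & P = cline (e2_of_row w).
Proof.
split.
  move=> [X [/e2_of_row_surj [w ->] X0 ->]]; exists w => // w0; apply: X0.
  by rewrite w0 -(scale0r (0 : 'rV[R[i]]_3)) e2_of_rowZ scale0r.
move=> [w w0 ->]; exists (e2_of_row w); split => //; last exact: e2_row_neq0.
by do 3!eexists; rewrite e2_of_rowE.
Qed.

Lemma P_cover P : pts (P_e2 R) P <->
  exists c x, [/\ atlas (P_e2 R) c, pdom c x & pmap c x = P].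
Proof.
split.
  move=> /P_pts [w w0 ->]; have [k wk] : exists k, w 0 k != 0.
    apply: contrapT => H; apply: w0; apply/rowP => k; rewrite mxE.
    by apply/eqP; apply: contrapT => /negP wk; apply: H; exists k.
  exists (pchart k), (ccoord (dehom k w)); split => //; first by exists k.
  exact: pchart_dehom.
move=> [c [x [[k _ <-] _ <-]]]; apply/P_pts; exists (homog k (cvec x)) => //.
exact: homog_neq0.
Qed.

Definition ptrans k l (v : 'rV[R]_(2 + 2)) : 'rV[R]_(2 + 2) :=
  ccoord (dehom l (homog k (cvec v))).

Definition pdomain k l : set 'rV[R]_(2 + 2) := [set v | homog k (cvec v) 0 l != 0].

Lemma csmooth_cvec n (U : set 'rV[R]_(n + n)) j : open U -> csmooth U (fun v => cvec v 0 j).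
Proof.
move=> oU; apply: (csmooth_ext oU (u := fun v => (v 0 (lshift n j) +i* v 0 (rshift n j))%C)).
  by move=> v _; rewrite !mxE.
by apply: csmooth_pair; exact: smooth_on_coord.
Qed.

Lemma csmooth_homog k (U : set 'rV[R]_(2 + 2)) j : open U -> csmooth U (fun v => homog k (cvec v) 0 j).
Proof.
move=> oU; case: (unliftP k j) => [l|] ->.
  apply: (csmooth_ext oU (u := fun v => cvec v 0 l)); last exact: csmooth_cvec.
  by move=> v _; rewrite homog_lift.
apply: (csmooth_ext oU (u := fun v => 1)); last exact: csmooth_cst.
by move=> v _; rewrite homog_k.
Qed.

Lemma open_csmooth_neq0 (V : normedModType R) (u : V -> R[i]) : csmooth setT u -> open [set v | u v != 0].
Proof.
move=> [ur ui].
have o1 := continuous_on_open openT ur (@open_neq R 0).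
have o2 := continuous_on_open openT ui (@open_neq R 0).
have := openU o1 o2; congr open; apply/seteqP; split => v /=.
  by move=> [[_ /eqP H]|[_ /eqP H]]; apply/eqP => E; apply: H; rewrite E.
move=> u0; have [r0|r0] := eqVneq (complex.Re (u v)) 0; last by left.
right; split => //; apply: contra u0 => /eqP i0.
by apply/eqP/eqC.
Qed.

Lemma open_pdomain k l : open (pdomain k l).
Proof. by apply: open_csmooth_neq0; apply: csmooth_homog; exact: openT. Qed.

Lemma smooth_ccoord (V : normedModType R) (U : set V) n (f : V -> 'rV[R[i]]_n) : open U ->
  (forall j, csmooth U (fun x => f x 0 j)) -> smooth_on U (fun x => ccoord (f x)).
Proof.
move=> oU fs; apply: smooth_on_mx => // i j; rewrite ord1.
rewrite -(splitK j); case: (fintype.split j) => l; have [fr fi] := fs l.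
  by apply: (smooth_on_ext oU _ fr) => x _; rewrite row_mxEl mxE.
by apply: (smooth_on_ext oU _ fi) => x _; rewrite row_mxEr mxE.
Qed.

Lemma csmooth_dehom k l j : csmooth (pdomain k l) (fun v => dehom l (homog k (cvec v)) 0 j).
Proof.
have oU := @open_pdomain k l.
apply: (csmooth_ext oU (u := fun v => homog k (cvec v) 0 (lift l j) * (homog k (cvec v) 0 l)^-1)).
  by move=> v _; rewrite [RHS]mxE.
apply: (csmoothM oU); first exact: csmooth_homog.
apply: (csmoothV oU) => //; exact: csmooth_homog.
Qed.

Lemma smooth_ptrans k l : smooth_on (pdomain k l) (ptrans k l).
Proof.
apply: smooth_ccoord; first exact: open_pdomain.
by move=> j; exact: csmooth_dehom.
Qed.

Lemma ptrans_rep k l v : pdomain k l v -> local_rep (pchart k) (pchart l) id v (ptrans k l).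
Proof.
move=> kv; exists (pdomain k l); split => //.
- exact: open_pdomain.
- exact: smooth_ptrans.
- by move=> y ky; split => //; rewrite /ptrans pchart_dehom.
Qed.

Lemma pchart_inj k (v w : 'rV[R]_(2 + 2)) : pmap (pchart k) v = pmap (pchart k) w -> v = w.
Proof.
move=> /= /pchart_eq [_]; rewrite dehom_homog; exact: (can_inj (@cvecK R 2)).
Qed.

Lemma P_compat : smooth_map (P_e2 R) (pts (P_e2 R)) (P_e2 R) id.
Proof.
move=> c x d y [k _ <-] _ _ [l _ <-] _ E.
exists (ptrans k l); apply: ptrans_rep.
by have [] := pchart_eq (E : pmap (pchart l) y = _).
Qed.

Definition cross z w : 'rV[R[i]]_3 := row3 (z 0 1 * w 0 2%:R - z 0 2%:R * w 0 1)
   (z 0 2%:R * w 0 0 - z 0 0 * w 0 2%:R) (z 0 0 * w 0 1 - z 0 1 * w 0 0).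

Definition sqnorm z : R :=
  \sum_j (complex.Re (z 0 j) * complex.Re (z 0 j) + complex.Im (z 0 j) * complex.Im (z 0 j)).

Lemma sqnorm_eq0 z : sqnorm z = 0 -> z = 0.
Proof.
move=> /eqP; rewrite psumr_eq0 => [/allP H|j _]; last by rewrite addr_ge0 // -expr2 sqr_ge0.
apply/rowP => j; have := H j (mem_index_enum _); rewrite mxE /= -!expr2.
rewrite paddr_eq0 ?sqr_ge0 // !sqrf_eq0 => /andP[/eqP Er /eqP Ei].
exact: eqC.
Qed.

Lemma sqnorm_ge0 z : 0 <= sqnorm z.
Proof. by apply: sumr_ge0 => j _; rewrite addr_ge0 // -expr2 sqr_ge0. Qed.

Lemma cross_eq0 z w : w <> 0 -> cross z w = 0 -> exists k, z = k *: w.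
Proof.
move=> w0 E.
have E0 := congr1 (fun v : 'rV[R[i]]_3 => v 0 0) E.
have E1 := congr1 (fun v : 'rV[R[i]]_3 => v 0 1) E.
have E2 := congr1 (fun v : 'rV[R[i]]_3 => v 0 2%:R) E.
move: E0 E1 E2; rewrite !mxE /= => /eqP + /eqP + /eqP; rewrite !subr_eq0.
move=> /eqP E0 /eqP E1 /eqP E2.
have [k wk] : exists k, w 0 k != 0.
  apply: contrapT => H; apply: w0; apply/rowP => k; rewrite mxE.
  by apply/eqP; apply: contrapT => /negP wk; apply: H; exists k.
exists (z 0 k / w 0 k); apply/rowP => j; rewrite mxE; apply: (mulIf wk).
rewrite mulrAC divfK //; move: j; clear wk; move: k.
by elim/ord3P; elim/ord3P => //; rewrite ?E0 ?E1 ?E2 // -?E0 -?E1 -?E2.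
Qed.

(** An inequality between the squared norms of v x z and v x w is therefore the same for all vectors
    spanning the line of v, and defines a set of lines. *)
Lemma sqnorm_crossZ a z w : sqnorm (cross (a *: z) w) =
  (complex.Re a ^+ 2 + complex.Im a ^+ 2) * sqnorm (cross z w).
Proof.
have -> : cross (a *: z) w = a *: cross z w.
  by apply/rowP; elim/ord3P; rewrite !mxE /=; ring.
rewrite /sqnorm mulr_sumr; apply: eq_bigr => j _; rewrite mxE.
by case: (cross z w 0 j) => p q; case: a => r s /=; ring.
Qed.

(* The line of v is closer to that of z than to that of w; this separates points. *)
Lemma cross_open z w : open_in (P_e2 R)
  [set P | exists2 v, v <> 0 /\ P = cline (e2_of_row v) & sqnorm (cross v z) < sqnorm (cross v w)].
Proof.
split; first by move=> P [v [v0 ->] _]; apply/P_pts; exists v.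
move=> c [k _ <-] /=.
pose f t (y : 'rV[R]_(2 + 2)) := sqnorm (cross (homog k (cvec y)) t).
have -> : [set x | True /\ (exists2 v, v <> 0 /\ cline (e2_of_row (homog k (cvec x))) = cline (e2_of_row v) &
   sqnorm (cross v z) < sqnorm (cross v w))] = [set x | f z x - f w x < 0].
  apply/seteqP; split => x /=.
    move=> [_ [v [v0 /(pline_eq (@homog_neq0 _ _)) [a a0 E]]]].
    rewrite /f E !sqnorm_crossZ subr_lt0 ltr_pM2l // lt_neqAle eq_sym norm2_neq0 //=.
    by rewrite addr_ge0 ?sqr_ge0.
  rewrite subr_lt0 => H; split => //; exists (homog k (cvec x)) => //; split => //.
  exact: homog_neq0.
have sf t : smooth_on setT (f t).
  apply: (@smooth_on_sum R 'rV[R]_(2 + 2) R setT _ _ (fun j y =>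
    complex.Re (cross (homog k (cvec y)) t 0 j) * complex.Re (cross (homog k (cvec y)) t 0 j) +
    complex.Im (cross (homog k (cvec y)) t 0 j) * complex.Im (cross (homog k (cvec y)) t 0 j)) openT) => j.
  have [cr ci] : csmooth setT (fun y => cross (homog k (cvec y)) t 0 j).
    have ch := fun j => csmooth_homog k j openT.
    have cc j' : csmooth (setT : set 'rV[R]_(2 + 2)) (fun=> t 0 j') by exact: csmooth_cst.
    have cm i i' := csmoothM openT (ch i) (cc i').
    move: j; elim/ord3P.
    - by apply: (csmooth_ext openT _ (csmoothB openT (cm 1 2%:R) (cm 2%:R 1))) => y _; rewrite [RHS]mxE.
    - by apply: (csmooth_ext openT _ (csmoothB openT (cm 2%:R 0) (cm 0 2%:R))) => y _; rewrite [RHS]mxE.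
    - by apply: (csmooth_ext openT _ (csmoothB openT (cm 0 1) (cm 1 0))) => y _; rewrite [RHS]mxE.
  by apply: (smooth_onD openT); apply: smooth_onM => //; exact: openT.
have := continuous_on_open openT (smooth_onB openT (sf z) (sf w)) (@open_lt R 0).
by congr open; apply/seteqP; split => v //= [].
Qed.

Lemma P_manifold : smooth_manifold (P_e2 R).
Proof.
split.
- exact: P_cover.
- by move=> c [k _ <-]; exact: openT.
- by move=> c x y [k _ <-] _ _; exact: (@pchart_inj k).
- exact: P_compat.
- move=> P Q /P_pts [z z0 ->] /P_pts [w w0 ->] PQ.
  (* Each of the two lines lies in its own open set, since its cross product with itself vanishes
     while the product with the other line does not. *)
  have zz t : cross t t = 0 by apply/rowP; elim/ord3P; rewrite !mxE /=; ring.
  have n0 : sqnorm (0 : 'rV[R[i]]_3) = 0.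
    by rewrite /sqnorm big1 // => j _; rewrite mxE /= !mulr0 addr0.
  have pos t s : s <> 0 -> t <> 0 -> cline (e2_of_row t) <> cline (e2_of_row s) ->
      sqnorm (cross t t) < sqnorm (cross t s).
    move=> s0 t0 ts; rewrite zz n0 lt_neqAle sqnorm_ge0 andbT eq_sym.
    apply/eqP => /sqnorm_eq0 /(cross_eq0 s0) [k E].
    apply: ts; rewrite E e2_of_rowZ cline_scale //; apply/eqP => k0; apply: t0.
    by rewrite E k0 scale0r.
  eexists; eexists; split; [exact: (cross_open z w)|exact: (cross_open w z)| | |].
  + by exists z; [split|exact: pos].
  + by exists w; [split|apply: pos => // E; exact: PQ].
  + apply/seteqP; split => T //= [[v [v0 ->] H] [v' [v'0 E] H']].
    have [k k0 E'] := pline_eq v0 E.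
    move: H; rewrite E' !sqnorm_crossZ => /lt_trans; move=> /(_ _ _).
    have kp : 0 < complex.Re k ^+ 2 + complex.Im k ^+ 2.
      by rewrite lt_neqAle eq_sym norm2_neq0 //= addr_ge0 ?sqr_ge0.
    move=> /(_ ((complex.Re k ^+ 2 + complex.Im k ^+ 2) * sqnorm (cross v' z))).
    by rewrite ltr_pM2l // => /(_ H'); rewrite ltxx.
- exists (atlas (P_e2 R)); split => //.
    by apply: finite_set_countable; apply: finite_image; exact: finite_finset.
  by move=> P /P_cover.
Qed.

End P_e2.

(** * The adjoint orbit and the tube *)

Section realization.
Variable R : realType.
Notation E2atlas := (sub_param (mxspace3 R) (@E2 R)).

Definition holomorphic_at n (x : 'rV[R]_(n + n)) (u : 'rV[R]_(n + n) -> R[i]) :=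
  cdifferentiable x u /\ forall v, derivec (cJ v) x u = 'i%C * derivec v x u.

Lemma holomorphic_atM n (x : 'rV[R]_(n + n)) u w :
  holomorphic_at x u -> holomorphic_at x w -> cdifferentiable x (fun y => u y * w y) ->
  holomorphic_at x (fun y => u y * w y).
Proof.
move=> [du hu] [dw hw] duw; split => // v.
by rewrite !derivecM // hu hw; ring.
Qed.

Lemma holomorphic_atV n (x : 'rV[R]_(n + n)) u (U : set 'rV[R]_(n + n)) : open U -> U x -> csmooth U u ->
  (forall y, U y -> u y != 0) -> holomorphic_at x u -> holomorphic_at x (fun y => (u y)^-1).
Proof.
move=> oU Ux us u0 [du hu].
have sV := csmoothV oU u0 us; have dV := csmooth_cdifferentiable sV Ux; split => // v.
(* Obtained by differentiating u u^-1 = 1. *)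
have E w : derivec w x (fun y => (u y)^-1) = - (u x)^-1 * (u x)^-1 * derivec w x u.
  have := derivecM w du dV.
  have -> : derivec w x (fun y => u y * (u y)^-1) = 0.
    rewrite -(derivec_cst x w 1); apply: (derivec_ext oU _ Ux) => y Uy.
    by rewrite mulfV // u0.
  move=> /esym/eqP; rewrite addrC addr_eq0 => /eqP E.
  apply: (mulfI (u0 _ Ux)); rewrite E; have := u0 _ Ux => ux0; field.
  exact: ux0.
by rewrite !E hu; ring.
Qed.

Lemma cvec_cJ n (v : 'rV[R]_(n + n)) : cvec (cJ v) = 'i%C *: cvec v.
Proof.
rewrite /cvec /cJ row_mxKl row_mxKr; apply/rowP => j; rewrite !mxE.
by apply: eqC => /=; ring.
Qed.

Lemma cJ_ccoord n (z : 'rV[R[i]]_n) : cJ (ccoord z) = ccoord ('i%C *: z).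
Proof. by apply: (can_inj (@cvecK R n)); rewrite cvec_cJ !ccoordK. Qed.

Lemma derivec_cvec n (v x : 'rV[R]_(n + n)) j : derivec v x (fun y => cvec y 0 j) = cvec v 0 j.
Proof.
have E : (fun y : 'rV[R]_(n + n) => cvec y 0 j) = (fun y => (y 0 (lshift n j) +i* y 0 (rshift n j))%C).
  by apply/funext => y; rewrite !mxE.
rewrite E !mxE; apply: eqC; rewrite [LHS]/=; exact: derive_coord.
Qed.

Lemma holomorphic_homog k j (x : 'rV[R]_(2 + 2)) : holomorphic_at x (fun y => homog k (cvec y) 0 j).
Proof.
split; first exact: (csmooth_cdifferentiable (csmooth_homog k j openT) Logic.I).
move=> v; case: (unliftP k j) => [l|] ->.
  have -> : (fun y : 'rV[R]_(2 + 2) => homog k (cvec y) 0 (lift k l)) = (fun y => cvec y 0 l).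
    by apply/funext => y; rewrite homog_lift.
  by rewrite !derivec_cvec cvec_cJ mxE.
have -> : (fun y : 'rV[R]_(2 + 2) => homog k (cvec y) 0 k) = (fun y => 1).
  by apply/funext => y; rewrite homog_k.
by rewrite !derivec_cst mulr0.
Qed.

Lemma holomorphic_dehom k l j (x : 'rV[R]_(2 + 2)) : pdomain k l x ->
  holomorphic_at x (fun y => dehom l (homog k (cvec y)) 0 j).
Proof.
move=> dx; have oU := @open_pdomain R k l.
have E : (fun y : 'rV[R]_(2 + 2) => dehom l (homog k (cvec y)) 0 j) =
  (fun y => homog k (cvec y) 0 (lift l j) * (homog k (cvec y) 0 l)^-1).
  by apply/funext => y; rewrite mxE.
rewrite E; apply: holomorphic_atM; first exact: holomorphic_homog.
  apply: (holomorphic_atV oU dx) => //; [exact: csmooth_homog|exact: holomorphic_homog].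
rewrite -E; exact: (csmooth_cdifferentiable (@csmooth_dehom R k l j) dx).
Qed.

(** Changes of affine charts are quotients of homogeneous coordinates, each of which is a complex
    coordinate or 1. Products and inverses keep the Cauchy-Riemann equation, and a local
    representative agrees with this formula near the point. *)
Lemma P_complex : complex_manifold (P_e2 R).
Proof.
split; first exact: P_manifold.
move=> c d x F v [k _ <-] [l _ <-] rF.
have [_ _ EF _] := local_rep_at rF.
have [dx _] := pchart_eq EF.
have [W [oW Wx FE]] := local_rep_uniq (fun y z _ _ => @pchart_inj R l y z) rF (ptrans_rep dx).
have E w : 'D_w F x = ccoord (\row_j derivec w x (fun y => dehom l (homog k (cvec y)) 0 j)).
  etransitivity; first exact: near_eq_derive (near_open oW Wx FE).
  have ds := smooth_on_differentiable (@smooth_ptrans R k l) dx.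
  apply/rowP => j; rewrite -(derive_entry w _ _ ds).
  rewrite -(splitK j); case: (fintype.split j) => i /=.
    rewrite row_mxEl !mxE [RHS]/=; apply: eq_derive => y.
    by rewrite /ptrans /ccoord row_mxEl mxE.
  rewrite row_mxEr !mxE [RHS]/=; apply: eq_derive => y.
  by rewrite /ptrans /ccoord row_mxEr mxE.
rewrite (E v) cJ_ccoord; etransitivity; first exact: E.
congr ccoord; apply/rowP => j; rewrite !mxE.
by have [_ ->] := holomorphic_dehom j dx.
Qed.

(* z_1 = g_00 + i g_12 and z_2 = g_10 - i g_02 embed E_2 onto the tube, and turn the
   left translates of L into (0,1)-vectors. *)
Definition tube_coord (K : pzRingType) (M : 'M[K]_3) : 'rV[K]_(2 + 2) :=
  \row_(j < 2 + 2) nth 0 [:: M 0 0; M 1 0; M 1 2%:R; - M 0 2%:R] j.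

Lemma tube_coord_linear : linear (@tube_coord R).
Proof.
move=> a A B; apply/rowP; case=> [[|[|[|[|//]]]] lt]; rewrite !mxE //=; ring.
Qed.

HB.instance Definition _ := GRing.isLinear.Build R 'M[R]_3 'rV[R]_(2 + 2) _ (@tube_coord R) tube_coord_linear.

Lemma cplxmx_tube_coord (A B : 'M[R]_3) : cplxmx (tube_coord A) (tube_coord B) = tube_coord (cplxmx A B).
Proof.
apply/rowP; case=> [[|[|[|[|//]]]] lt]; rewrite !mxE //=.
Qed.

(** The two (0,1)-equations, turned by the inverse of the rotation part (p, q) of [g], become i b =
    0 and e - i a = 0. They say that (a, b, e) is [a] times L = (1, 0, i). *)
Lemma T01_tube_coord (g : 'M[R]_3) a b e : E2 g ->
  T01 (tube_coord (tocmx g *m e2_mx a b e)) <->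
  cline (tocmx g *m e2_L R) (tocmx g *m e2_mx a b e).
Proof.
have ii : 'i%C * 'i%C = -1 :> R[i] by apply: eqC => /=; ring.
move=> /E2P [p [q [x [y [pq ->]]]]].
have cpq : (p%:C * p%:C + q%:C * q%:C = 1 :> R[i])%C.
  by rewrite -!rmorphM -rmorphD -!expr2 pq.
have tE a' b' e' : tocmx (e2g p q x y) *m e2_mx a' b' e' =
   mx3 (- (q%:C%C * e')) (- (p%:C%C * e')) (p%:C%C * a' - q%:C%C * b')
       (p%:C%C * e') (- (q%:C%C * e')) (q%:C%C * a' + p%:C%C * b') 0 0 0.
  rewrite e2_mxE tocmx_mx3 mul_mx3 rmorphN; congr mx3; ring.
have -> : T01 (tube_coord (tocmx (e2g p q x y) *m e2_mx a b e)) <->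
  - (q%:C%C * e) + 'i%C * (q%:C%C * a + p%:C%C * b) = 0 /\
  p%:C%C * e - 'i%C * (p%:C%C * a - q%:C%C * b) = 0.
  rewrite T01P tE; split.
    move=> E; have E0 := congr1 (fun w : 'rV[R[i]]_2 => w 0 0) E.
    have E1 := congr1 (fun w : 'rV[R[i]]_2 => w 0 1) E.
    by move: E0 E1; rewrite !mxE /= mulrN.
  move=> [E0 E1]; apply/rowP; case=> [[|[|//]] lt]; rewrite !mxE /= ?mulrN //.
rewrite e2_LE; split.
  move=> [E0 E1].
  have b0 : b = 0.
    transitivity ((p%:C * p%:C + q%:C * q%:C)%C * b); first by rewrite cpq mul1r.
    transitivity (- 'i%C * (p%:C%C * (- (q%:C%C * e) + 'i%C * (q%:C%C * a + p%:C%C * b)) +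
        q%:C%C * (p%:C%C * e - 'i%C * (p%:C%C * a - q%:C%C * b)))); last by rewrite E0 E1; ring.
    transitivity (- ('i%C * 'i%C) * ((p%:C * p%:C + q%:C * q%:C)%C * b)); last ring.
    by rewrite ii; ring.
  have ea : e = 'i%C * a.
    transitivity ((p%:C * p%:C + q%:C * q%:C)%C * e); first by rewrite cpq mul1r.
    transitivity (p%:C%C * (p%:C%C * e - 'i%C * (p%:C%C * a - q%:C%C * b)) -
       q%:C%C * (- (q%:C%C * e) + 'i%C * (q%:C%C * a + p%:C%C * b)) +
       (p%:C * p%:C + q%:C * q%:C)%C * ('i%C * a)); first ring.
    by rewrite E0 E1 cpq; ring.
  exists a => //; rewrite scalemxAr e2_mxZ b0 ea; congr (_ *m e2_mx _ _ _); ring.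
move=> [l _]; rewrite scalemxAr e2_mxZ !tE => /mx3_inj [[E1 _ E2] [[E3 _ E4] _]].
have -> : q%:C%C * e = q%:C%C * (l * 'i%C) by apply: oppr_inj; rewrite -E1.
rewrite -E3 -E4 -E2; split; ring.
Qed.

Definition tube_to_E2 (z : 'rV[R[i]]_2) : 'M[R]_3 :=
  e2g (complex.Re (z 0 0)) (complex.Re (z 0 1)) (- complex.Im (z 0 1)) (complex.Im (z 0 0)).

Definition E2_to_tube (M : 'M[R]_3) : 'rV[R[i]]_2 := cvec (tube_coord M).

Lemma E2_to_tubeE a b x y : E2_to_tube (e2g a b x y) = \row_j nth 0 [:: (a +i* y)%C; (b +i* - x)%C] j.
Proof. by apply/rowP; case=> [[|[|//]] lt]; rewrite !mxE. Qed.

Lemma E2_to_tubeK g : E2 g -> @tube R (E2_to_tube g) /\ tube_to_E2 (E2_to_tube g) = g.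
Proof.
move=> /E2P [a [b [x [y [ab ->]]]]]; split; first by rewrite /tube /= E2_to_tubeE !mxE.
by rewrite /tube_to_E2 E2_to_tubeE !mxE /= opprK.
Qed.

Lemma tube_to_E2K z : @tube R z -> E2 (tube_to_E2 z) /\ E2_to_tube (tube_to_E2 z) = z.
Proof.
rewrite /tube /= => tz; split; first by apply/E2P; do 4!eexists; split; last reflexivity.
rewrite E2_to_tubeE opprK; apply/rowP; case=> [[|[|//]] lt]; rewrite mxE /=.
  by apply: eqC => /=; congr (_ (z 0 _)); exact: val_inj.
by apply: eqC => /=; congr (_ (z 0 _)); exact: val_inj.
Qed.

Lemma smooth_E2_to_tube : smooth_map (mxspace3 R) setT (cspace R 2) E2_to_tube.
Proof.
have oT : open [set x : 'rV[R]_(3 * 3) | setT (@vec_mx R 3 3 x)].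
  by rewrite (_ : [set x | _] = setT) //; exact: openT.
apply: (one_chart_smooth (@ccoordK R 2) (@cvecK R 2) oT).
apply: (smooth_on_ext oT (f := fun x => tube_coord (vec_mx x))).
  by move=> x _; rewrite /E2_to_tube cvecK.
exact: (smooth_on_linear (@tube_coord R \o vec_mx)).
Qed.

Lemma smooth_tube_to_E2 : smooth_map (cspace R 2) setT (mxspace3 R) tube_to_E2.
Proof.
have oT : open [set x : 'rV[R]_(2 + 2) | setT (cvec x)].
  by rewrite (_ : [set x | _] = setT) //; exact: openT.
apply: (one_chart_smooth (@mxvecK R 3 3) (@vec_mxK R 3 3) oT).
apply: smooth_on_linear_comp => //.
have [r0 i0] := csmooth_cvec 0 oT; have [r1 i1] := csmooth_cvec 1 oT.
apply: smooth_on_mx3 => //; try exact: smooth_on_cst.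
- exact: smooth_onN.
- exact: smooth_onN.
Qed.

Lemma open_cspace n : open_in (cspace R n) setT.
Proof.
apply: (@one_chart_open R _ _ (@cvec R n)).
by rewrite (_ : [set x | _] = setT) //; exact: openT.
Qed.

(** Transported from E_2: both maps are defined and smooth on the whole ambient spaces, and they
    invert each other on E_2 and the tube. *)
Lemma tube_submanifold : submanifold 3 (cspace R 2) (@tube R).
Proof.
apply: (@submanifold_map R _ _ _ _ 3 (mxspace3 R) (cspace R 2) (@E2 R) (@tube R)
  E2_to_tube tube_to_E2 setT setT) => //.
all: try by [exact: mxspace3_covered|exact: cspace_covered|exact: open_in_setT
  |exact: open_cspace|exact: smooth_E2_to_tube|exact: smooth_tube_to_E2
  |exact: E2_submanifold].
- exact: E2_to_tubeK.
- exact: tube_to_E2K.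
Qed.

(* The line with homogeneous coordinates [- i z : 1]. *)
Definition tube_to_P (z : 'rV[R[i]]_2) : set 'M[R[i]]_3 :=
  pmap (pchart R 2%:R) (- cJ (ccoord z)).

Definition P_affine : set (set 'M[R[i]]_3) :=
  [set P | exists2 w : 'rV[R[i]]_3, w 0 2%:R != 0 & P = cline (e2_of_row w)].

(* Meaningful on P_affine only; elsewhere xget still selects some spanning vector, or 0. *)
Definition P_to_tube (P : set 'M[R[i]]_3) : 'rV[R[i]]_2 :=
  cvec (cJ (ccoord (dehom 2%:R (xget 0 [set w : 'rV[R[i]]_3 | w <> 0 /\ P = cline (e2_of_row w)])))).

Lemma P_to_tubeE (w : 'rV[R[i]]_3) : w 0 2%:R != 0 ->
  P_to_tube (cline (e2_of_row w)) = cvec (cJ (ccoord (dehom 2%:R w))).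
Proof.
move=> w2; rewrite /P_to_tube; set A := [set _ | _].
have w0 : w <> 0 by move=> w0; move: w2; rewrite w0 mxE eqxx.
have [g0 gE] : A (xget 0 A) by apply: xgetPex; exists w.
have [k k0 E] := pline_eq w0 gE.
by rewrite E dehomZ.
Qed.

Lemma P_affine_open : open_in (P_e2 R) P_affine.
Proof.
split.
  move=> P [w w2 ->]; apply/P_pts; exists w => // w0.
  by move: w2; rewrite w0 mxE eqxx.
move=> c [k _ <-] /=; have := @open_pdomain R k 2%:R; congr open.
apply/seteqP; split => x.
  by move=> h; split => //; exists (homog k (cvec x)).
move=> [_ [w w2 E]]; have [k' k0 E'] := pline_eq (@homog_neq0 _ k (cvec x)) E.
by rewrite /pdomain /= E' mxE mulf_neq0.
Qed.

Lemma cJK n (v : 'rV[R]_(n + n)) : cJ (cJ v) = - v.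
Proof.
rewrite /cJ row_mxKl row_mxKr -[in RHS](hsubmxK v) opp_row_mx //.
Qed.

Lemma cJN n (v : 'rV[R]_(n + n)) : cJ (- v) = - cJ v.
Proof. by rewrite /cJ opp_row_mx !linearN /=. Qed.

Lemma tube_to_P_affine z : P_affine (tube_to_P z).
Proof. by exists (homog 2%:R (cvec (- cJ (ccoord z)))) => //; rewrite homog_k oner_eq0. Qed.

Lemma tube_to_PK z : P_to_tube (tube_to_P z) = z.
Proof.
rewrite /tube_to_P /= P_to_tubeE; last by rewrite homog_k oner_eq0.
by rewrite dehom_homog cvecK cJN cJK opprK ccoordK.
Qed.

Lemma P_to_tubeK P : P_affine P -> tube_to_P (P_to_tube P) = P.
Proof.
move=> [w w2 ->]; rewrite P_to_tubeE // /tube_to_P cvecK cJK opprK.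
exact: pchart_dehom.
Qed.

Lemma cJ_linear n : linear (@cJ R n).
Proof.
move=> a u v; rewrite /cJ !linearP /= scale_row_mx add_row_mx; congr row_mx.
Qed.

HB.instance Definition _ n := GRing.isLinear.Build R 'rV[R]_(n + n) 'rV[R]_(n + n) _ (@cJ R n) (@cJ_linear n).

Lemma P_to_tube_rep k x : pdomain k 2%:R x ->
  local_rep (pchart R k) (Param setT (@cvec R 2)) P_to_tube x (fun y => cJ (ptrans k 2%:R y)).
Proof.
move=> dx; exists (pdomain k 2%:R); split => //.
- exact: open_pdomain.
- apply: smooth_on_linear_comp; [exact: open_pdomain|exact: smooth_ptrans].
- by move=> y dy; split => //; rewrite /= P_to_tubeE.
Qed.

Lemma smooth_P_to_tube : smooth_map (P_e2 R) P_affine (cspace R 2) P_to_tube.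
Proof.
move=> c x d y [k _ <-] _ [w w2 E] -> _ _; exists (fun y => cJ (ptrans k 2%:R y)).
apply: P_to_tube_rep; have [k' k0 E'] := pline_eq (@homog_neq0 _ k (cvec x)) E.
by rewrite /pdomain /= E' mxE mulf_neq0.
Qed.

Lemma tube_to_P_rep x : local_rep (Param setT (@cvec R 2)) (pchart R 2%:R) tube_to_P x (fun y => - cJ y).
Proof.
exists setT; split => //; first exact: openT.
  exact: (smooth_on_linear (-%R \o @cJ R 2)).
by move=> y _; split => //; rewrite /tube_to_P /= cvecK.
Qed.

Lemma smooth_tube_to_P : smooth_map (cspace R 2) setT (P_e2 R) tube_to_P.
Proof.
move=> c x d y -> _ _ [l _ <-] _ E.
have [dx _] := pchart_eq (E : pmap (pchart R l) y = cline (e2_of_row (homog 2%:R _))).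
rewrite /= cvecK in dx.
exists (fun y => ptrans 2%:R l (- cJ y)).
exact: local_rep_comp (tube_to_P_rep x) (ptrans_rep dx).
Qed.

(** [Ad g] sends L to (z_1, z_2, i) for z = [E2_to_tube g]: the rotation entry is invariant, and the
    translation entries collect the rotated vector (1, 0) and i times the translation of [g] turned
    by - pi/2. Dividing by i gives (- i z_1, - i z_2, 1). *)
Lemma Ad_L (g : 'M[R]_3) : E2 g -> Ad g @` cline (e2_L R) = tube_to_P (E2_to_tube g).
Proof.
have ii : 'i%C * 'i%C = -1 :> R[i] by apply: eqC => /=; ring.
have i0 : 'i%C != 0 :> R[i] by apply/eqP => /(congr1 (@complex.Im R)) /= /eqP; rewrite oner_eq0.
move=> Eg; have ug := unit_tocmx (let: And3 u _ _ := E2_inv Eg in u).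
have AdZ l X : Ad g (l *: X) = l *: Ad g X by rewrite /Ad -scalemxAr -scalemxAl.
transitivity (cline (Ad g (e2_L R))).
  apply/seteqP; split => Y.
    by move=> [_ [l _ <-] <-]; exists l; rewrite ?AdZ.
  by move=> [l _ <-]; exists (l *: e2_L R); [exists l|rewrite AdZ].
have -> : Ad g (e2_L R) = 'i%C *: e2_of_row (homog 2%:R (cvec (- cJ (tube_coord g)))).
  have -> : cvec (- cJ (tube_coord g)) = - 'i%C *: E2_to_tube g.
    by rewrite -[- cJ _]scaleN1r -linearZ /= cvec_cJ; apply/rowP => j; rewrite !mxE; apply: eqC => /=; ring.
  rewrite -e2_of_rowZ; set w := _ *: homog _ _.
  have -> : w = row3 (E2_to_tube g 0 0) (E2_to_tube g 0 1) 'i%C.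
    have L0 : (0 : 'I_3) = lift 2%:R (0 : 'I_2) by exact: val_inj.
    have L1 : (1 : 'I_3) = lift 2%:R (1 : 'I_2) by exact: val_inj.
    apply/rowP; elim/ord3P; rewrite [LHS]mxE [RHS]mxE [RHS]/=.
    - by rewrite L0 homog_lift mxE mulrA mulrN ii opprK mul1r.
    - by rewrite L1 homog_lift mxE mulrA mulrN ii opprK mul1r.
    - by rewrite homog_k mulr1.
  apply: (can_inj (mulmxK ug)); rewrite /Ad mulmxKV // e2_of_rowE.
  rewrite [row3 _ _ _ 0 0]mxE [row3 _ _ _ 0 1]mxE [row3 _ _ _ 0 2%:R]mxE /=.
  move: Eg => /E2P [p [q [x [y [pq ->]]]]].
  rewrite E2_to_tubeE [(\row_j _) 0 0]mxE [(\row_j _) 0 1]mxE /= e2_LE !e2_mxE tocmx_mx3 !mul_mx3 rmorphN.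
  by congr mx3; apply: eqC => /=; ring.
by rewrite cline_scale // /tube_to_P /E2_to_tube cvecK.
Qed.

Lemma orbitP P : Ad_orbit (e2_L R) P <-> exists2 z, @tube R z & P = tube_to_P z.
Proof.
split.
  move=> [g Eg ->]; exists (E2_to_tube g); last exact: Ad_L.
  by have [] := E2_to_tubeK Eg.
move=> [z tz ->]; have [Ez E] := tube_to_E2K tz; exists (tube_to_E2 z) => //.
by rewrite Ad_L // E.
Qed.

Lemma orbit_affine P : Ad_orbit (e2_L R) P -> P_affine P.
Proof. by move=> /orbitP [z _ ->]; exact: tube_to_P_affine. Qed.

Lemma P_covered : covered (P_e2 R).
Proof. by move=> P /P_cover. Qed.

(** The orbit lies in one affine chart, where [P_to_tube] is smooth; this chart is the open set
    needed for the transport. *)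
Lemma orbit_submanifold : submanifold 3 (P_e2 R) (Ad_orbit (e2_L R)).
Proof.
apply: (@submanifold_map R _ _ _ _ 3 (cspace R 2) (P_e2 R) (@tube R)
  (Ad_orbit (e2_L R)) tube_to_P P_to_tube setT P_affine) => //.
all: try by [exact: cspace_covered|exact: P_covered|exact: open_cspace
  |exact: P_affine_open|exact: smooth_tube_to_P|exact: smooth_P_to_tube|exact: orbit_affine
  |exact: tube_submanifold].
- by move=> z tz; split; [apply/orbitP; exists z|exact: tube_to_PK].
- by move=> P oP; split; [have /orbitP [z tz ->] := oP; rewrite tube_to_PK|apply: P_to_tubeK; exact: orbit_affine].
Qed.

Lemma T01_scale n (k : R[i]) (w : 'rV[R[i]]_(n + n)) : k != 0 -> T01 (k *: w) -> T01 w.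
Proof.
move=> k0 /T01P H; apply/T01P.
have : k *: (lsubmx w + 'i%C *: rsubmx w) = 0.
  by rewrite -[RHS]H scalerDr scalerA mulrC -scalerA !linearZ.
by move=> /eqP; rewrite scaler_eq0 (negPf k0) => /eqP.
Qed.

(** The (0,1)-vectors form an eigenspace of J, and J is invertible. So the factor - i between the
    tube and the orbit does not affect the test. *)
Lemma T01_cJ n (w : 'rV[R[i]]_(n + n)) : T01 (cJ w) <-> T01 w.
Proof.
have ii : 'i%C * 'i%C = -1 :> R[i] by apply: eqC => /=; ring.
rewrite !T01P /cJ row_mxKl row_mxKr.
have -> : - rsubmx w + 'i%C *: lsubmx w = 'i%C *: (lsubmx w + 'i%C *: rsubmx w).
  by rewrite scalerDr scalerA ii scaleN1r addrC.
split => [/eqP|->]; last by rewrite scaler0.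
rewrite scaler_eq0 => /orP[/eqP i0|/eqP //].
by move: ii; rewrite i0 mul0r => /esym/eqP; rewrite oppr_eq0 oner_eq0.
Qed.

Lemma cdiff_cJ_comp m n (F : 'rV[R]_m -> 'rV[R]_(n + n)) x v : differentiable F x ->
  cdiff (fun y => cJ (F y)) x v = cJ (cdiff F x v).
Proof.
move=> dF; have D w : 'D_w (fun y => cJ (F y)) x = cJ ('D_w F x) by exact: (derive_linear (@cJ R n)).
by rewrite !cdiff_cplxmx !D cJ_cplxmx.
Qed.

Lemma cplxmx_N m n (A B : 'M[R]_(m, n)) : cplxmx (- A) (- B) = - cplxmx A B.
Proof. by apply/matrixP => i j; rewrite !mxE; apply: eqC. Qed.

(** The map is g |-> [Ad g L]. In the last affine chart it reads - i times the tube coordinates of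
    g, so the test of [cr_equiv_induced] comes down to [T01_tube_coord]. *)
Lemma E2_orbit_cr_equiv : exists f, cr_equiv (E2_space R) (@E2_V R)
  (sub_space 3 (P_e2 R) (Ad_orbit (e2_L R))) (induced_cr (P_e2 R)) f.
Proof.
exists (fun g => tube_to_P (E2_to_tube g)); apply: cr_equiv_induced.
- exact: mxspace3_covered.
- by [].
- exact: P_complex.
- by move=> P /orbit_affine; exact: P_affine_open.1.
- apply: (@diffeo_sub R _ _ _ _ (mxspace3 R) (P_e2 R) (@E2 R) (Ad_orbit (e2_L R))
    (fun g => tube_to_P (E2_to_tube g)) (fun P => tube_to_E2 (P_to_tube P)) setT P_affine) => //.
  all: try by [exact: mxspace3_covered|exact: P_covered|exact: open_in_setT
    |exact: P_affine_open|exact: orbit_affine].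
  + exact: (smooth_map_comp (@cspace_covered R 2) smooth_E2_to_tube smooth_tube_to_P).
  + exact: (smooth_map_comp (@cspace_covered R 2) smooth_P_to_tube smooth_tube_to_E2).
  + move=> g Eg; have [tg gK] := E2_to_tubeK Eg; split; first by apply/orbitP; exists (E2_to_tube g).
    by rewrite tube_to_PK.
  + move=> P /orbitP [z tz ->]; rewrite tube_to_PK; have [Ez Ek] := tube_to_E2K tz.
    by rewrite Ek.
- move=> c x sc cx.
  exists (pchart R 2%:R), (fun y => cJ (- tube_coord (pmap c y))).
  have dc := mx_param_diff sc cx; have [oc cS _ _] := sc.
  have sF : smooth_on (pdom c) (fun y => - tube_coord (pmap c y)).
    apply: (smooth_on_linear_comp (-%R \o @tube_coord R)) => //; exact: (mx_param_smooth sc).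
  split; first by exists 2%:R.
    exists (pdom c); split => //.
      exact: (smooth_on_linear_comp (@cJ R 2)).
    by move=> y cy; split => //; rewrite /tube_to_P /E2_to_tube cvecK cJN.
  move=> v; rewrite (cdiff_cJ_comp _ (smooth_on_differentiable sF cx)) T01_cJ.
  have -> : cdiff (fun y => - tube_coord (pmap c y)) x v = - tube_coord (cdiff (pmap c) x v).
    have D w : 'D_w (fun y => - tube_coord (pmap c y)) x = - tube_coord ('D_w (pmap c) x).
      exact: (derive_linear (-%R \o @tube_coord R) w dc).
    by rewrite !cdiff_cplxmx !D -cplxmx_tube_coord cplxmx_N.
  have -> : T01 (- tube_coord (cdiff (pmap c) x v)) <-> T01 (tube_coord (cdiff (pmap c) x v)).
    have n1 : (-1 : R[i]) != 0 by rewrite oppr_eq0 oner_eq0.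
    split=> H; apply: (T01_scale n1); first by rewrite scaleN1r.
    by rewrite scaleN1r opprK.
  have [a [b [e Ev]]] := E2_tangent v sc cx.
  rewrite Ev T01_tube_coord; last exact: cS.
  by rewrite /E2_V /left_line_field /= Ev.
Qed.

(** [P_to_tube] is multiplication by i in the affine chart, hence holomorphic, and it respects the
    induced structures. *)
Lemma orbit_tube_cr_equiv : exists f, cr_equiv
  (sub_space 3 (P_e2 R) (Ad_orbit (e2_L R))) (induced_cr (P_e2 R))
  (sub_space 3 (cspace R 2) (@tube R)) (induced_cr (cspace R 2)) f.
Proof.
exists P_to_tube; apply: cr_equiv_induced.
- exact: P_covered.
- by move=> P /orbit_affine; exact: P_affine_open.1.
- exact: cspace_complex.
- by [].
- apply: (@diffeo_sub R _ _ _ _ (P_e2 R) (cspace R 2) (Ad_orbit (e2_L R)) (@tube R)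
    P_to_tube tube_to_P P_affine setT) => //.
  all: try by [exact: P_covered|exact: cspace_covered|exact: P_affine_open
    |exact: open_cspace|exact: smooth_P_to_tube|exact: smooth_tube_to_P
    |exact: orbit_affine].
  + by move=> P oP; split; [have /orbitP [z tz ->] := oP; rewrite tube_to_PK|apply: P_to_tubeK; exact: orbit_affine].
  + by move=> z tz; split; [apply/orbitP; exists z|exact: tube_to_PK].
- move=> c x sc cx.
  have SP : Ad_orbit (e2_L R) `<=` pts (P_e2 R) by move=> P /orbit_affine; exact: P_affine_open.1.
  have [a [F [Pa _ rF]]] := sub_param_rep P_covered SP sc cx.
  have [k _ ak] := Pa; have [_ cS _ _] := sc.
  have [_ _ EF dF] := local_rep_at rF.
  have dFx : pdomain k 2%:R (F x).
    have [w w2 Ew] := orbit_affine (cS _ cx).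
    move: EF; rewrite -ak /= Ew => /(pline_eq (@homog_neq0 _ _ _)) [k' k0 E'].
    by rewrite /pdomain /= E' mxE mulf_neq0.
  rewrite -ak in rF.
  have rF2 := local_rep_comp rF (ptrans_rep dFx).
  have [_ _ _ dF2] := local_rep_at rF2.
  exists (Param setT (@cvec R 2)), (fun y => cJ (ptrans k 2%:R (F y))); split => //.
    exact: (local_rep_comp rF (P_to_tube_rep dFx)).
  move=> v; rewrite (cdiff_cJ_comp _ dF2) T01_cJ.
  have Pa2 : atlas (P_e2 R) (pchart R 2%:R) by exists 2%:R.
  split.
    move=> [d' [F' [Pd' rF' TF']]].
    exact: (T01_chart P_complex Pd' Pa2 rF' rF2).
  by move=> TF; exists (pchart R 2%:R), (fun y => ptrans k 2%:R (F y)).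
Qed.

End realization.

(** * Charts of the sphere *)

Section sphere.
Variable R : realType.

Lemma normC2 (z : R[i]) :
  `|z| ^+ 2 = (complex.Re z * complex.Re z + complex.Im z * complex.Im z)%:C%C.
Proof.
case: z => a b; rewrite normc_def /= -rmorphXn /= sqr_sqrtr; last by rewrite addr_ge0 ?sqr_ge0.
by rewrite !expr2.
Qed.

Lemma ord4P (P : 'I_(2 + 2) -> Prop) : P (lshift 2 0) -> P (lshift 2 1) ->
  P (rshift 2 0) -> P (rshift 2 1) -> forall i, P i.
Proof.
move=> P0 P1 P2 P3 [[|[|[|[|//]]]] lt]; [move: P0|move: P1|move: P2|move: P3];
congr P; exact: val_inj.
Qed.

Lemma sum2 (K : nmodType) (F : 'I_2 -> K) : \sum_i F i = F 0 + F 1.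
Proof. by rewrite !big_ord_recl big_ord0 addr0; congr (_ + F _); exact: val_inj. Qed.

Lemma sphereP (v : 'rV[R]_(2 + 2)) : sphere3 (cvec v) <->
  v 0 (lshift 2 0) * v 0 (lshift 2 0) + v 0 (rshift 2 0) * v 0 (rshift 2 0) +
  (v 0 (lshift 2 1) * v 0 (lshift 2 1) + v 0 (rshift 2 1) * v 0 (rshift 2 1)) = 1.
Proof.
rewrite /sphere3 /= sum2 !normC2 -rmorphD !mxE /=.
by split=> [/(congr1 (@complex.Re R))|->].
Qed.

Definition row4 (a b c d : R) : 'rV[R]_(2 + 2) := \row_(j < 2 + 2) nth 0 [:: a; b; c; d] j.

Definition sq3 (u : 'rV[R]_3) : R := u 0 0 * u 0 0 + u 0 1 * u 0 1 + u 0 2%:R * u 0 2%:R.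

(* Inverse stereographic projection, from the pole where the last coordinate is - s. *)
Definition stereo (s : R) (u : 'rV[R]_3) : 'rV[R]_(2 + 2) :=
  let t := (1 + sq3 u)^-1 in
  row4 (2 * u 0 0 * t) (2 * u 0 1 * t) (2 * u 0 2%:R * t) (s * (1 - sq3 u) * t).

Definition unstereo (s : R) (v : 'rV[R]_(2 + 2)) : 'rV[R]_3 :=
  let t := (1 + s * v 0 (rshift 2 1))^-1 in
  row3 (v 0 (lshift 2 0) * t) (v 0 (lshift 2 1) * t) (v 0 (rshift 2 0) * t).

Lemma sq3_neq0 u : 1 + sq3 u != 0.
Proof.
by rewrite lt0r_neq0 // ltr_pwDl // /sq3 -!expr2 !addr_ge0 ?sqr_ge0.
Qed.

Lemma stereo_sphere s u : s * s = 1 -> sphere3 (cvec (stereo s u)).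
Proof.
move=> ss; apply/sphereP; rewrite !mxE /=.
have n0 := sq3_neq0 u.
transitivity ((4 * sq3 u + s * s * (1 - sq3 u) ^+ 2) * ((1 + sq3 u)^-1) ^+ 2).
  by rewrite /sq3; ring.
by rewrite ss; field.
Qed.

Lemma stereoK s u : s * s = 1 ->
  1 + s * stereo s u 0 (rshift 2 1) != 0 /\ unstereo s (stereo s u) = u.
Proof.
move=> ss; have n0 := sq3_neq0 u.
have E : 1 + s * stereo s u 0 (rshift 2 1) = 2 / (1 + sq3 u).
  rewrite mxE /=; transitivity (1 + s * s * ((1 - sq3 u) / (1 + sq3 u))); first ring.
  by rewrite ss; field.
split; first by rewrite E mulf_neq0 ?invr_neq0 ?pnatr_eq0.
rewrite /unstereo E [RHS]row3_eta !mxE /=; congr row3; by field.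
Qed.

Lemma unstereoK s v : s * s = 1 -> sphere3 (cvec v) -> 1 + s * v 0 (rshift 2 1) != 0 ->
  stereo s (unstereo s v) = v.
Proof.
move=> ss /sphereP; rewrite /unstereo.
set a := v 0 (lshift 2 0); set b := v 0 (rshift 2 0); set c := v 0 (lshift 2 1).
set w := v 0 (rshift 2 1) => S w0.
have E : sq3 (unstereo s v) = (1 - s * w) / (1 + s * w).
  rewrite /sq3 /unstereo !mxE /= -/a -/b -/c -/w.
  transitivity ((1 - s * s * w * w) * ((1 + s * w)^-1) ^+ 2); last by field.
  by rewrite ss mul1r -S; ring.
have E1 : (1 + sq3 (unstereo s v))^-1 = (1 + s * w) / 2.
  by rewrite E -[RHS]invf_div; congr (_^-1); field.
rewrite /stereo -/(unstereo s v) E1 E; apply/rowP; elim/ord4P; rewrite !mxE /= ?mxE /= -/a -/b -/c -/w.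
- by field.
- by field.
- by field.
- transitivity (s * s * w); last by rewrite ss mul1r.
  by field.
Qed.

Definition sphere_param (s : R) : param R 'rV[R[i]]_2 3 :=
  Param setT (fun u => cvec (stereo s u)).

Lemma smooth_stereo s : smooth_on setT (stereo s).
Proof.
have oT := @openT 'rV[R]_3.
have sc j : smooth_on setT (fun u : 'rV[R]_3 => u 0 j : R) by exact: smooth_on_coord.
have sq : smooth_on setT sq3.
  by apply: (smooth_onD oT); [apply: (smooth_onD oT)|]; exact: smooth_onM.
have sV : smooth_on setT (fun u => (1 + sq3 u)^-1).
  apply: (smooth_onV oT) => [x _|]; first exact: sq3_neq0.
  by apply: (smooth_onD oT) => //; exact: smooth_on_cst.
have s2 j : smooth_on setT (fun u : 'rV[R]_3 => 2 * u 0 j * (1 + sq3 u)^-1).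
  apply: (smooth_onM oT) => //; apply: (smooth_onM oT) => //; exact: smooth_on_cst.
apply: (smooth_on_mx oT) => i; rewrite ord1; elim/ord4P.
- by apply: (smooth_on_ext oT _ (s2 0)) => u _; rewrite [RHS]mxE.
- by apply: (smooth_on_ext oT _ (s2 1)) => u _; rewrite [RHS]mxE.
- by apply: (smooth_on_ext oT _ (s2 2%:R)) => u _; rewrite [RHS]mxE.
- apply: (smooth_on_ext oT (f := fun u => s * (1 - sq3 u) * (1 + sq3 u)^-1)).
    by move=> u _; rewrite [RHS]mxE.
  apply: (smooth_onM oT) => //; apply: (smooth_onM oT); first exact: smooth_on_cst.
  by apply: (smooth_onB oT) => //; exact: smooth_on_cst.
Qed.

(** The retraction is the stereographic projection itself, whose formula makes sense on the open
    part of C^2 where its denominator does not vanish. *)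
Lemma sphere_sub_param s : s * s = 1 -> sub_param (cspace R 2) (@sphere3 R) (sphere_param s).
Proof.
move=> ss; split => /=.
- exact: openT.
- by move=> u _; exact: stereo_sphere.
- have oT : open [set x : 'rV[R]_3 | setT (id x)] by exact: openT.
  apply: (one_chart_smooth (@ccoordK R 2) (@cvecK R 2) oT) => /=.
  apply: (smooth_on_ext oT _ (smooth_stereo s)) => u _; by rewrite cvecK.
- move=> u _.
  pose D (v : 'rV[R]_(2 + 2)) := 1 + s * v 0 (rshift 2 1).
  have sD U : open U -> smooth_on U D.
    move=> oU; apply: (smooth_onD oU); first exact: smooth_on_cst.
    by apply: (smooth_onM oU); [exact: smooth_on_cst|exact: smooth_on_coord].
  have oD : open [set v | D v != 0].
    have := continuous_on_open openT (sD _ openT) (@open_neq R 0).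
    by congr open; apply/seteqP; split => [v []|v ?].
  exists [set z | D (ccoord z) != 0], (fun z => unstereo s (ccoord z)); split.
  + apply: (@one_chart_open R _ _ (@cvec R 2)).
    rewrite (_ : [set x | _] = [set v | D v != 0]) //.
    by apply/seteqP; split => v /=; rewrite cvecK.
  + by rewrite /= cvecK; have [] := stereoK u ss.
  + have oD' : open [set x : 'rV[R]_(2 + 2) | [set z | D (ccoord z) != 0] (cvec x)].
      rewrite (_ : [set x | _] = [set v | D v != 0]) //.
      by apply/seteqP; split => v /=; rewrite cvecK.
    apply: (@one_chart_smooth R _ _ _ _ (@cvec R 2) id id) => //=.
    have DE : [set x : 'rV[R]_(2 + 2) | D (ccoord (cvec x)) != 0] = [set v | D v != 0].
      by apply/seteqP; split => v /=; rewrite cvecK.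
    rewrite DE; apply: (smooth_on_ext oD (f := unstereo s)).
      by move=> v _; rewrite cvecK.
    have sV j : smooth_on [set v | D v != 0] (fun v => v 0 j * (D v)^-1).
      apply: (smooth_onM oD); first exact: smooth_on_coord.
      by apply: (smooth_onV oD) => //; exact: sD.
    apply: (smooth_on_mx oD) => i; rewrite ord1; elim/ord3P.
    * by apply: (smooth_on_ext oD _ (sV (lshift 2 0))) => v _; rewrite [RHS]mxE.
    * by apply: (smooth_on_ext oD _ (sV (lshift 2 1))) => v _; rewrite [RHS]mxE.
    * by apply: (smooth_on_ext oD _ (sV (rshift 2 0))) => v _; rewrite [RHS]mxE.
  + move=> z Sz /= Dz; exists (unstereo s (ccoord z)) => //.
    by rewrite unstereoK ?ccoordK.
  + by move=> y _ _; rewrite cvecK; have [] := stereoK y ss.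
Qed.

Lemma sphere_chart z : sphere3 z -> exists (d : param R 'rV[R[i]]_2 3) y,
  [/\ sub_param (cspace R 2) (@sphere3 R) d, pdom d y & pmap d y = z].
Proof.
move=> Sz; pose v := ccoord z.
have main s : s * s = 1 -> 1 + s * v 0 (rshift 2 1) != 0 -> exists (d : param R 'rV[R[i]]_2 3) y,
  [/\ sub_param (cspace R 2) (@sphere3 R) d, pdom d y & pmap d y = z].
  move=> ss v0; exists (sphere_param s), (unstereo s v); split => //.
    exact: sphere_sub_param.
  by rewrite /= unstereoK ?ccoordK.
(* The point missed by the chart with [s = 1] has last coordinate -1, for which the other
   denominator is 2. *)
have [E|/main H] := eqVneq (1 + 1 * v 0 (rshift 2 1)) 0; last by apply: H; ring.
apply: (main (-1)); first ring.
have -> : v 0 (rshift 2 1) = -1 by apply/eqP; rewrite -addr_eq0 addrC -[v _ _]mul1r E.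
by rewrite mulrNN mulr1 -[1 + 1]/(2%:R) pnatr_eq0.
Qed.

End sphere.

(** * Asphericity *)

Section spherical_structure_equations.
Variables (A : comPzRingType) (L M J N : A -> A).
Hypotheses (LD : forall u v, L (u + v) = L u + L v)
  (LM : forall u v, L (u * v) = L u * v + u * L v)
  (MD : forall u v, M (u + v) = M u + M v)
  (MM : forall u v, M (u * v) = M u * v + u * M v)
  (JD : forall u v, J (u + v) = J u + J v)
  (JM : forall u v, J (u * v) = J u * J v)
  (J1 : J 1 = 1) (JK : forall u, J (J u) = u) (JL : forall u, J (L u) = M (J u)).
Hypothesis NE : forall u, N u = L (M u) - M (L u).
Hypothesis NM : forall u, N (M u) - M (N u) = L u + M u.

(* Since f = (f1, f2) has norm 1 and is killed by L, M f = mu (- J f2, J f1) with mu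
   invertible. Applied to f, the commutation relations give L (L mu) = mu and
   M mu = - 2 (J k) mu for k = L mu / mu, hence L k = 1 - k^2. Applied to mu they
   give 6 L m = - 6 k m - 3 k for m = M k, and the relation for N and L applied to
   k is then 9 = 0. *)
Lemma spherical_impossible (f1 f2 hi : A) :
  L f1 = 0 -> L f2 = 0 -> f1 * J f1 + f2 * J f2 = 1 ->
  (M f1 * J (M f1) + M f2 * J (M f2)) * hi = 1 -> 9%:R = 0 :> A.
Proof.
move=> L1f L2f ff hh.
have L0 : L 0 = 0 by apply: (addrI (L 0)); rewrite -LD !addr0.
have M0 : M 0 = 0 by apply: (addrI (M 0)); rewrite -MD !addr0.
have J0 : J 0 = 0 by apply: (addrI (J 0)); rewrite -JD !addr0.
have LN u : L (- u) = - L u by apply/eqP; rewrite -addr_eq0 -LD addNr L0.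
have MN u : M (- u) = - M u by apply/eqP; rewrite -addr_eq0 -MD addNr M0.
have JN u : J (- u) = - J u by apply/eqP; rewrite -addr_eq0 -JD addNr J0.
have L1 : L 1 = 0 by apply: (addrI (L 1)); rewrite addr0 -{3}(mulr1 1) LM mulr1 mul1r.
have M1 : M 1 = 0 by apply: (addrI (M 1)); rewrite addr0 -{3}(mulr1 1) MM mulr1 mul1r.
have JMJ u : J (M u) = L (J u) by rewrite -[RHS]JK JL JK.
have NMul u v : N (u * v) = N u * v + u * N v.
  by rewrite !NE LM MM LD MD !LM !MM; ring.
have ND u v : N (u + v) = N u + N v by rewrite !NE LD MD LD MD; ring.
have NN u : N (- u) = - N u by rewrite !NE LN MN LN MN; ring.
have JNJ u : J (N u) = - N (J u) by rewrite !NE JD JN JL JMJ JMJ JL; ring.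
(* The conjugate of [NM]: [J] exchanges [L] and [M] and turns [N] into its opposite. *)
have NL u : N (L u) - L (N u) = - (L u + M u).
  have := congr1 J (NM (J u)); rewrite !(JD, JN, JL, JMJ, JNJ, JK, LN) => E.
  by apply: oppr_inj; rewrite opprK -[RHS]addrC -E; ring.
have MJ1 : M (J f1) = 0 by rewrite -JL L1f J0.
have MJ2 : M (J f2) = 0 by rewrite -JL L2f J0.
have orth : M f1 * J f1 + M f2 * J f2 = 0.
  by have := congr1 M ff; rewrite MD !MM MJ1 MJ2 M1 !mulr0 !addr0.
(* The determinant of (f, M f). As M f is orthogonal to the unit vector f, this is the coefficient
   of M f along (- J f2, J f1). *)
pose mu := f1 * M f2 - f2 * M f1.
have M1f : M f1 = - (mu * J f2).
  transitivity (M f1 * (f1 * J f1 + f2 * J f2) - f1 * (M f1 * J f1 + M f2 * J f2)).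
    by rewrite ff orth; ring.
  by rewrite /mu; ring.
have M2f : M f2 = mu * J f1.
  transitivity (M f2 * (f1 * J f1 + f2 * J f2) - f2 * (M f1 * J f1 + M f2 * J f2)).
    by rewrite ff orth; ring.
  by rewrite /mu; ring.
(* Equal to |M f|^2, hence invertible with inverse [hi]; this is what allows cancelling [mu] and
   [J mu] in a ring that need not be a domain. *)
pose h := mu * J mu.
have hhi : h * hi = 1.
  rewrite -hh M1f M2f JN !JM !JK; transitivity (h * hi * (f1 * J f1 + f2 * J f2)).
    by rewrite ff mulr1.
  by rewrite /h; ring.
clearbody mu.
pose mi := J mu * hi.
have mumi : mu * mi = 1 by rewrite -hhi /h /mi; ring.
have muI x : x * mu = 0 -> x = 0.
  by move=> E; rewrite -[x]mulr1 -mumi mulrA E mul0r.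
have JmuI x : x * J mu = 0 -> x = 0.
  move=> E; rewrite -[x]mulr1 -hhi; transitivity (x * J mu * mu * hi); first by rewrite /h; ring.
  by rewrite E !mul0r.
have hE : h = mu * J mu by [].
clearbody h.
have LJ1 : L (J f1) = - (J mu * f2) by rewrite -JMJ M1f JN JM JK.
have LJ2 : L (J f2) = J mu * f1 by rewrite -JMJ M2f JM JK.
(* f and (J f2, - J f1) form a basis: the determinant of the system is, up to sign, |f|^2 = 1. Each
   bracket relation applied to f thus yields two scalar equations. *)
have indep a b : a * f1 + b * J f2 = 0 -> a * f2 - b * J f1 = 0 -> a = 0 /\ b = 0.
  move=> E1 E2; split.
    transitivity (a * (f1 * J f1 + f2 * J f2)); first by rewrite ff mulr1.
    transitivity ((a * f1 + b * J f2) * J f1 + (a * f2 - b * J f1) * J f2); first by ring.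
    by rewrite E1 E2; ring.
  transitivity (b * (f1 * J f1 + f2 * J f2)); first by rewrite ff mulr1.
  transitivity ((a * f1 + b * J f2) * f2 - (a * f2 - b * J f1) * f1); first by ring.
  by rewrite E1 E2; ring.
pose la := L mu.
have MJmu : M (J mu) = J la by rewrite -JL.
have Lmu' : L mu = la by [].
clearbody la.
have N1f : N f1 = - (la * J f2) - h * f1.
  by rewrite NE L1f M0 M1f LN LM LJ2 Lmu' hE; ring.
have N2f : N f2 = la * J f1 - h * f2.
  by rewrite NE L2f M0 M2f LM LJ1 Lmu' hE; ring.
have NJ1 : N (J f1) = J la * f2 + h * J f1.
  by rewrite NE MJ1 L0 LJ1 MN MM M2f MJmu hE; ring.
have NJ2 : N (J f2) = - (J la * f1) + h * J f2.
  by rewrite NE MJ2 L0 LJ2 MM M1f MJmu hE; ring.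
have [eA eB] : mu * J la + M h = 0 /\ mu - N mu - 2%:R * mu * h + M la = 0.
  apply: indep.
    have := NM f1; rewrite N1f M1f L1f NN NMul NJ2 MD !MN !MM MJ2 M1f => E.
    by move: E => /eqP; rewrite -subr_eq0 => /eqP <-; ring.
  have := NM f2; rewrite N2f M2f L2f NMul NJ1 MD !MN !MM MJ1 M2f => E.
  by move: E => /eqP; rewrite -subr_eq0 => /eqP <-; ring.
have N0 : N 0 = 0 by rewrite NE M0 L0 M0 subrr.
have [eL /eqP] : - L h - J mu * la = 0 /\ mu - L la = 0.
  apply: indep.
    have := NL f1; rewrite N1f L1f M1f LD !LN !LM LJ2 L1f N0 => E.
    by move: E => /eqP; rewrite -subr_eq0 => /eqP /(congr1 -%R); rewrite oppr0 => <-; ring.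
  have := NL f2; rewrite N2f L2f M2f LD !LN !LM LJ1 L2f N0 => E.
  by move: E => /eqP; rewrite -subr_eq0 => /eqP /(congr1 -%R); rewrite oppr0 => <-; ring.
rewrite subr_eq0 => /eqP/esym eC.
pose k := la * mi.
have laE : la = k * mu by rewrite /k -mulrA (mulrC mi) mumi mulr1.
clearbody k; pose m := M k.
have Mk : M k = m by [].
clearbody m.
have Mmu : M mu = - (2%:R * J k * mu).
  apply/eqP; rewrite -subr_eq0; apply/eqP/JmuI.
  by rewrite -[RHS]eA hE MM MJmu laE JM; ring.
have Lmu : L mu = k * mu by rewrite Lmu' laE.
have Lk : L k = 1 - k * k.
  apply/eqP; rewrite -subr_eq0; apply/eqP/muI.
  transitivity (L la - mu); last by rewrite eC subrr.
  by rewrite laE LM Lmu; ring.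
have MJk : M (J k) = 1 - J k * J k by rewrite -JL Lk JD JN JM J1.
have LJk : L (J k) = J m by rewrite -JMJ Mk.
have Lh : L h = - (k * h).
  by apply/eqP; rewrite -subr_eq0; apply/eqP; rewrite -[RHS]oppr0 -eL laE hE; ring.
have L2 u : L (2%:R * u) = 2%:R * L u by rewrite -[2%:R]/(1 + 1) !mulrDl LD !mul1r.
have M2 u : M (2%:R * u) = 2%:R * M u by rewrite -[2%:R]/(1 + 1) !mulrDl MD !mul1r.
have N2 u : N (2%:R * u) = 2%:R * N u by rewrite -[2%:R]/(1 + 1) !mulrDl ND !mul1r.
have J2 u : J (2%:R * u) = 2%:R * J u by rewrite -[2%:R]/(1 + 1) !mulrDl JD !mul1r.
have Nmu : N mu = - ((2%:R * J m + m) * mu).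
  by rewrite NE Mmu Lmu LN -mulrA L2 LM LJk Lmu MM Mk Mmu; ring.
(* This is [eB] divided by [mu]. *)
have E1 : 2%:R * m + 2%:R * J m = 2%:R * h + 2%:R * (k * J k) - 1.
  apply/eqP; rewrite -subr_eq0; apply/eqP/muI.
  by rewrite -[RHS]eB Nmu laE MM Mk Mmu; ring.
have NJk : N (J k) = - (2%:R * J k * J m) - M (J m).
  by rewrite NE MJk LJk LD LN LM LJk L1; ring.
(* The relation [NM] at [mu], divided by [mu]. Its conjugate [F1] and the derivative [F2] of [E1]
   along [L] are two linear equations for [L m] and [L (J m)]. *)
have F0 : 2%:R * (2%:R * (J k * J m)) + 2%:R * (2%:R * M (J m)) + M m = k - 2%:R * J k.
  apply/eqP; rewrite -subr_eq0; apply/eqP/muI.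
  have := NM mu; rewrite Mmu Nmu NN -mulrA N2 NMul NJk Nmu MN MM MD M2 Mmu Lmu => E.
  by move: E => /eqP; rewrite -subr_eq0 => /eqP <-; ring.
have F1 : 2%:R * (2%:R * (k * m)) + 2%:R * (2%:R * L m) + L (J m) = J k - 2%:R * k.
  by have := congr1 J F0; rewrite !(JD, JN, J2, JM, JMJ, JK).
have F2 : 2%:R * L m + 2%:R * L (J m) = - (2%:R * (k * h)) + 2%:R * (k * J m) + 2%:R * ((1 - k * k) * J k).
  have := congr1 L E1; rewrite !(LD, LN, L2, LM) Lh Lk LJk L1 => ->; ring.
(* Twice [F1] minus [F2] eliminates [L (J m)], and [E1] eliminates [J m] and [h]. The factor 6 is
   kept, since it need not be invertible in the ring. *)
have Lm : 6%:R * L m = - (6%:R * k * m) - 3%:R * k.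
  transitivity (2%:R * (2%:R * (2%:R * (k * m)) + 2%:R * (2%:R * L m) + L (J m)) -
     (2%:R * L m + 2%:R * L (J m)) - 8%:R * (k * m)); first by ring.
  rewrite F1 F2; transitivity (k * (2%:R * h + 2%:R * (k * J k) - 1) -
      2%:R * k * J m - 8%:R * (k * m) - 3%:R * k).
    by ring.
  by rewrite -E1; ring.
have Nk : N k = L m + 2%:R * (k * m).
  by rewrite NE Mk Lk MD MN MM Mk M1; ring.
have L6 u : L (6%:R * u) = 6%:R * L u.
  by rewrite !mulr_natl !mulrS mulr0n !addr0 !LD.
have Nk6 : 6%:R * N k = 6%:R * (k * m) - 3%:R * k by rewrite Nk mulrDr Lm; ring.
have N1 : N 1 = 0 by rewrite NE L1 M1 L0 M0 subrr.
have NLk : N (L k) = - (2%:R * (k * N k)) by rewrite Lk ND NN NMul N1; ring.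
have LNk : 6%:R * L (N k) = 6%:R * L (k * m) - 3%:R * L k.
  rewrite -L6 Nk6 LD LN L6; congr (_ - _).
  by rewrite !mulr_natl !mulrS mulr0n !addr0 !LD.
(* Multiplied by 6, this relation involves only [k] and [m]; all terms containing them cancel and 3
   = - 6 remains. *)
have := NL k; rewrite NLk Lk Mk => E.
have E6 : - (2%:R * (k * (6%:R * N k))) - (6%:R * L (N k)) = - (6%:R * (1 - k * k + m)).
  by rewrite -[RHS]mulrN -E; ring.
have L6m : 6%:R * L (k * m) = 6%:R * (1 - k * k) * m - k * (6%:R * k * m + 3%:R * k).
  rewrite LM Lk mulrDr (mulrCA _ k) Lm; ring.
rewrite Nk6 LNk L6m Lk in E6.
by move: E6 => /eqP; rewrite -subr_eq0 => /eqP <-; ring.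
Qed.

End spherical_structure_equations.

(* Vanishing off W makes Leibniz equality the equality on W. *)
Record smooth_fun (R : realType) n (W : {W : set 'rV[R]_n | open W}) := SmoothFun {
  sfun :> 'rV[R]_n -> R[i];
  sfun_csmooth : csmooth (sval W) sfun;
  sfun_off : forall x, ~ sval W x -> sfun x = 0 }.

(** * The ring of smooth complex functions on an open set, with its derivations and conjugation *)

Section smooth_ring.
Variables (R : realType) (n : nat) (W : {W : set 'rV[R]_n | open W}).
Let oW : open (sval W) := svalP W.
Implicit Types f g : smooth_fun W.

Lemma smooth_funP f g : (forall x, sval W x -> f x = g x) -> f = g.
Proof.
case: f => f sf f0; case: g => g sg g0 /= fg.
have E : f = g.
  by apply: funext => x; have [/fg //|Wx] := pselect (sval W x); rewrite f0 // g0.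
subst g; congr SmoothFun; exact: Prop_irrelevance.
Qed.

(** The extension may be discontinuous on the boundary of [W], which is harmless: smoothness is
    asked at points of the open set [W] only. *)
Definition extend0 (u : 'rV[R]_n -> R[i]) x : R[i] := if `[< sval W x >] then u x else 0.

Lemma extend0E u x : sval W x -> extend0 u x = u x.
Proof. by move=> Wx; rewrite /extend0 asboolT. Qed.

Lemma extend0_csmooth u : csmooth (sval W) u -> csmooth (sval W) (extend0 u).
Proof. by apply: csmooth_ext => // x Wx; rewrite extend0E. Qed.

Lemma extend0_off u x : ~ sval W x -> extend0 u x = 0.
Proof. by move=> Wx; rewrite /extend0 asboolF. Qed.

Definition mk_smooth u (su : csmooth (sval W) u) : smooth_fun W :=
  SmoothFun (extend0_csmooth su) (@extend0_off u).

Lemma mk_smoothE u su x : sval W x -> @mk_smooth u su x = u x.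
Proof. exact: extend0E. Qed.

Definition sf_add f g := mk_smooth (csmoothD oW (sfun_csmooth f) (sfun_csmooth g)).
Definition sf_mul f g := mk_smooth (csmoothM oW (sfun_csmooth f) (sfun_csmooth g)).
Definition sf_opp f := mk_smooth (csmoothN oW (sfun_csmooth f)).
Definition sf_cst a := mk_smooth (csmooth_cst (sval W) a).
Definition sf_conj f := mk_smooth (csmoothJ oW (sfun_csmooth f)).

Lemma sf_addE f g x : sval W x -> sf_add f g x = f x + g x.
Proof. exact: mk_smoothE. Qed.
Lemma sf_mulE f g x : sval W x -> sf_mul f g x = f x * g x.
Proof. exact: mk_smoothE. Qed.
Lemma sf_oppE f x : sval W x -> sf_opp f x = - f x.
Proof. exact: mk_smoothE. Qed.
Lemma sf_cstE a x : sval W x -> sf_cst a x = a.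
Proof. exact: mk_smoothE. Qed.
Lemma sf_conjE f x : sval W x -> sf_conj f x = conjc (f x).
Proof. exact: mk_smoothE. Qed.

Lemma sf_addA : associative sf_add.
Proof. by move=> f g h; apply: smooth_funP => x Wx; rewrite !sf_addE // addrA. Qed.
Lemma sf_addC : commutative sf_add.
Proof. by move=> f g; apply: smooth_funP => x Wx; rewrite !sf_addE // addrC. Qed.
Lemma sf_add0 : left_id (sf_cst 0) sf_add.
Proof. by move=> f; apply: smooth_funP => x Wx; rewrite sf_addE // sf_cstE // add0r. Qed.
Lemma sf_addN : left_inverse (sf_cst 0) sf_opp sf_add.
Proof. by move=> f; apply: smooth_funP => x Wx; rewrite sf_addE // sf_oppE // sf_cstE // addNr. Qed.
Lemma sf_mulA : associative sf_mul.
Proof. by move=> f g h; apply: smooth_funP => x Wx; rewrite !sf_mulE // mulrA. Qed.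
Lemma sf_mulC : commutative sf_mul.
Proof. by move=> f g; apply: smooth_funP => x Wx; rewrite !sf_mulE // mulrC. Qed.
Lemma sf_mul1 : left_id (sf_cst 1) sf_mul.
Proof. by move=> f; apply: smooth_funP => x Wx; rewrite sf_mulE // sf_cstE // mul1r. Qed.
Lemma sf_mulDl : left_distributive sf_mul sf_add.
Proof.
by move=> f g h; apply: smooth_funP => x Wx; rewrite sf_mulE // !sf_addE // !sf_mulE // mulrDl.
Qed.

HB.instance Definition _ := gen_eqMixin (smooth_fun W).
HB.instance Definition _ := gen_choiceMixin (smooth_fun W).
HB.instance Definition _ :=
  GRing.isZmodule.Build (smooth_fun W) sf_addA sf_addC sf_add0 sf_addN.
HB.instance Definition _ :=
  GRing.Zmodule_isComPzRing.Build (smooth_fun W) sf_mulA sf_mulC sf_mul1 sf_mulDl.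

Lemma smooth_funD f g x : sval W x -> (f + g) x = f x + g x.
Proof. exact: sf_addE. Qed.
Lemma smooth_funM f g x : sval W x -> (f * g) x = f x * g x.
Proof. exact: sf_mulE. Qed.
Lemma smooth_funN f x : sval W x -> (- f) x = - f x.
Proof. exact: sf_oppE. Qed.
Lemma smooth_fun0 x : sval W x -> (0 : smooth_fun W) x = 0.
Proof. exact: sf_cstE. Qed.
Lemma smooth_fun1 x : sval W x -> (1 : smooth_fun W) x = 1.
Proof. exact: sf_cstE. Qed.

Lemma sf_conjD f g : sf_conj (f + g) = sf_conj f + sf_conj g.
Proof.
apply: smooth_funP => x Wx.
by rewrite smooth_funD // !sf_conjE // smooth_funD // rmorphD.
Qed.
Lemma sf_conjM f g : sf_conj (f * g) = sf_conj f * sf_conj g.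
Proof.
apply: smooth_funP => x Wx.
by rewrite smooth_funM // !sf_conjE // smooth_funM // rmorphM.
Qed.
Lemma sf_conj1 : sf_conj 1 = 1.
Proof. by apply: smooth_funP => x Wx; rewrite sf_conjE // !smooth_fun1 // rmorph1. Qed.
Lemma sf_conjK f : sf_conj (sf_conj f) = f.
Proof. by apply: smooth_funP => x Wx; rewrite !sf_conjE // conjcK. Qed.

Section derivation.
Variables (X : 'rV[R]_n -> 'rV[R[i]]_n) (sX : csmooth_on (sval W) X).

Definition sf_der f : smooth_fun W :=
  mk_smooth (csmooth_cderive oW ((csmoothP X oW).1 sX) (sfun_csmooth f)).

Lemma sf_derE f x : sval W x -> sf_der f x = cderive (X x) x f.
Proof. exact: mk_smoothE. Qed.

Lemma smooth_fun_cdifferentiable f x : sval W x -> cdifferentiable x f.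
Proof. exact/csmooth_cdifferentiable/sfun_csmooth. Qed.

Lemma sf_derD f g : sf_der (f + g) = sf_der f + sf_der g.
Proof.
apply: smooth_funP => x Wx; rewrite smooth_funD // !sf_derE //.
etransitivity; last by apply: cderiveD; exact: smooth_fun_cdifferentiable.
by apply: (cderive_ext _ oW Wx) => y Wy; rewrite smooth_funD.
Qed.

Lemma sf_derM f g : sf_der (f * g) = sf_der f * g + f * sf_der g.
Proof.
apply: smooth_funP => x Wx; rewrite smooth_funD // !smooth_funM // !sf_derE //.
etransitivity; last by apply: cderiveM; exact: smooth_fun_cdifferentiable.
by apply: (cderive_ext _ oW Wx) => y Wy; rewrite smooth_funM.
Qed.

End derivation.

Lemma sf_der_conj X Y (sX : csmooth_on (sval W) X) (sY : csmooth_on (sval W) Y) f :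
  (forall x, sval W x -> Y x = conjmx (X x)) ->
  sf_conj (sf_der sX f) = sf_der sY (sf_conj f).
Proof.
move=> YX; apply: smooth_funP => x Wx; rewrite sf_conjE // !sf_derE // YX //.
etransitivity; first by symmetry; apply: cderiveJ; exact: smooth_fun_cdifferentiable.
by apply: (cderive_ext _ oW Wx) => y Wy; rewrite sf_conjE.
Qed.

Lemma sf_der_bracket X Y Z (sX : csmooth_on (sval W) X) (sY : csmooth_on (sval W) Y)
    (sZ : csmooth_on (sval W) Z) f :
  (forall x, sval W x -> lie_bracket X Y x = Z x) ->
  sf_der sZ f = sf_der sX (sf_der sY f) - sf_der sY (sf_der sX f).
Proof.
move=> ZE; apply: smooth_funP => x Wx; rewrite smooth_funD // smooth_funN // !sf_derE // -ZE //.
etransitivity; first by apply: (cderive_lie_bracket oW sX sY (sfun_csmooth f) Wx).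
by congr (_ - _); apply: (cderive_ext _ oW Wx) => y Wy; rewrite sf_derE.
Qed.

End smooth_ring.

(** [spherical_impossible] in the ring of smooth functions on [W], with conjugation as [J]. Since
    the derivatives along [Y] have no common zero, |Y u|^2 has a smooth inverse, which serves as
    [hi]. Evaluation at [x] turns 9 = 0 into an equation between complex numbers. *)
Lemma no_spherical_frame (R : realType) (W : set 'rV[R]_3) X Y (u : 'I_2 -> 'rV[R]_3 -> R[i]) x :
  open W -> W x -> csmooth_on W X -> csmooth_on W Y ->
  (forall y, W y -> Y y = conjmx (X y)) ->
  (forall y, W y -> lie_bracket (lie_bracket X Y) Y y = X y + Y y) ->
  (forall j, csmooth W (u j)) -> (forall j y, W y -> cderive (X y) y (u j) = 0) ->
  (forall y, W y -> \sum_j `|u j y| ^+ 2 = 1) ->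
  ~ (forall y, W y -> exists j, cderive (Y y) y (u j) != 0).
Proof.
move=> oW Wx sX sY YX ZE su Xu u1 Yu.
pose V : {W : set 'rV[R]_3 | open W} := exist _ W oW.
have sN : csmooth_on (sval V) (lie_bracket X Y) by exact: csmooth_lie_bracket.
have sX' : csmooth_on (sval V) X by [].
have sY' : csmooth_on (sval V) Y by [].
have sZ : csmooth_on (sval V) (lie_bracket (lie_bracket X Y) Y) by exact: csmooth_lie_bracket.
pose f j : smooth_fun V := @mk_smooth R 3 V (u j) (su j).
have fE j y : W y -> f j y = u j y by move=> Wy; exact: (@mk_smoothE R 3 V (u j) (su j) y Wy).
pose L := @sf_der R 3 V X sX'; pose M := @sf_der R 3 V Y sY'; pose J := @sf_conj R 3 V.
have Lf j : L (f j) = 0.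
  apply: smooth_funP => y Wy; rewrite sf_derE // smooth_fun0 // -(Xu j y Wy).
  exact: (cderive_ext _ oW Wy (fE j)).
have ME j y : W y -> M (f j) y = cderive (Y y) y (u j).
  move=> Wy; rewrite sf_derE //; exact: (cderive_ext _ oW Wy (fE j)).
have JE g y : W y -> (g * J g) y = `|g y| ^+ 2.
  by move=> Wy; rewrite smooth_funM // sf_conjE // normCK.
have ff : f 0 * J (f 0) + f 1 * J (f 1) = 1.
  apply: smooth_funP => y Wy; rewrite smooth_funD // smooth_fun1 // !JE // !fE //.
  by rewrite -(u1 y Wy) sum2.
pose h := M (f 0) * J (M (f 0)) + M (f 1) * J (M (f 1)).
have h0 y : W y -> h y != 0.
  move=> Wy; rewrite smooth_funD // !JE // !ME //; have [j] := Yu y Wy.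
  apply: contra; rewrite paddr_eq0 ?exprn_ge0 // !expf_eq0 /= !normr_eq0 => /andP[E0 E1].
  by have [->|->] : j = 0 \/ j = 1 by case: j => [[|[|//]] lt]; [left|right]; exact: val_inj.
have shi : csmooth (sval V) (fun y => (h y)^-1).
  exact: (csmoothV oW h0 (@sfun_csmooth R 3 V h)).
have hh : h * mk_smooth shi = 1.
  by apply: smooth_funP => y Wy; rewrite smooth_funM // (mk_smoothE shi) // smooth_fun1 // mulfV // h0.
have NM g : sf_der sN (M g) - M (sf_der sN g) = L g + M g.
  rewrite -(sf_der_bracket sN sY' sZ g (fun _ _ => erefl)).
  by apply: smooth_funP => y Wy; rewrite smooth_funD // !sf_derE // ZE //; exact: cderiveDv.
have := @spherical_impossible (smooth_fun V) L M J (@sf_der R 3 V _ sN)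
  (sf_derD sX') (sf_derM sX') (sf_derD sY') (sf_derM sY') (@sf_conjD R 3 V) (@sf_conjM R 3 V)
  (@sf_conj1 R 3 V) (@sf_conjK R 3 V) (fun g => sf_der_conj sX' sY' g YX)
  (fun g => sf_der_bracket sX' sY' sN g (fun _ _ => erefl)) NM _ _ _ (Lf 0) (Lf 1) ff hh.
move=> /(congr1 (fun g : smooth_fun V => g x)).
have E9 k : (k%:R : smooth_fun V) x = k%:R.
  by elim: k => [|k IH]; rewrite ?smooth_fun0 // !mulrS smooth_funD // IH smooth_fun1.
by rewrite smooth_fun0 // E9 => /eqP; rewrite pnatr_eq0.
Qed.

(** * Local CR equivalences with the sphere, read as pairs of functions *)

Section aspherical.
Variable R : realType.

Lemma cr_equiv_on_rep T1 T2 n (M : space R T1 3) (V : cr_field R T1) O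
    (N : space R T2 n) (V' : cr_field R T2) S Q f c y :
  covered N -> submanifold 3 N S -> Q `<=` S ->
  cr_equiv_on M V O (sub_space 3 N S) V' Q f ->
  atlas M c -> pdom c y -> O (pmap c y) ->
  exists (d : param R T2 3) F (e : param R T2 n) H,
    [/\ sub_param N S d, local_rep c d f y F, atlas N e & local_rep d e id (F y) H].
Proof.
move=> cN [SN mS] OS [[g [fO _ sf _]] _] Mc cy Oy.
have [Qf _] := fO _ Oy.
have [d [z [sd dz Ed]]] := mS _ (OS _ Qf).
have [F rF] := sf c y d z Mc cy Oy sd dz Ed.
have [_ dF _ _] := local_rep_at rF.
have [e [H [Ne _ rH]]] := sub_param_rep cN SN sd dF.
by exists d, F, e, H.
Qed.

(** Both directions are used later: one says that L kills the components of the map, the other that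
    conj L does not kill both. The second recovers a vector from its image through the differential
    of the inverse map. *)
Lemma cr_equiv_on_T01 T1 T2 (M : space R T1 3) (V : cr_field R T1) O
    (N : space R T2 (2 + 2)) S Q f c y e K v :
  smooth_manifold M -> open_in M O ->
  complex_manifold N -> covered N -> submanifold 3 N S -> Q `<=` S ->
  cr_equiv_on M V O (sub_space 3 N S) (induced_cr N) Q f ->
  atlas M c -> pdom c y -> O (pmap c y) ->
  atlas N e -> local_rep c e f y K ->
  V c y v <-> T01 (cdiff K y v).
Proof.
move=> mM [_ oO] cN covN mS OS fE Mc cy Oy Ne rK.
have [d [F [e' [H [sd rF Ne' rH]]]]] := cr_equiv_on_rep covN mS OS fE Mc cy Oy.
have [[g [fO gO _ sg]] crf] := fE.
have [_ dF EF dfF] := local_rep_at rF.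
have [_ _ _ dfH] := local_rep_at rH.
have [Qf gf] := fO _ Oy.
have [G rG] : exists G, local_rep d c g (F y) G.
  by apply: (sg d (F y) c y) => //; rewrite EF.
have Finj : forall w, cdiff G (F y) (cdiff F y w) = w.
  have oW := oO c Mc.
  have [] := local_rep_cancel oW _ _ (mfd_open mM Mc) _ rF rG => //.
    by move=> z [_ Oz] _; have [] := fO _ Oz.
  by move=> z z'; exact: (mfd_inj mM Mc).
have crF := crf c d y F Mc sd Oy rF.
split=> [Vv|Tv].
  have [e2 [H2 [Ne2 rH2 TH2]]] : induced_cr N d (F y) (cdiff F y v).
    by rewrite -crF; exists v.
  have [_ _ _ dfH2] := local_rep_at rH2.
  apply: (T01_chart cN Ne2 Ne (local_rep_comp rF rH2) rK).
  by rewrite (cdiff_comp v dfF dfH2).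
have : induced_cr N d (F y) (cdiff F y v).
  have := T01_chart cN Ne Ne' rK (local_rep_comp rF rH) (v := v).
  by rewrite (cdiff_comp v dfF dfH) => /(_ Tv) TH; exists e', H.
by rewrite -crF => -[w Vw /(congr1 (cdiff G (F y)))]; rewrite !Finj => <-.
Qed.

(** The (0,1)-equations a + i b = 0 for the image of [v] are the derivatives along [v] of the
    complex coordinates x + i y of [K]: the components of a CR map are CR functions. *)
Lemma T01_cderive n (K : 'rV[R]_n -> 'rV[R]_(2 + 2)) y v : differentiable K y ->
  T01 (cdiff K y v) <-> forall j, cderive v y (fun z => cvec (K z) 0 j) = 0.
Proof.
move=> dK.
have E j : (lsubmx (cdiff K y v) + 'i%C *: rsubmx (cdiff K y v)) 0 j =
    cderive v y (fun z => cvec (K z) 0 j).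
  have c1 : cdifferentiable y (fun z => (K z 0 (lshift 2 j))%:C%C).
    by apply/cdifferentiable_real/differentiable_entry.
  have c2 : cdifferentiable y (fun z => (K z 0 (rshift 2 j))%:C%C).
    by apply/cdifferentiable_real/differentiable_entry.
  have c3 : cdifferentiable y (fun z => 'i%C * (K z 0 (rshift 2 j))%:C%C).
    have dj := @differentiable_entry R _ _ _ K y 0 (rshift 2 j) dK.
    split.
      apply: (differentiable_near_eq (f := fun=> 0)) => //; apply: (near_open openT I) => z _ /=; ring.
    apply: (differentiable_near_eq _ dj); apply: (near_open openT I) => z _ /=; ring.
  rewrite [LHS]mxE [X in X + _]mxE [X in _ + X]mxE [X in _ * X]mxE.
  rewrite (cdiffE v 0 (lshift 2 j) dK) (cdiffE v 0 (rshift 2 j) dK) -(cderiveZ v 'i%C c2).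
  etransitivity; first by symmetry; exact: (cderiveD v c1 c3).
  by apply: (cderive_ext _ openT) => // z _; rewrite [RHS]mxE [in RHS]mxE [in RHS]mxE; apply: eqC => /=; ring.
rewrite T01P; split => [H j|H]; first by rewrite -E H mxE.
by apply/rowP => j; rewrite E H mxE.
Qed.

Lemma sphere_submanifold : submanifold 3 (cspace R 2) (@sphere3 R).
Proof. by split => // z; exact: sphere_chart. Qed.

Lemma E2_V_aspherical : ~ spherical (E2_space R) (@E2_V R).
Proof.
move=> sph; have [U [Q [f [oO O1 oQ fE]]]] := sph _ (E2_1 R).
have mE := @E2_manifold R; have mS := sphere_submanifold.
have covN := @cspace_covered R 2; have cN := @cspace_complex R 2.
have OS : Q `<=` @sphere3 R := oQ.1.
pose c := cay_param (1%:M : 'M[R]_3); have sc : atlas (E2_space R) c := cay_sub_param (E2_1 R).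
have c0 : pmap c 0 = 1%:M by rewrite /= cay0 mulmx1.
have cT x : pdom c x by [].
have Oc0 : U (pmap c 0) by rewrite c0.
have [d [F [e [H [sd rF Ne rH]]]]] := cr_equiv_on_rep covN mS OS fE sc (cT 0) Oc0.
have [W1 [oW1 W10 W1c sK rK]] := local_rep_near (local_rep_comp rF rH).
set K := fun y => H (F y) in sK rK.
have [W2 [oW2 W20 W2c XW]] := E2_field sc (cT 0).
(* On [W] the map to the sphere has a smooth representative, the invariant fields exist, and the
   points stay in the domain of the equivalence. *)
pose W := W1 `&` W2 `&` [set y | pdom c y /\ U (pmap c y)].
have oW : open W by apply: openI; [exact: openI|exact: oO.2].
have W0 : W 0 by split => //; split.
have WW1 y : W y -> W1 y by move=> [[]].
have WW2 y : W y -> W2 y by move=> [[]].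
have Wc : W `<=` pdom c by [].
have sub X : csmooth_on W2 X -> csmooth_on W X.
  by move=> [s1 s2]; split; apply: smooth_on_sub WW2 _.
have [X [/sub sX XE]] := XW 1 0 'i%C.
have [Y [/sub sY YE]] := XW 1 0 (- 'i%C).
have XE' y : W y -> cdiff (pmap c) y (X y) = tocmx (pmap c y) *m e2_mx 1 0 'i%C.
  by move=> /WW2; exact: XE.
have YE' y : W y -> cdiff (pmap c) y (Y y) = tocmx (pmap c y) *m e2_mx 1 0 (- 'i%C).
  by move=> /WW2; exact: YE.
have dc y : differentiable (pmap c) y by exact: (mx_param_diff sc).
have inj y v w := @mx_param_cdiff_inj R 3 _ c sc y v w (cT y).
have sN := csmooth_lie_bracket oW sX sY.
have NE := E2_bracket sc oW Wc sX sY XE' YE'.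
have ZE := E2_bracket sc oW Wc sN sY NE YE'.
pose u (j : 'I_2) y : R[i] := cvec (K y) 0 j.
have dK y : W y -> differentiable K y by move=> /WW1; exact: smooth_on_differentiable.
have TE y v : W y -> E2_V c y v <-> forall j, cderive v y (u j) = 0.
  move=> Wy; have [_ Oy] : [set y | pdom c y /\ U (pmap c y)] y by case: Wy.
  rewrite (cr_equiv_on_T01 v mE oO cN covN mS OS fE sc (cT y) Oy Ne (rK y (WW1 y Wy))).
  exact: (T01_cderive v (dK y Wy)).
apply: (no_spherical_frame (u := u) oW W0 sX sY).
- move=> y Wy; apply: (inj y); rewrite (cdiff_conj _ (dc y)) XE' // YE' // conjmx_tocmx_mul conjmx_e2.
  by rewrite rmorph1 rmorph0; congr (_ *m e2_mx _ _ _); apply: eqC => /=; rewrite ?oppr0.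
(* In matrices, [L, M] = (0, 2 i, 0) and its bracket with M = (1, 0, - i) is (2, 0, 0) = L + M. *)
- move=> y Wy; apply: (inj y); rewrite (cdiffD _ _ (dc y)) ZE // XE' // YE' // -mulmxDr; congr (_ *m _).
  by rewrite !e2_bracket e2_mxD; congr e2_mx; apply: eqC => /=; ring.
- move=> j; apply: (csmooth_comp oW (W := setT) (f := K) (u := fun v => cvec v 0 j)) => //.
    exact: smooth_on_sub WW1 sK.
  by apply: csmooth_cvec; exact: openT.
- move=> j y Wy; move: j; apply/(TE y (X y) Wy); rewrite /E2_V /left_line_field /= XE' //.
  by exists 1; rewrite ?scale1r ?e2_LE.
- move=> y Wy; have [_ Oy] : [set y | pdom c y /\ U (pmap c y)] y by case: Wy.
  have [_ _ EK _] := local_rep_at (rK y (WW1 y Wy)).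
  have [[g [fO _ _ _]] _] := fE; have [/OS] := fO _ Oy.
  by move: EK; rewrite Ne /= => <-.
(* If both derivatives vanished, conj L would lie in the line of L; the first entries make the
   factor 1, and then i = - i. *)
- move=> y Wy; apply: contrapT => nu.
  have : E2_V c y (Y y).
    apply/(TE y _ Wy) => j; apply/eqP/negPn/negP => nj; apply: nu; by exists j.
  rewrite /E2_V /left_line_field /= YE' // => -[l _]; rewrite scalemxAr e2_LE e2_mxZ.
  move=> /(mulmx_inj (E2_pt_unit sc (cT y))) /e2_mx_inj [].
  rewrite mulr1 => -> _; rewrite mul1r => /(congr1 (@complex.Im R)) /= /eqP.
  by rewrite -addr_eq0 -[1 + 1]/(2%:R) pnatr_eq0.
Qed.

End aspherical.

Theorem proposition7p1 (R : realType) :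
  (* (a) *)
  (forall W : cr_field R 'M[R]_3,
     cr_structure (E2_space R) W -> left_invariant W ->
     exists phi, E2_aut phi /\
       cr_equiv (E2_space R) W (E2_space R) (@E2_V R) phi) /\
  (* (b) *)
  [/\ cr_structure (E2_space R) (@E2_V R),
      left_invariant (@E2_V R) &
      ~ spherical (E2_space R) (@E2_V R)] /\
  (* (c) *)
  [/\ real_hypersurface (P_e2 R) (Ad_orbit (e2_L R)),
      exists f, cr_equiv (E2_space R) (@E2_V R)
        (sub_space 3 (P_e2 R) (Ad_orbit (e2_L R))) (induced_cr (P_e2 R)) f,
      real_hypersurface (cspace R 2) (@tube R) &
      exists f, cr_equiv
        (sub_space 3 (P_e2 R) (Ad_orbit (e2_L R))) (induced_cr (P_e2 R))
        (sub_space 3 (cspace R 2) (@tube R)) (induced_cr (cspace R 2)) f].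
Proof.
split; first exact: E2_classification.
split; first by split; [exact: E2_cr_structure|exact: E2_V_left_invariant|exact: E2_V_aspherical].
split.
- by split; [exact: P_complex|exact: orbit_submanifold].
- exact: E2_orbit_cr_equiv.
- by split; [exact: cspace_complex|exact: tube_submanifold].
- exact: orbit_tube_cr_equiv.
Qed.
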